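(* Let $G$ be a compact Hausdorff topological group and let $H\subset G$ be a closed subgroup such that the coset space $G/H$ is contractible. Then $H=G$.
   Context: $G/H$ denotes the space of left cosets $\{xH\mid x\in G\}$ with the quotient topology. All topological groups are assumed to be Hausdorff. *)

(* Defs.v *)
From HB Require Import structures.
From mathcomp Require Import all_boot all_order all_algebra generic_quotient.
From mathcomp Require Import all_classical all_reals all_analysis.
Import Order.TTheory GRing.Theory Num.Theory.
Import numFieldNormedType.Exports.

Set Implicit Arguments.
Unset Strict Implicit.
Unset Printing Implicit Defensive.

Local Open Scope classical_set_scope.
Local Open Scope quotient_scope.

HB.structure Definition PreTopologicalGroup := {G of Topological G & Group G}.

HB.mixin Record PreTopologicalGroup_isTopologicalGroup G
    & PreTopologicalGroup G := {
  mulg_continuous : continuous (fun x : G * G => (x.1 * x.2)%g) ;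
  invg_continuous : continuous (fun x : G => (x^-1)%g)
}.

(* The Hausdorff property is not part of the structure. *)
#[short(type="topologicalGroupType")]
HB.structure Definition TopologicalGroup :=
  {G of PreTopologicalGroup G & PreTopologicalGroup_isTopologicalGroup G}.

Section CosetSpace.
Local Open Scope group_scope.
Variables (G : topologicalGroupType) (H : set G).

Definition left_coset (x : G) : set G := [set x * h | h in H].

(* Two elements of G are identified when they have the same left coset, so the
   points of the quotient correspond to the left cosets of H. *)
Definition left_coset_rel : rel G :=
  fun x y => `[< left_coset x = left_coset y >].

Lemma left_coset_rel_refl : reflexive left_coset_rel.
Proof. by move=> x; apply/asboolP. Qed.

Lemma left_coset_rel_sym : symmetric left_coset_rel.
Proof. by move=> x y; apply/asboolP/asboolP. Qed.

Lemma left_coset_rel_trans : transitive left_coset_rel.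
Proof. by move=> y x z /asboolP xy /asboolP yz; apply/asboolP; rewrite xy. Qed.

Definition left_coset_equiv : equiv_rel G :=
  EquivRel left_coset_rel
    left_coset_rel_refl left_coset_rel_sym left_coset_rel_trans.

Definition coset_space : topologicalType :=
  quotient_topology {eq_quot left_coset_equiv}.

Lemma left_coset_relE (x y : G) : group_closed [in H] ->
  left_coset_rel x y = (x^-1 * y \in H).
Proof.
move=> HG; have HV := group_closedV HG; have HM := group_closedM HG.
case: HG => H1 _; apply/asboolP/idP => [xy|Hxy].
  have : left_coset x y by rewrite xy; exists 1; [exact: set_mem|rewrite mulg1].
  by move=> [h Hh <-]; rewrite mulKg; exact: mem_set.
apply/seteqP; split=> _ [h /mem_set Hh <-].
  exists ((x^-1 * y)^-1 * h); last by rewrite invgM invgK -!mulgA mulVKg.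
  by apply/set_mem; apply: HM => //; exact: HV.
exists (x^-1 * y * h); last by rewrite -!mulgA mulVKg.
by apply/set_mem; exact: HM.
Qed.

End CosetSpace.

Section Contractible.
Local Open Scope ring_scope.

(* R plays the role of the real numbers. *)
Definition homotopic (R : realType) (X Y : topologicalType) (f g : X -> Y) :=
  exists F : X * R -> Y,
    [/\ {within [set: X] `*` `[0, 1], continuous F},
        forall x, F (x, 0) = f x & forall x, F (x, 1) = g x].

Definition contractible (R : realType) (X : topologicalType) :=
  exists x0 : X, homotopic R idfun (cst x0).

End Contractible.

(* Main.v *)
(* Suppose that a contraction F of G/H exists and H <> G.  Haar averaging and a
   compact operator give finite-dimensional invariant spaces of continuous
   functions on G/H that separate points; this yields an orthogonal
   representation V0 of G and an equivariant map p0 : G/H -> V0 with p0(x0),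
   p0(x1) distinct, x0 being the end point of the contraction.  The path
   t |-> p0(F(x, t)) is followed in small time steps, each step being a gradient
   step along one-parameter groups of the image of G.  This produces a word
   g(x) = al_1(s_1(x)) ... al_m(s_m(x)) in one-parameter paths of G, with
   continuous s_i : G/H -> R, such that g(x) p0(x) is near p0(x0) for all x.
   The s_i are approximated by linear functionals of an equivariant map
   p : G/H -> W into a larger representation W = V0 + V1, and the one-parameter
   paths are lifted to W.  Cutting off the parameters then gives a continuous
   map Phi(u) = g(u) u of the whole vector space W, with g(u) in G and Phi = id
   far away.  Such a map is onto (Brouwer, proved here from a cup product
   computation on grids).  As g(u) lies in G, a solution of Phi(u) = p(x1) lies
   on the orbit p(G/H), and there the V0-component of Phi is close to p0(x0),
   hence different from p0(x1): a contradiction. *)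

Require Import Defs.
From mathcomp Require Import all_boot all_order all_algebra.
From mathcomp Require Import all_classical all_reals all_analysis.
From mathcomp Require Import generic_quotient ring lra.
Import Order.TTheory GRing.Theory Num.Theory.
Import numFieldNormedType.Exports.

Set Implicit Arguments.
Unset Strict Implicit.
Unset Printing Implicit Defensive.

Local Open Scope classical_set_scope.
Local Open Scope ring_scope.

(** * A mod 2 degree argument on grids *)

(** [G] need not be a Lie group and [G/H] need not be a manifold, so no degree of self-maps of [G/H]
    is at hand. The degree argument is therefore moved to a Euclidean space [W], where being the
    identity far away forces surjectivity; as [u |-> g(u) u] carries every orbit into itself,
    surjectivity on [W] gives surjectivity on the single orbit [p(G/H)]. This is why the contraction
    has to be tracked by group elements [g(x)] and not just by the points [F(x, t)]. A continuous
    section [G/H -> G] would supply [g(x)] at once, but none is given. The parameters must extend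
    from [G/H] to [W], which linear functionals of [p] do for free. Paths must be lifted because
    [V1] is chosen after the word, to approximate its parameters. Lie algebra and exponential map
    are bypassed: tangent directions are limits of difference quotients along a free ultrafilter,
    and a path is pinned down by multiplicativity together with a quadratic error bound. *)

Section GridCup.
Local Open Scope nat_scope.

Definition set_coord (v : nat -> nat) (d k : nat) : nat -> nat :=
  fun i => if i == d then k else v i.

Definition succ_coord d v := set_coord v d (v d).+1.

Definition diff_coord d (h : (nat -> nat) -> bool) v := h (succ_coord d v) (+) h v.

Definition del_coord (d : nat) D := [seq x <- D | x != d].

Lemma set_coord_comm v d d' k k' : d != d' ->
  set_coord (set_coord v d k) d' k' = set_coord (set_coord v d' k') d k.
Proof.
move=> /eqP dd'; apply/funext => i; rewrite /set_coord.
by case: (eqVneq i d') => // ->; case: eqP => // /esym.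
Qed.

Lemma succ_coord_comm v d d' : succ_coord d (succ_coord d' v) = succ_coord d' (succ_coord d v).
Proof.
have [->//|dd'] := eqVneq d d'; rewrite /succ_coord.
have -> : set_coord v d' (v d').+1 d = v d by rewrite /set_coord (negPf dd').
have -> : set_coord v d (v d).+1 d' = v d' by rewrite /set_coord eq_sym (negPf dd').
by rewrite set_coord_comm 1?eq_sym.
Qed.

Lemma set_coord_shift v d k : succ_coord d (set_coord v d k) = set_coord v d k.+1.
Proof. by apply/funext => i; rewrite /succ_coord /set_coord eqxx; case: eqP. Qed.

Lemma set_coord_shiftC v d d' k : d != d' -> succ_coord d (set_coord v d' k) = set_coord (succ_coord d v) d' k.
Proof. move=> dd'; rewrite /succ_coord set_coord_comm 1?eq_sym //.
by have -> : set_coord v d' k d = v d by rewrite /set_coord (negPf dd'). Qed.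

Lemma diff_coord_comm d d' h v : diff_coord d (diff_coord d' h) v = diff_coord d' (diff_coord d h) v.
Proof.
rewrite /diff_coord succ_coord_comm; case: (h _); case: (h _); case: (h _); by case: (h _).
Qed.

Lemma del_coord_comm d d' D : del_coord d (del_coord d' D) = del_coord d' (del_coord d D).
Proof. by rewrite /del_coord -!filter_predI; apply: eq_filter => x /=; rewrite andbC. Qed.

Lemma del_coord_id d D : d \notin D -> del_coord d D = D.
Proof.
by move=> dD; apply/all_filterP/allP => x xD; apply: contraNneq dD => <-.
Qed.

Lemma size_del d D : uniq D -> d \in D -> size D = (size (del_coord d D)).+1.
Proof.
move=> uD dD; have -> : del_coord d D = rem d D by rewrite rem_filter.
by rewrite size_rem // prednK //; case: D dD {uD}.
Qed.

(** Each pair of distinct directions is met in both orders, so the terms cancel mod 2; this is the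
    vanishing of a double coboundary. *)
Lemma big_addb_sym (D : seq nat) (X : nat -> nat -> bool) :
  (forall d d', X d d' = X d' d) ->
  \big[addb/false]_(d <- D) \big[addb/false]_(d' <- del_coord d D) X d d' = false.
Proof.
move=> Xs; under eq_bigr do rewrite big_filter.
elim: D => [|a D IH]; rewrite ?big_nil // big_cons big_cons eqxx /=.
rewrite [X in _ (+) X](eq_bigr (fun d => (if d != a then X a d else false) (+)
   \big[addb/false]_(d' <- D | d' != d) X d d')); last first.
  by move=> d _; rewrite big_cons eq_sym; case: ifP => //= _; rewrite Xs.
by rewrite big_split /= IH addbF -big_mkcond addbb.
Qed.

Variable f : nat -> (nat -> nat) -> bool.

(* The cup product of the coboundaries of the labels [f i], [i <- s], summed
   mod 2 over the maximal monotone paths of the unit cube spanned at [v] by the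
   directions in [D]. *)
Fixpoint cup (s D : seq nat) (v : nat -> nat) : bool :=
  if s is i :: s' then
    \big[addb/false]_(d <- D) (diff_coord d (f i) v && cup s' (del_coord d D) (succ_coord d v))
  else true.

Lemma diff_coord_big d (I : eqType) (r : seq I) (h : I -> (nat -> nat) -> bool) v :
  diff_coord d (fun w => \big[addb/false]_(i <- r) h i w) v =
  \big[addb/false]_(i <- r) diff_coord d (h i) v.
Proof. by rewrite /diff_coord -big_split. Qed.

(** The second part is the Leibniz rule [d(f u) = df u + f du] mod 2, where [f du] is killed by the
    closedness of [u = cup s]. Closedness in turn uses the second part for the tail of [s]: it turns
    [cup] into a sum of first differences and leaves symmetric second differences. Hence the joint
    induction. *)
Lemma cup_closed_stokes s : forall D v, uniq D -> size D = (size s).+1 ->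
  \big[addb/false]_(d <- D) diff_coord d (cup s (del_coord d D)) v = false /\
  forall i, cup (i :: s) D v =
    \big[addb/false]_(d <- D) diff_coord d (fun w => f i w && cup s (del_coord d D) w) v.
Proof.
have stokes_of_closed t D v i :
    \big[addb/false]_(d <- D) diff_coord d (cup t (del_coord d D)) v = false ->
    cup (i :: t) D v =
    \big[addb/false]_(d <- D) diff_coord d (fun w => f i w && cup t (del_coord d D) w) v.
  move=> Z; transitivity (cup (i :: t) D v (+)
      f i v && \big[addb/false]_(d <- D) diff_coord d (cup t (del_coord d D)) v).
    by rewrite Z andbF addbF.
  rewrite big_distrr -big_split /=; apply: eq_bigr => d _; rewrite /diff_coord.
  rewrite -/cup; by case: (f i _); case: (f i _); case: (cup _ _ _); case: (cup _ _ _).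
elim: s => [|j s IH] D v uD sD; last first.
  have Z : \big[addb/false]_(d <- D) diff_coord d (cup (j :: s) (del_coord d D)) v = false.
    pose X d d' := diff_coord d (diff_coord d' (fun w => f j w && cup s (del_coord d' (del_coord d D)) w)) v.
    rewrite -[RHS](@big_addb_sym D X); last first.
      by move=> d d'; rewrite /X diff_coord_comm del_coord_comm.
    rewrite big_seq [RHS]big_seq; apply: eq_bigr => d dD.
    rewrite -diff_coord_big; congr diff_coord; apply/funext => w.
    have sd : size (del_coord d D) = (size s).+1.
      by move: sD; rewrite (size_del uD dD) => -[].
    by have [_ ->] := IH _ w (filter_uniq _ uD) sd.
  by split=> // i; exact: stokes_of_closed.
have Z : \big[addb/false]_(d <- D) diff_coord d (cup [::] (del_coord d D)) v = false.
  by rewrite big1.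
by split=> // i; exact: stokes_of_closed.
Qed.

Fixpoint box (m : nat) (D : seq nat) (h : (nat -> nat) -> bool) v : bool :=
  if D is d :: D' then \big[addb/false]_(k < m) box m D' h (set_coord v d k) else h v.

Lemma eq_box m D h h' v : h =1 h' -> box m D h v = box m D h' v.
Proof. by move=> /funext ->. Qed.

Lemma box_big m D (I : eqType) (r : seq I) (h : I -> (nat -> nat) -> bool) v :
  box m D (fun w => \big[addb/false]_(i <- r) h i w) v =
  \big[addb/false]_(i <- r) box m D (h i) v.
Proof.
elim: D v => [//|d D IH] v /=; rewrite exchange_big /=.
by apply: eq_bigr => k _; rewrite IH.
Qed.

Lemma box_shift m D d h v : d \notin D ->
  box m D (fun w => h (succ_coord d w)) v = box m D h (succ_coord d v).
Proof.
elim: D v => [//|a D IH] v /=; rewrite inE negb_or => /andP[da dD].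
by apply: eq_bigr => k _; rewrite IH // set_coord_shiftC.
Qed.

Lemma box_diff_notin m D d h v : d \notin D ->
  box m D (diff_coord d h) v = diff_coord d (box m D h) v.
Proof.
move=> dD; rewrite /diff_coord -box_shift //.
elim: D v {dD} => [//|a D IH] v /=; rewrite -big_split /=.
by apply: eq_bigr => k _; rewrite IH.
Qed.

Lemma big_addb_telescope m (F : nat -> bool) :
  \big[addb/false]_(k < m) (F k.+1 (+) F k) = F m (+) F 0.
Proof.
elim: m => [|m IH]; first by rewrite big_ord0 addbb.
rewrite big_ord_recr /= IH.
by case: (F m); case: (F 0); case: (F m.+1).
Qed.

Lemma box_diff m D d h v : uniq D -> d \in D ->
  box m D (diff_coord d h) v =
  box m (del_coord d D) h (set_coord v d m) (+) box m (del_coord d D) h (set_coord v d 0).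
Proof.
rewrite /del_coord; elim: D v => [//|a D IH] v /= /andP[aD uD]; rewrite inE.
rewrite [a == d]eq_sym; case: (eqVneq d a) => [->|da] /= dD.
  rewrite -/(del_coord a D) del_coord_id // -(big_addb_telescope m (fun k => box m D h (set_coord v a k))).
  by apply: eq_bigr => k _; rewrite box_diff_notin // /diff_coord set_coord_shift.
rewrite -big_split /=; apply: eq_bigr => k _.
by rewrite IH // ![set_coord (set_coord v a k) d _]set_coord_comm 1?eq_sym.
Qed.

Lemma box_fixed m D d c h h' v : d \notin D -> v d = c ->
  (forall w, w d = c -> h w = h' w) -> box m D h v = box m D h' v.
Proof.
elim: D v => [|a D IH] v /=; first by move=> _ vd; exact.
rewrite inE negb_or => /andP[da dD] vd hh'; apply: eq_bigr => k _.
by apply: IH => //; rewrite /set_coord (negPf da).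
Qed.

Lemma box_false m D v : box m D (fun=> false) v = false.
Proof. by elim: D v => //= d D IH v; rewrite big1. Qed.

(** All paths stay in the face [w d = c], where [f d] is constant, so the difference contributed by
    the label [d] vanishes. *)
Lemma cup_face s D d c v : d \in s -> d \notin D -> v d = c ->
  (forall w w', w d = c -> w' d = c -> f d w = f d w') -> cup s D v = false.
Proof.
move=> + + + fc; elim: s D v => [//|i s IH] D v /=; rewrite inE => ds dD vd.
rewrite big_seq big1 // => e eD.
have ed : d != e by apply: contraNneq dD => ->.
have sd : succ_coord e v d = c by rewrite /succ_coord /set_coord (negPf ed).
case/predU1P: ds => [<-|ds]; first by rewrite /diff_coord (fc _ v) // addbb.
by rewrite IH ?andbF // mem_filter (negPf dD) andbF.
Qed.

(** Induction on the dimension. The Leibniz form of [cup] telescopes over the grid to its faces. On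
    the faces across a direction of the tail, [cup_face] applies. On the face [a = 0] the factor
    [f a] is false; on [a = m] it is true and leaves the same sum with one direction less. *)
Lemma box_cup m D v : uniq D ->
  (forall d w, w d = 0 -> f d w = false) ->
  (forall d w, w d = m -> f d w = true) ->
  box m D (cup D D) v = true.
Proof.
move=> + f0 fm; elim: D v => [//|a D IH] v uD.
have [aD uD'] : a \notin D /\ uniq D by move/andP: uD.
pose g d := fun w => f a w && cup D (del_coord d (a :: D)) w.
rewrite (@eq_box _ _ _ (fun w => \big[addb/false]_(d <- a :: D) diff_coord d (g d) w)).
  rewrite box_big (eq_big_seq (fun d => box m (del_coord d (a :: D)) (g d) (set_coord v d m)
    (+) box m (del_coord d (a :: D)) (g d) (set_coord v d 0))); last first.
    by move=> d dD; exact: box_diff.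
  have g_m d : d \in D -> box m (del_coord d (a :: D)) (g d) (set_coord v d m) = false.
    move=> dD; have dn : d \notin del_coord d (a :: D) by rewrite mem_filter eqxx.
    rewrite (@box_fixed m _ d m _ (fun=> false)) ?box_false // ?/set_coord ?eqxx //.
    move=> w wd; rewrite /g (@cup_face _ _ d m) ?andbF // => w1 w2 w1d w2d.
    by rewrite !fm.
  have g_0 d : d \in D -> box m (del_coord d (a :: D)) (g d) (set_coord v d 0) = false.
    move=> dD; have dn : d \notin del_coord d (a :: D) by rewrite mem_filter eqxx.
    rewrite (@box_fixed m _ d 0 _ (fun=> false)) ?box_false // ?/set_coord ?eqxx //.
    move=> w wd; rewrite /g (@cup_face _ _ d 0) ?andbF // => w1 w2 w1d w2d.
    by rewrite !f0.
  rewrite big_cons big_seq big1 ?addbF; last first.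
    by move=> d dD; rewrite g_m ?g_0.
  have aa : del_coord a (a :: D) = D by rewrite /del_coord /= eqxx; exact: del_coord_id.
  rewrite /g aa (@box_fixed m D a m _ (cup D D)) // ?/set_coord ?eqxx //; last first.
    by move=> w wa; rewrite fm.
  rewrite -/(set_coord _ _ _) IH // (@box_fixed m D a 0 _ (fun=> false)) // ?/set_coord ?eqxx //.
    by rewrite box_false.
  by move=> w wa; rewrite f0.
move=> w; have [_ ->] := cup_closed_stokes w uD (erefl : size (a :: D) = _).
by [].
Qed.

Lemma box_true m D h v : box m D h v ->
  exists w, h w /\ (forall d, d \in D -> w d < m).
Proof.
suff : box m D h v -> exists w, [/\ h w, (forall d, d \in D -> w d < m) &
    forall d, d \notin D -> w d = v d].
  by move=> /[apply] -[w []]; exists w.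
elim: D v => [|a D IH] v /=; first by move=> hv; exists v.
move=> B; have [k Bk] : exists k : 'I_m, box m D h (set_coord v a k).
  apply/existsP; apply: contraTT B => /existsPn B; rewrite big1 // => k _.
  exact/negbTE/B.
have [w [hw wD wn]] := IH _ Bk; exists w; split => // d; rewrite inE.
  have [dD _|dD] := boolP (d \in D); first exact: wD.
  by rewrite orbF => /eqP da; move: dD; rewrite da => dD; rewrite wn // /set_coord eqxx.
by rewrite negb_or => /andP[da dD]; rewrite wn // /set_coord (negPf da).
Qed.

Definition in_cell (w : nat -> nat) (u : nat -> nat) := forall i, w i <= u i <= (w i).+1.

Lemma cup_true s D w : cup s D w -> forall i, i \in s ->
  exists u u', [/\ in_cell w u, in_cell w u' , f i u & ~~ f i u'].
Proof.
(* A nonzero summand selects a monotone path in the cube, and the label [i] flips on the edge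
   assigned to it. Each direction is used at most once, so the bounds by [(j \in D)] keep the path
   inside the cell. *)
suff : cup s D w -> forall i, i \in s ->
  exists u u', [/\ forall j, w j <= u j <= w j + (j \in D),
    forall j, w j <= u' j <= w j + (j \in D), f i u & ~~ f i u'].
  move=> /[apply] + i => /[apply] -[u [u' [Hu Hu' fu fu']]]; exists u, u'; split=> //.
    by move=> j; have /andP[-> /leq_trans->] := Hu j; rewrite // -addn1 leq_add2l leq_b1.
  by move=> j; have /andP[-> /leq_trans->] := Hu' j; rewrite // -addn1 leq_add2l leq_b1.
elim: s D w => [//|a s IH] D w /= B.
have [d dD /andP[da cd]] : exists2 d, d \in D &
    diff_coord d (f a) w && cup s (del_coord d D) (succ_coord d w).
  apply/hasP; apply: contraTT B => /hasPn B; rewrite big_seq big1 // => d dD.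
  exact/negbTE/B.
have Hs j : w j <= succ_coord d w j <= w j + (j \in D).
  rewrite /succ_coord /set_coord; case: eqP => [->|_]; first by rewrite dD addn1 leqnSn leqnn.
  by rewrite leqnn leq_addr.
have Hw j : w j <= w j <= w j + (j \in D) by rewrite leqnn leq_addr.
move=> i; rewrite inE => /predU1P[->|si].
  move: da; rewrite /diff_coord; case fs : (f a (succ_coord d w)); case fw: (f a w) => // _.
    by exists (succ_coord d w), w; rewrite fs fw.
  by exists w, (succ_coord d w); rewrite fs fw.
have [u [u' [Hu Hu' fu fu']]] := IH _ _ cd i si.
have le2 (z : nat -> nat) :
    (forall j, succ_coord d w j <= z j <= succ_coord d w j + (j \in del_coord d D)) ->
    forall j, w j <= z j <= w j + (j \in D).
  move=> Hz j; have /andP[z1 z2] := Hz j; have /andP[s1 _] := Hs j.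
  rewrite (leq_trans s1 z1) (leq_trans z2) // mem_filter /succ_coord /set_coord.
  by case: eqP => [->|] //=; rewrite dD addn0 addn1.
by exists u, u'; split => //; exact: le2.
Qed.

(** A discrete Poincare-Miranda theorem: the mod 2 count over the grid is odd, so some cell has a
    nonzero cup product. *)
Lemma sign_change_cell n m :
  (forall d w, w d = 0 -> f d w = false) ->
  (forall d w, w d = m -> f d w = true) ->
  exists w, (forall d, d < n -> w d < m) /\ forall d, d < n ->
    exists u u', [/\ in_cell w u, in_cell w u', f d u & ~~ f d u'].
Proof.
move=> f0 fm; have := box_cup (fun=> 0) (iota_uniq 0 n) f0 fm.
move=> /box_true[w [cw wm]]; exists w; split=> d dn.
  by apply: wm; rewrite mem_iota.
by apply: (cup_true cw); rewrite mem_iota.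
Qed.

End GridCup.

(** * Ultrafilter limits and the Frobenius norm *)

Section UltraLimits.

(** A free ultrafilter serves as a universal subsequence: bounded sequences converge along it, so no
    subsequences have to be extracted. *)
Lemma ultra_nat : exists U : set_system nat, UltraFilter U /\ \oo `<=` U.
Proof. exact: ultraFilterLemma. Qed.

Lemma ultra_compact_cvg (I : Type) (U : set_system I) (T : topologicalType) (K : set T)
    (x : I -> T) :
  UltraFilter U -> compact K -> (forall k, K (x k)) ->
  exists2 p, K p & x @ U --> p.
Proof.
move=> UU cK Kx; have UP : ProperFilter U by exact: ultra_proper.
have [p [Kp clp]] : K `&` cluster (x @ U) !=set0.
  apply: cK; suff : U (x @^-1` K) by [].
  by apply: filterS (filterT : U setT) => k _; exact: Kx.
exists p => // V Vp; have [//|nV] := in_ultra_setVsetC (x @^-1` V) UU.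
by have [y [ny Vy]] := clp (~` V) V nV Vp.
Qed.

Lemma ultra_real_cvg (R : realType) (I : Type) (U : set_system I) (C : R) (a : I -> R) :
  UltraFilter U -> (forall k, `|a k| <= C) -> exists l : R, a @ U --> l.
Proof.
move=> UU aC.
have [|l _ al] := @ultra_compact_cvg _ U R _ a UU (@segment_compact R (- C) C).
  by move=> k /=; rewrite in_itv /= -ler_norml.
by exists l.
Qed.

End UltraLimits.

Section Frobenius.
Variable R : realType.
Implicit Types n k m : nat.

(** Common core of the Cauchy-Schwarz inequalities for matrices and for the invariant mean. *)
Lemma discriminant_le (a b c : R) : 0 <= c ->
  (forall t, 0 <= a + 2 * t * b + t ^+ 2 * c) -> b ^+ 2 <= a * c.
Proof.
move=> c0 H; have [c1|c1] := eqVneq c 0.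
  rewrite c1 mulr0; have [->|b0] := eqVneq b 0; first by rewrite expr0n.
  (* With [c = 0] the form is affine in [t] and takes the value [-1] here. *)
  have := H (- (a + 1) / (2 * b)); rewrite c1 mulr0 addr0.
  have -> : 2 * (- (a + 1) / (2 * b)) * b = - (a + 1) by field.
  by rewrite opprD addrA subrr sub0r ler0N1.
have cp : 0 < c by rewrite lt_neqAle eq_sym c1.
have := H (- b / c).
have -> : a + 2 * (- b / c) * b + (- b / c) ^+ 2 * c = (a * c - b ^+ 2) / c by field.
by rewrite pmulr_lge0 ?invr_gt0 // subr_ge0.
Qed.

Definition mxdot n k (A B : 'M[R]_(n, k)) : R := \sum_i \sum_j A i j * B i j.
Definition fro n k (A : 'M[R]_(n, k)) : R := Num.sqrt (mxdot A A).

Lemma mxdotE n k (A B : 'M[R]_(n, k)) : mxdot A B = \tr (A^T *m B).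
Proof.
rewrite /mxdot exchange_big /mxtrace; apply: eq_bigr => j _; rewrite mxE.
by apply: eq_bigr => i _; rewrite mxE.
Qed.

Lemma mxdotC n k (A B : 'M[R]_(n, k)) : mxdot A B = mxdot B A.
Proof. by apply: eq_bigr => i _; apply: eq_bigr => j _; rewrite mulrC. Qed.

Lemma mxdotDl n k (A B C : 'M[R]_(n, k)) : mxdot (A + B) C = mxdot A C + mxdot B C.
Proof. by rewrite !mxdotE linearD /= mulmxDl mxtraceD. Qed.

Lemma mxdotZl n k a (A B : 'M[R]_(n, k)) : mxdot (a *: A) B = a * mxdot A B.
Proof. by rewrite !mxdotE linearZ /= -scalemxAl mxtraceZ. Qed.

Lemma mxdotNl n k (A B : 'M[R]_(n, k)) : mxdot (- A) B = - mxdot A B.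
Proof. by rewrite -scaleN1r mxdotZl mulN1r. Qed.

Lemma mxdotDr n k (A B C : 'M[R]_(n, k)) : mxdot C (A + B) = mxdot C A + mxdot C B.
Proof. by rewrite mxdotC mxdotDl ![mxdot _ C]mxdotC. Qed.

Lemma mxdotZr n k a (A B : 'M[R]_(n, k)) : mxdot A (a *: B) = a * mxdot A B.
Proof. by rewrite mxdotC mxdotZl mxdotC. Qed.

Lemma mxdotNr n k (A B : 'M[R]_(n, k)) : mxdot A (- B) = - mxdot A B.
Proof. by rewrite mxdotC mxdotNl mxdotC. Qed.

Lemma mxdot_suml n k (I : Type) (r : seq I) (F : I -> 'M[R]_(n, k)) B :
  mxdot (\sum_(i <- r) F i) B = \sum_(i <- r) mxdot (F i) B.
Proof.
elim: r => [|i r IH]; last by rewrite !big_cons mxdotDl IH.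
by rewrite !big_nil -(scale0r (0 : 'M[R]_(n, k))) mxdotZl mul0r.
Qed.

Lemma mxdot_ge0 n k (A : 'M[R]_(n, k)) : 0 <= mxdot A A.
Proof. by apply: sumr_ge0 => i _; apply: sumr_ge0 => j _; rewrite -expr2 sqr_ge0. Qed.

Lemma fro_ge0 n k (A : 'M[R]_(n, k)) : 0 <= fro A. Proof. exact: sqrtr_ge0. Qed.

Lemma fro_sqr n k (A : 'M[R]_(n, k)) : fro A ^+ 2 = mxdot A A.
Proof. by rewrite sqr_sqrtr // mxdot_ge0. Qed.

Lemma mxdot_entry n k (A : 'M[R]_(n, k)) i j : A i j ^+ 2 <= mxdot A A.
Proof.
rewrite /mxdot (bigD1 i) //= (bigD1 j) //= -expr2 -addrA lerDl addr_ge0 //.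
  by apply: sumr_ge0 => l _; rewrite -expr2 sqr_ge0.
by apply: sumr_ge0 => l _; apply: sumr_ge0 => l' _; rewrite -expr2 sqr_ge0.
Qed.

Lemma fro_entry n k (A : 'M[R]_(n, k)) i j : `|A i j| <= fro A.
Proof.
rewrite -(ler_pXn2r (n := 2)) // ?nnegrE ?fro_ge0 //.
by rewrite fro_sqr real_normK ?num_real // mxdot_entry.
Qed.

Lemma fro_eq0 n k (A : 'M[R]_(n, k)) : fro A = 0 -> A = 0.
Proof.
move=> A0; apply/matrixP => i j; rewrite mxE; apply/eqP; rewrite -normr_le0.
by rewrite -A0 fro_entry.
Qed.

Lemma fro0 n k : fro (0 : 'M[R]_(n, k)) = 0.
Proof. by rewrite /fro -(scale0r (0 : 'M[R]_(n, k))) mxdotZl mul0r sqrtr0. Qed.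

Lemma fro_gt0 n k (A : 'M[R]_(n, k)) : A != 0 -> 0 < fro A.
Proof.
by move=> A0; rewrite lt_neqAle fro_ge0 andbT eq_sym; apply: contraNneq A0 => /fro_eq0 ->.
Qed.

Lemma mxdot_sqr_le n k (A B : 'M[R]_(n, k)) : mxdot A B ^+ 2 <= mxdot A A * mxdot B B.
Proof.
apply: discriminant_le => [|t]; first exact: mxdot_ge0.
have := mxdot_ge0 (A + t *: B).
rewrite mxdotDl !mxdotDr !mxdotZl !mxdotZr [mxdot B A]mxdotC.
by congr (_ <= _); ring.
Qed.

Lemma mxdot_le n k (A B : 'M[R]_(n, k)) : `|mxdot A B| <= fro A * fro B.
Proof.
rewrite -(ler_pXn2r (n := 2)) // ?nnegrE ?mulr_ge0 ?fro_ge0 //.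
by rewrite real_normK ?num_real // exprMn !fro_sqr mxdot_sqr_le.
Qed.

Lemma froD n k (A B : 'M[R]_(n, k)) : fro (A + B) <= fro A + fro B.
Proof.
rewrite -(ler_pXn2r (n := 2)) // ?nnegrE ?addr_ge0 ?fro_ge0 //.
rewrite fro_sqr sqrrD !fro_sqr mxdotDl !mxdotDr [mxdot B A]mxdotC.
have := mxdot_le A B; have := ler_norm (mxdot A B); lra.
Qed.

Lemma froN n k (A : 'M[R]_(n, k)) : fro (- A) = fro A.
Proof. by rewrite /fro mxdotNl mxdotNr opprK. Qed.

Lemma froZ n k a (A : 'M[R]_(n, k)) : fro (a *: A) = `|a| * fro A.
Proof.
by rewrite /fro mxdotZl mxdotZr mulrA -expr2 sqrtrM ?sqr_ge0 // sqrtr_sqr.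
Qed.

Lemma froB n k (A B : 'M[R]_(n, k)) : fro (A - B) = fro (B - A).
Proof. by rewrite -froN opprB. Qed.

Lemma fro_triangle n k (C A B : 'M[R]_(n, k)) : fro (A - B) <= fro (A - C) + fro (C - B).
Proof. by apply: le_trans (froD _ _); rewrite addrA subrK. Qed.

Lemma fro_sum n k (I : Type) (r : seq I) (F : I -> 'M[R]_(n, k)) :
  fro (\sum_(i <- r) F i) <= \sum_(i <- r) fro (F i).
Proof.
elim: r => [|i r IH]; first by rewrite !big_nil fro0.
by rewrite !big_cons (le_trans (froD _ _)) // lerD2l.
Qed.

Lemma froM n m k (A : 'M[R]_(n, m)) (B : 'M[R]_(m, k)) :
  fro (A *m B) <= fro A * fro B.
Proof.
rewrite -(ler_pXn2r (n := 2)) // ?nnegrE ?mulr_ge0 ?fro_ge0 //.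
rewrite exprMn !fro_sqr {1 2}/mxdot mulr_suml; apply: ler_sum => i _.
rewrite /mxdot [X in _ * X]exchange_big mulr_sumr /=; apply: ler_sum => j _.
have := mxdot_sqr_le (row i A) (col j B)^T.
rewrite -expr2 /mxdot !big_ord1.
have -> : (A *m B) i j = \sum_l row i A 0 l * (col j B)^T 0 l.
  by rewrite mxE; apply: eq_bigr => l _; rewrite !mxE.
move=> /le_trans -> //; rewrite le_eqVlt; apply/orP; left; apply/eqP.
by congr (_ * _); apply: eq_bigr => l _; rewrite !mxE.
Qed.

Definition orthogonal n (Q : 'M[R]_n) := Q^T *m Q = 1%:M.

Lemma orthogonalT n (Q : 'M[R]_n) : orthogonal Q -> Q *m Q^T = 1%:M.
Proof. exact: mulmx1C. Qed.

Lemma mxdot_orthl n k (Q : 'M[R]_n) (A B : 'M[R]_(n, k)) :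
  orthogonal Q -> mxdot (Q *m A) (Q *m B) = mxdot A B.
Proof.
by move=> oQ; rewrite !mxdotE trmx_mul -mulmxA [Q^T *m _]mulmxA oQ mul1mx.
Qed.

Lemma fro_orthl n k (Q : 'M[R]_n) (A : 'M[R]_(n, k)) :
  orthogonal Q -> fro (Q *m A) = fro A.
Proof. by move=> oQ; rewrite /fro mxdot_orthl. Qed.

Lemma fro_orthr n k (Q : 'M[R]_k) (A : 'M[R]_(n, k)) :
  orthogonal Q -> fro (A *m Q) = fro A.
Proof.
move=> oQ; rewrite /fro !mxdotE trmx_mul mxtrace_mulC !mulmxA -[A *m _ *m _]mulmxA.
by rewrite (orthogonalT oQ) mulmx1 mxtrace_mulC.
Qed.

End Frobenius.

(** * Entrywise convergence of matrices along a filter *)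

Section MatrixConvergence.
Variables (R : realType) (T : Type) (F : set_system T).
Context {FF : ProperFilter F}.

Definition mxcvg n k (A : T -> 'M[R]_(n, k)) (L : 'M[R]_(n, k)) :=
  forall i j, (fun t => A t i j) @ F --> L i j.

Lemma real_cvg_sum (I : Type) (r : seq I) (f : I -> T -> R) (l : I -> R) :
  (forall i, f i @ F --> l i) -> (fun t => \sum_(i <- r) f i t) @ F --> \sum_(i <- r) l i.
Proof.
move=> H; apply: (@cvg_big _ _ +%R 0 xpredT); last by move=> i _; exact: H.
exact: add_continuous.
Qed.

Lemma mxcvg_cst n k (L : 'M[R]_(n, k)) : mxcvg (fun=> L) L.
Proof. by move=> i j; exact: cvg_cst. Qed.

Lemma mxcvgD n k (A B : T -> 'M[R]_(n, k)) L M :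
  mxcvg A L -> mxcvg B M -> mxcvg (fun t => A t + B t) (L + M).
Proof.
move=> AL BM i j; rewrite mxE; under eq_fun do rewrite mxE.
by apply: cvgD; [exact: AL|exact: BM].
Qed.

Lemma mxcvgN n k (A : T -> 'M[R]_(n, k)) L :
  mxcvg A L -> mxcvg (fun t => - A t) (- L).
Proof.
by move=> AL i j; rewrite mxE; under eq_fun do rewrite mxE; apply: cvgN; exact: AL.
Qed.

Lemma mxcvgB n k (A B : T -> 'M[R]_(n, k)) L M :
  mxcvg A L -> mxcvg B M -> mxcvg (fun t => A t - B t) (L - M).
Proof. by move=> AL /mxcvgN; exact: mxcvgD. Qed.

Lemma mxcvgZ n k (a : T -> R) (l : R) (A : T -> 'M[R]_(n, k)) L :
  a @ F --> l -> mxcvg A L -> mxcvg (fun t => a t *: A t) (l *: L).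
Proof.
move=> al AL i j; rewrite mxE; under eq_fun do rewrite mxE.
by apply: cvgM => //; exact: AL.
Qed.

Lemma mxcvgM n m k (A : T -> 'M[R]_(n, m)) (B : T -> 'M[R]_(m, k)) L M :
  mxcvg A L -> mxcvg B M -> mxcvg (fun t => A t *m B t) (L *m M).
Proof.
move=> AL BM i j; rewrite mxE; under eq_fun do rewrite mxE.
by apply: real_cvg_sum => l; apply: cvgM; [exact: AL|exact: BM].
Qed.

Lemma mxcvg_mxdot n k (A B : T -> 'M[R]_(n, k)) L M :
  mxcvg A L -> mxcvg B M -> (fun t => mxdot (A t) (B t)) @ F --> mxdot L M.
Proof.
move=> AL BM; apply: real_cvg_sum => i; apply: real_cvg_sum => j.
by apply: cvgM; [exact: AL|exact: BM].
Qed.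

Lemma mxcvg_fro n k (A : T -> 'M[R]_(n, k)) L :
  mxcvg A L -> (fun t => fro (A t)) @ F --> fro L.
Proof.
move=> AL; apply: (cvg_comp _ _ (mxcvg_mxdot AL AL)); exact: sqrt_continuous.
Qed.

Lemma mxcvg_unique n k (A : T -> 'M[R]_(n, k)) L M : mxcvg A L -> mxcvg A M -> L = M.
Proof.
move=> AL AM; apply/matrixP => i j; apply: (cvg_unique _ (AL i j) (AM i j)).
exact: Rhausdorff.
Qed.

Lemma mxcvg_fro0 n k (A : T -> 'M[R]_(n, k)) L :
  (fun t => fro (A t - L)) @ F --> (0 : R) -> mxcvg A L.
Proof.
move=> AL i j; apply/cvgrPdist_lt => e e0.
have : \forall t \near F, `|fro (A t - L)| < e by exact: (cvgr0_norm_lt _ AL).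
apply: filterS => t.
rewrite ger0_norm ?fro_ge0 //; apply: le_lt_trans.
by rewrite distrC; apply: le_trans (fro_entry _ i j); rewrite !mxE.
Qed.

Lemma mxcvg_ultra n k C (A : T -> 'M[R]_(n, k)) : UltraFilter F ->
  (forall t, fro (A t) <= C) -> exists L, mxcvg A L.
Proof.
move=> FU AC; have H (ij : 'I_n * 'I_k) : exists l : R, (fun t => A t ij.1 ij.2) @ F --> l.
  by apply: (@ultra_real_cvg R _ F C) => t; apply: le_trans (AC t); exact: fro_entry.
have [l Hl] := choice H; exists (\matrix_(i, j) l (i, j)) => i j.
by rewrite mxE; exact: (Hl (i, j)).
Qed.

Lemma real_cvg_unique (f : T -> R) (a b : R) : f @ F --> a -> f @ F --> b -> a = b.
Proof. by move=> fa fb; apply: (cvg_unique _ fa fb); exact: Rhausdorff. Qed.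

Lemma real_cvg0_le (f g : T -> R) :
  g @ F --> (0 : R) -> (\forall t \near F, `|f t| <= g t) -> f @ F --> (0 : R).
Proof.
move=> g0 fg; apply/cvgrPdist_lt => e e0.
have : \forall t \near F, `|g t| < e by exact: (cvgr0_norm_lt _ g0).
apply: filterS2 fg => t fg gt.
rewrite sub0r normrN (le_lt_trans fg) // (le_lt_trans (ler_norm _)) //.
Qed.

End MatrixConvergence.

(** * Maps of Euclidean space that are the identity far away *)

Section Surjectivity.
Variables (R : realType) (n : nat) (U : set_system nat).
Hypotheses (UU : UltraFilter U) (Uoo : \oo `<=` U).
Let UP : ProperFilter U := ultra_proper (F := U).

Lemma harmonic_cvg_ultra : (fun k => k.+1%:R^-1 : R) @ U --> (0 : R).
Proof. by move=> V V0; apply: Uoo; exact: (@cvg_harmonic R). Qed.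

(** Labels record the sign of [Phi - y] in each coordinate on finer and finer grids of a large cube.
    Cells where all labels change shrink to a point [l], and continuity gives both inequalities in
    each coordinate of [Phi l = y]. Only limits along [U] are taken, so continuity is stated along
    [U]. *)
Lemma surjective_of_id_outside (Phi : 'cV[R]_n -> 'cV[R]_n) (r0 : R) :
  (forall (u : nat -> 'cV[R]_n) l, mxcvg U u l -> mxcvg U (Phi \o u) (Phi l)) ->
  (forall (u : 'cV[R]_n) i, r0 <= `|u i 0| -> Phi u = u) ->
  forall y, exists u, Phi u = y.
Proof.
move=> cPhi Phi_id y.
(* At least [r0], so that [Phi] is the identity on the faces of the cube [[-r, r]^n]; above every
   coordinate of [y] in absolute value, so that the labels on the faces are as [sign_change_cell]
   wants them. *)
pose r : R := `|r0| + fro y + 1.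
have r0r : r0 <= r by rewrite /r -addrA (le_trans (ler_norm _)) // lerDl addr_ge0 // fro_ge0.
have rgt0 : 0 < r by rewrite /r ltr_wpDl // addr_ge0 // fro_ge0.
have yr i : `|y i 0| < r.
  by rewrite /r addrAC (le_lt_trans (fro_entry y i 0)) // ltr_pwDl // ltr_wpDl.
pose pt (k : nat) (w : nat -> nat) : 'cV[R]_n :=
  \col_i (- r + 2 * r * k.+1%:R^-1 * (w i)%:R).
have pt0 k (w : nat -> nat) (i : 'I_n) : w i = 0%N -> pt k w i 0 = - r.
  by rewrite mxE => ->; rewrite mulr0 addr0.
have ptm k (w : nat -> nat) (i : 'I_n) : w i = k.+1 -> pt k w i 0 = r.
  by rewrite mxE => ->; rewrite mulfVK ?pnatr_eq0 //; lra.
(* Labels are indexed by all naturals; for [d >= n] the default [w d == k.+1] meets the face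
   conditions trivially. *)
pose lab k (d : nat) w := if insub d is Some i then y i 0 <= Phi (pt k w) i 0 else w d == k.+1.
have lab0 k d (w : nat -> nat) : w d = 0%N -> lab k d w = false.
  rewrite /lab; case: insubP => [i _ id_|_ ->//] wd.
  have wi : w i = 0%N by rewrite id_.
  rewrite (Phi_id _ i) pt0 ?normrN ?gtr0_norm //; apply/negbTE; rewrite -ltNge.
  by have := yr i; rewrite ltr_norml => /andP[].
have labm k d (w : nat -> nat) : w d = k.+1 -> lab k d w = true.
  rewrite /lab; case: insubP => [i _ id_|_] wd; last by rewrite wd eqxx.
  have wi : w i = k.+1 by rewrite id_.
  rewrite (Phi_id _ i) ptm ?gtr0_norm //.
  by have := yr i; rewrite ltr_norml => /andP[_ /ltW].
have cell k : exists w : nat -> nat, (forall i : 'I_n, (w i < k.+1)%N) /\ forall i : 'I_n,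
    exists uu : (nat -> nat) * (nat -> nat), [/\ in_cell w uu.1, in_cell w uu.2,
      y i 0 <= Phi (pt k uu.1) i 0 & Phi (pt k uu.2) i 0 <= y i 0].
  have [w [wm wc]] := sign_change_cell n (lab0 k) (labm k).
  exists w; split=> i; first exact: wm.
  have [u [u' [Hu Hu' lu lu']]] := wc i (ltn_ord i).
  exists (u, u'); split=> //; move: lu lu'; rewrite /lab valK //.
  by move=> _; rewrite -ltNge => /ltW.
have [w Hw] := choice cell.
have pt_bound k (z : nat -> nat) : (forall i : 'I_n, (z i <= k.+1)%N) ->
    forall i, `|pt k z i 0| <= r.
  move=> zk i; rewrite mxE ler_norml; have : 0 <= (k.+1%:R^-1 * (z i)%:R : R) <= 1.
    by rewrite mulr_ge0 ?invr_ge0 //= mulrC ler_pdivrMr ?ltr0n // mul1r ler_nat zk.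
  set q := _ * _ => /andP[q0 q1]; rewrite -mulrA -/q; apply/andP; split; first by nra.
  by nra.
have [l Hl] : exists l, mxcvg U (fun k => pt k (w k)) l.
  have H i : exists li : R, (fun k => pt k (w k) i 0) @ U --> li.
    apply: (@ultra_real_cvg R _ U r) => k; apply: pt_bound => j.
    by have [/(_ j)/ltnW] := Hw k.
  have [li Hli] := choice H; exists (\col_i li i) => i j.
  by rewrite mxE (ord1 j); exact: Hli.
(* A vertex of a cell differs from its base point by at most the mesh [2 r / (k + 1)] in each
   coordinate, so all vertices share one limit. *)
have near_cell (z : nat -> nat -> nat) : (forall k, in_cell (w k) (z k)) ->
    mxcvg U (fun k => pt k (z k)) l.
  move=> Hz i j; rewrite (ord1 j) -[l i 0]addr0.
  rewrite (_ : (fun k => _) = (fun k => pt k (w k) i 0) +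
      (fun k => pt k (z k) i 0 - pt k (w k) i 0)); last first.
    by apply/funext => k; rewrite fctE subrKC.
  apply: cvgD; first exact: Hl.
  apply: (@real_cvg0_le _ _ _ _ _ (fun k => 2 * r * k.+1%:R^-1)).
    by rewrite -[0](mulr0 (2 * r)); apply: cvgM; [exact: cvg_cst|exact: harmonic_cvg_ultra].
  apply: nearW => k; rewrite !mxE.
  have /andP[z1 z2] := Hz k i.
  set q := 2 * r / k.+1%:R.
  have -> : - r + q * (z k i)%:R - (- r + q * (w k i)%:R) = q * ((z k i)%:R - (w k i)%:R).
    by ring.
  have q0 : 0 <= q by rewrite mulr_ge0 ?invr_ge0 ?ler0n // mulr_ge0 // ltW.
  rewrite normrM (ger0_norm q0) ler_piMr //.
  rewrite -natrB // ger0_norm ?ler0n // -[1]/(1%:R) ler_nat leq_subLR addn1.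
  exact: z2.
exists l; apply/matrixP => i j; rewrite (ord1 j); apply/eqP; rewrite eq_le.
have /choice[uu Huu] : forall k, exists uu : (nat -> nat) * (nat -> nat),
    [/\ in_cell (w k) uu.1, in_cell (w k) uu.2,
      y i 0 <= Phi (pt k uu.1) i 0 & Phi (pt k uu.2) i 0 <= y i 0].
  by move=> k; have [_ /(_ i)] := Hw k.
apply/andP; split.
  have /cPhi/(_ i 0) c2 := near_cell (fun k => (uu k).2) (fun k => let: And4 _ h _ _ := Huu k in h).
  apply: (ler_cvg_to c2 (cvg_cst (y i 0))); apply: nearW => k /=.
  by have [] := Huu k.
have /cPhi/(_ i 0) c1 := near_cell (fun k => (uu k).1) (fun k => let: And4 h _ _ _ := Huu k in h).
apply: (ler_cvg_to (cvg_cst (y i 0)) c1); apply: nearW => k /=.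
by have [] := Huu k.
Qed.

End Surjectivity.

(** * The invariant mean of a compact group *)

Section RealContinuity.
Variables (R : realType) (T : topologicalType).
Implicit Types f g : T -> R.

Lemma ctsP f : continuous f <->
  forall x e, 0 < e -> \forall y \near x, `|f y - f x| < e.
Proof.
split=> [cf x e e0|H x].
  by have /cvgrPdist_lt/(_ e e0) := cf x; apply: filterS => y; rewrite distrC.
by apply/cvgrPdist_lt => e e0; apply: filterS (H x e e0) => y; rewrite distrC.
Qed.

Lemma cts_cst (c : R) : continuous (fun _ : T => c).
Proof. by move=> x; exact: cvg_cst. Qed.

Lemma ctsD f g : continuous f -> continuous g -> continuous (fun x => f x + g x).
Proof. by move=> cf cg x; apply: cvgD; [exact: cf|exact: cg]. Qed.

Lemma ctsN f : continuous f -> continuous (fun x => - f x).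
Proof. by move=> cf x; apply: cvgN; exact: cf. Qed.

Lemma ctsB f g : continuous f -> continuous g -> continuous (fun x => f x - g x).
Proof. by move=> cf cg; apply: ctsD => //; exact: ctsN. Qed.

Lemma ctsM f g : continuous f -> continuous g -> continuous (fun x => f x * g x).
Proof. by move=> cf cg x; apply: cvgM; [exact: cf|exact: cg]. Qed.

Lemma ctsX f n : continuous f -> continuous (fun x => f x ^+ n).
Proof.
move=> cf; elim: n => [|n IH]; first exact: cts_cst.
by rewrite (_ : (fun x => _) = fun x => f x * f x ^+ n); [exact: ctsM|apply/funext => x; rewrite exprS].
Qed.

Lemma cts_norm f : continuous f -> continuous (fun x => `|f x|).
Proof. by move=> cf x; apply: cvg_norm; exact: cf. Qed.

Lemma cts_max f g : continuous f -> continuous g -> continuous (fun x => Num.max (f x) (g x)).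
Proof.
move=> cf cg; rewrite (_ : (fun x => _) = fun x => 2^-1 * (f x + g x + `|f x - g x|)).
  by apply: ctsM; [exact: cts_cst|apply: ctsD; [exact: ctsD|exact/cts_norm/ctsB]].
apply/funext => x; case: (leP (f x) (g x)) => fg.
  by rewrite ler0_norm ?subr_le0 //; field.
by rewrite gtr0_norm ?subr_gt0 //; field.
Qed.

Lemma cts_sum (I : Type) (r : seq I) (P : pred I) (F : I -> T -> R) :
  (forall i, P i -> continuous (F i)) -> continuous (fun x => \sum_(i <- r | P i) F i x).
Proof.
move=> cF x; apply: (@cvg_big _ _ +%R 0 P); last by move=> i Pi; exact: cF.
exact: add_continuous.
Qed.

Lemma cts_comp (T' : topologicalType) (h : T' -> T) f :
  continuous f -> continuous h -> continuous (fun x => f (h x)).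
Proof. by move=> cf ch x; apply: (@continuous_comp _ _ _ h f); [exact: ch|exact: cf]. Qed.

Lemma compact_bounded_fun f : compact [set: T] -> continuous f ->
  exists2 C, 0 < C & forall x, `|f x| <= C.
Proof.
move=> cT cf.
have [[x0]|nT] := pselect (inhabited T); last first.
  by exists 1 => // x; case: nT.
have cn : {within [set: T], continuous (fun x => `|f x|)}.
  by apply/continuous_subspaceT/cts_norm.
have [x _ xmax] := compact_EVT_max (ex_intro _ x0 I) cT cn.
exists (`|f x| + 1); first by rewrite ltr_wpDl.
by move=> y; rewrite (le_trans (xmax y _)) ?in_setT // lerDl.
Qed.

Lemma finite_cover (V : T -> set T) : compact [set: T] ->
  (forall y, nbhs y (V y)) -> exists s : seq T, forall x, exists2 y, y \in s & V y x.
Proof.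
move=> /compact_near_coveringP cT nV.
(* Finite lists ordered by inclusion: a property holds near [F] once it holds for all lists
   containing some fixed one. *)
pose F := filter_from setT (fun s0 : seq T => [set s : seq T | {subset s0 <= s}]).
have FF : Filter F.
  apply: filter_from_filter; first by exists [::].
  move=> s1 s2 _ _; exists (s1 ++ s2) => // s sub.
  by split=> x xs; apply: sub; rewrite mem_cat xs ?orbT.
have := cT _ F (fun (s : seq T) x => exists2 y, y \in s & V y x) FF.
case.
  move=> x _; exists (V x, [set s : seq T | {subset [:: x] <= s}]).
    by split; [exact: nV|exists [:: x]].
  by move=> -[x' s] [/= Vx sub]; exists x => //; apply: sub; rewrite mem_head.
by move=> s _ /(_ s (fun x h => h)) Hs; exists s => x; exact: Hs.
Qed.

End RealContinuity.

(** The tube lemma; it supplies the uniform continuity of functions on the compact group. *)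
Lemma near_uniform (R : realType) (X Y : topologicalType) (F : X * Y -> R) (y0 : Y) (e : R) :
  compact [set: X] -> continuous F -> 0 < e ->
  \forall y \near y0, forall x, `|F (x, y) - F (x, y0)| < e.
Proof.
move=> /compact_near_coveringP cX cF e0.
have := cX _ (nbhs y0) (fun y x => `|F (x, y) - F (x, y0)| < e) _.
move=> H; have : \forall y \near y0, [set: X] `<=` (fun x => `|F (x, y) - F (x, y0)| < e).
  apply: H => x _.
  have e2 : 0 < e / 2 by rewrite divr_gt0.
  have /ctsP/(_ (x, y0) _ e2) [[A B] /= [Ax By] AB] := cF.
  exists (A, B) => //= -[x' y'] /= [Ax' By'].
  have h1 := AB (x', y') (conj Ax' By').
  have h2 := AB (x', y0) (conj Ax' (nbhs_singleton By)).
  rewrite (le_lt_trans (ler_distD (F (x, y0)) _ _)) // [e]splitr ltrD //.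
  by rewrite distrC.
by apply: filterS => y Hy x; exact: Hy.
Qed.

Section Averages.
Variables (R : realType) (T : Type).
Implicit Types (f g : T -> R) (s : seq T).

Definition avg s f : R := (size s)%:R^-1 * \sum_(a <- s) f a.

Lemma eq_avg s f g : f =1 g -> avg s f = avg s g.
Proof. by move=> fg; congr (_ * _); apply: eq_bigr. Qed.

Lemma avgD s f g : avg s (fun a => f a + g a) = avg s f + avg s g.
Proof. by rewrite /avg big_split mulrDr. Qed.

Lemma avgZ s c f : avg s (fun a => c * f a) = c * avg s f.
Proof. by rewrite /avg -mulr_sumr mulrCA. Qed.

Lemma avgN s f : avg s (fun a => - f a) = - avg s f.
Proof. by rewrite /avg sumrN mulrN. Qed.

Lemma avg_cst s c : (0 < size s)%N -> avg s (fun=> c) = c.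
Proof.
move=> s0; rewrite /avg big_const_seq count_predT iter_addr_0 -[c *+ _]mulr_natl mulrA.
by rewrite mulVf ?mul1r // pnatr_eq0 -lt0n.
Qed.

Lemma avg_le s f g : (forall a, f a <= g a) -> avg s f <= avg s g.
Proof. by move=> fg; rewrite /avg ler_wpM2l ?invr_ge0 // ler_sum. Qed.

Lemma avg_dist s f c e : (0 < size s)%N -> (forall a, `|f a - c| <= e) -> `|avg s f - c| <= e.
Proof.
move=> s0 H; rewrite ler_distl; apply/andP; split.
  by rewrite -[c - e](avg_cst _ s0); apply: avg_le => a; have := H a; rewrite ler_distl => /andP[].
by rewrite -[c + e](avg_cst _ s0); apply: avg_le => a; have := H a; rewrite ler_distl => /andP[].
Qed.

Lemma avg_allpairs (T1 T2 : Type) (s : seq T1) (t : seq T2) (h : T1 -> T2 -> T) f :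
  avg [seq h a b | a <- s, b <- t] f = (size s)%:R^-1 * \sum_(a <- s) ((size t)%:R^-1 * \sum_(b <- t) f (h a b)).
Proof.
rewrite /avg size_allpairs natrM invfM -mulrA; congr (_ * _).
rewrite -mulr_sumr; congr (_ * _).
by rewrite big_allpairs_dep.
Qed.

End Averages.

(** * The invariant mean as a limit of finite averages of translates *)

Section HaarMean.
Variables (R : realType) (G : topologicalGroupType).
Hypothesis cG : compact [set: G].
Implicit Types (f g : G -> R) (x y z : G).

Lemma cts_mulg (T : topologicalType) (u v : T -> G) :
  continuous u -> continuous v -> continuous (fun t => (u t * v t)%g).
Proof.
move=> cu cv t; apply: (@continuous_comp _ _ _ (fun t => (u t, v t)) (fun p => (p.1 * p.2)%g)).
  by apply: cvg_pair; [exact: cu|exact: cv].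
exact: mulg_continuous.
Qed.

Lemma cts_invg (T : topologicalType) (u : T -> G) :
  continuous u -> continuous (fun t => ((u t)^-1)%g).
Proof.
move=> cu t; apply: (@continuous_comp _ _ _ u (fun p => (p^-1)%g)); first exact: cu.
exact: invg_continuous.
Qed.

Lemma cts_fst (S T : topologicalType) : continuous (fun p : S * T => p.1).
Proof. by move=> x; exact: cvg_fst. Qed.

Lemma cts_snd (S T : topologicalType) : continuous (fun p : S * T => p.2).
Proof. by move=> x; exact: cvg_snd. Qed.

Lemma cts_id (T : topologicalType) : continuous (fun t : T => t).
Proof. by move=> x; exact: cvg_id. Qed.

Lemma cts_lmul a f : continuous f -> continuous (fun x => f (a * x)%g).
Proof.
move=> cf; apply: (cts_comp cf); apply: cts_mulg; last exact: cts_id.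
by move=> x; exact: cvg_cst.
Qed.

Lemma cts_rmul a f : continuous f -> continuous (fun x => f (x * a)%g).
Proof.
move=> cf; apply: (cts_comp cf); apply: cts_mulg; first exact: cts_id.
by move=> x; exact: cvg_cst.
Qed.

Lemma cts_inv f : continuous f -> continuous (fun x => f (x^-1)%g).
Proof. by move=> cf; apply: (cts_comp cf); apply: cts_invg; exact: cts_id. Qed.

Lemma cts_mul2 f : continuous f -> continuous (fun p : G * G => f (p.1 * p.2)%g).
Proof. by move=> cf; apply: (cts_comp cf); apply: cts_mulg; [exact: cts_fst|exact: cts_snd]. Qed.

Definition lavg s f x := avg s (fun a => f (a * x)%g).

(** The invariant mean in the manner of von Neumann: a constant in the uniform closure of the
    averages of translates, which avoids integration. *)
Definition is_lmean f c := forall e, 0 < e -> exists s : seq G,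
  (0 < size s)%N /\ forall x, `|lavg s f x - c| <= e.

Definition is_rmean f c := forall e, 0 < e -> exists s : seq G,
  (0 < size s)%N /\ forall x, `|avg s (fun a => f (x * a)%g) - c| <= e.

Lemma lavgM s t f x : lavg [seq (a * b)%g | a <- s, b <- t] f x = lavg t (lavg s f) x.
Proof.
rewrite /lavg avg_allpairs /avg -!mulr_sumr mulrCA; congr (_ * (_ * _)).
by rewrite exchange_big /=; apply: eq_bigr => b _; apply: eq_bigr => a _; rewrite mulgA.
Qed.

Lemma cts_lavg s f : continuous f -> continuous (lavg s f).
Proof.
move=> cf; apply: ctsM; first exact: cts_cst.
by apply: cts_sum => a _; exact: cts_lmul.
Qed.

Lemma avg_drop s f A d a0 : 0 <= d -> a0 \in s -> (forall a, f a <= A) -> f a0 <= A - d ->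
  avg s f <= A - (size s)%:R^-1 * d.
Proof.
move=> d0 a0s fA fa0; have s0 : (0 < size s)%N by case: s a0s.
rewrite -[X in X - _](avg_cst A s0) /avg -mulrBr ler_wpM2l ?invr_ge0 //.
have fgi (h : G -> R) : \sum_(a <- s) h a = h a0 + \sum_(a <- rem a0 s) h a.
  exact: big_rem.
rewrite !fgi addrAC lerD //; exact: ler_sum.
Qed.

(** The mean is the infimum of the uniform upper bounds of averages. If a nearly optimal average
    were low at a point [z], it would be low near [z]; averaging once more over finitely many
    translates, one of which brings any given point there, would push the upper bound below the
    infimum. *)
Lemma lmean_exists f : continuous f -> exists c, is_lmean f c.
Proof.
move=> cf; have [C C0 fC] := compact_bounded_fun cG cf.
pose E := [set m | exists2 s : seq G, (0 < size s)%N & forall x, lavg s f x <= m].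
have Eb : lbound E (- C).
  move=> m [s s0 /(_ 1%g)]; apply: le_trans; rewrite -[- C](avg_cst _ s0).
  by apply: avg_le => a; have := fC (a * 1)%g; rewrite ler_norml => /andP[].
have E0 : E !=set0.
  exists C, [:: 1%g] => // x; rewrite /lavg -[leRHS](avg_cst C (erefl : (0 < size [:: 1%g : G])%N)).
  by apply: avg_le => a; rewrite (le_trans (ler_norm _)).
have Einf : has_inf E by split=> //; exists (- C).
exists (inf E) => e e0; have e2 : 0 < e / 2 by rewrite divr_gt0.
have W1 := near_uniform 1%g cG (cts_mul2 cf) e2.
pose W := [set w | forall x, `|f (x * w)%g - f (x * 1)%g| < e / 2].
have [t tP] : exists t : seq G, forall x, exists2 y, y \in t & W (y^-1 * x)%g.
  apply: (@finite_cover _ (fun y => [set x | W (y^-1 * x)%g])) => // y.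
  have cy : continuous (fun x => (y^-1 * x)%g).
    by apply: cts_mulg; [move=> x; exact: cvg_cst|exact: cts_id].
  by apply: cy; rewrite mulVg; exact: W1.
have t0 : (0 < size t)%N by have [y] := tP 1%g; case: (t).
set N : R := (size t)%:R; have N0 : 0 < N by rewrite ltr0n.
(* One low value lowers an average over [N] translates by [e / (2 N)], twice the slack [e / (4 N)]
   with which the infimum is approached. *)
have eta0 : 0 < e / (4 * N) by rewrite divr_gt0 // mulr_gt0.
have etae : e / (4 * N) <= e.
  rewrite ler_pdivrMr ?mulr_gt0 //; have : 1 <= N by rewrite /N ler1n.
  by move: e0; clear; nra.
have [m [s s0 sm] mE] := inf_adherent eta0 Einf.
exists s; split=> // z; rewrite ler_distl; apply/andP; split; last first.
  by rewrite (le_trans (sm z)) // (le_trans (ltW mE)) // lerD2l.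
rewrite leNgt; apply/negP => hz.
suff : inf E <= inf E - e / (4 * N) by rewrite lerBrDr gerDl leNgt eta0.
apply: (ge_inf (ex_intro _ _ Eb)).
exists [seq (a * b)%g | a <- s, b <- [seq (z * y^-1)%g | y <- t]].
  by rewrite size_allpairs size_map muln_gt0 s0.
move=> x; rewrite lavgM; have [y yt Wy] := tP x.
set A := inf E + e / (4 * N).
have -> : inf E - e / (4 * N) = A - (size [seq (z * y^-1)%g | y <- t])%:R^-1 * (e / 2).
  by rewrite size_map -/N /A; field; rewrite gt_eqF.
apply: (@avg_drop _ _ _ _ (z * y^-1)%g); first exact: ltW.
- exact: map_f.
- by move=> a; rewrite (le_trans (sm _)) // ltW.
- rewrite -mulgA; set w := (y^-1 * x)%g.
  have : `|lavg s f (z * w)%g - lavg s f z| <= e / 2.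
    rewrite /lavg -(avgN s (fun a => f (a * z)%g)) -avgD -[X in `|X|]subr0; apply: avg_dist => // a.
    by rewrite subr0 ltW // mulgA; have := Wy (a * z)%g; rewrite mulg1.
  rewrite ler_distl => /andP[_ /le_trans]; apply; rewrite /A; move: hz eta0.
  set q := e / (4 * N); set i := inf E; set l := lavg _ _ _; lra.
Qed.

Lemma rmean_exists f : continuous f -> exists c, is_rmean f c.
Proof.
move=> cf; have [c Hc] := lmean_exists (cts_inv cf); exists c => e e0.
have [s [s0 Hs]] := Hc e e0; exists [seq (a^-1)%g | a <- s]; rewrite size_map; split=> // x.
rewrite (_ : avg _ _ = lavg s (fun x => f (x^-1)%g) (x^-1)%g) //.
by rewrite /lavg /avg size_map big_map; congr (_ * _); apply: eq_bigr => a _; rewrite invgM invgK.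
Qed.

(** Averaging on both sides at once approximates both constants. That any left mean equals any right
    mean gives the uniqueness of each. *)
Lemma lmean_rmean f c c' : is_lmean f c -> is_rmean f c' -> c = c'.
Proof.
move=> Hc Hc'; apply/eqP; rewrite -subr_eq0 -normr_le0; apply/ler_addgt0Pl => e e0.
rewrite addr0; have e2 : 0 < e / 2 by rewrite divr_gt0.
have [s [s0 Hs]] := Hc _ e2; have [t [t0 Ht]] := Hc' _ e2.
pose d := avg t (fun b => lavg s f b).
have dc : `|d - c| <= e / 2 by apply: avg_dist.
have dc' : `|d - c'| <= e / 2.
  have -> : d = avg s (fun a => avg t (fun b => f (a * b)%g)).
    rewrite /d /lavg /avg -!mulr_sumr mulrCA; congr (_ * (_ * _)); exact: exchange_big.
  exact: avg_dist.
by rewrite (le_trans (ler_distD d _ _)) // [e]splitr lerD // distrC.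
Qed.

(** The default [0] only concerns functions without a mean; continuous functions have one. *)
Definition mean f : R := xget 0 [set c | is_lmean f c].

Lemma mean_l f : continuous f -> is_lmean f (mean f).
Proof. by move=> /lmean_exists [c Hc]; rewrite /mean; case: xgetP => [//|/(_ c)]. Qed.

Lemma mean_r f : continuous f -> is_rmean f (mean f).
Proof. by move=> cf; have [c Hc] := rmean_exists cf; rewrite (lmean_rmean (mean_l cf) Hc). Qed.

Lemma mean_unique_l f c : continuous f -> is_lmean f c -> mean f = c.
Proof. by move=> cf Hc; rewrite (lmean_rmean Hc (mean_r cf)). Qed.

Lemma mean_unique_r f c : continuous f -> is_rmean f c -> mean f = c.
Proof. by move=> cf Hc; rewrite (lmean_rmean (mean_l cf) Hc). Qed.

(** Left translation commutes with averaging on the right, so the right averages of [f] serve for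
    its translate. *)
Lemma mean_lmul a f : continuous f -> mean (fun x => f (a * x)%g) = mean f.
Proof.
move=> cf; apply: mean_unique_r; first exact: cts_lmul.
move=> e e0; have [s [s0 Hs]] := mean_r cf e0; exists s; split=> // x.
by under eq_avg do rewrite mulgA.
Qed.

Lemma mean_rmul a f : continuous f -> mean (fun x => f (x * a)%g) = mean f.
Proof.
move=> cf; apply: mean_unique_l; first exact: cts_rmul.
move=> e e0; have [s [s0 Hs]] := mean_l cf e0; exists s; split=> // x.
by rewrite /lavg; under eq_avg do rewrite -mulgA; exact: Hs.
Qed.

Lemma mean_lavg s f : (0 < size s)%N -> continuous f -> mean (lavg s f) = mean f.
Proof.
move=> s0 cf; apply: mean_unique_r; first exact: cts_lavg.
move=> e e0; have [t [t0 Ht]] := mean_r cf e0; exists t; split=> // x.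
have -> : avg t (fun b => lavg s f (x * b)%g) = avg s (fun a => avg t (fun b => f (a * x * b)%g)).
  rewrite /lavg /avg -!mulr_sumr mulrCA; congr (_ * (_ * _)).
  rewrite exchange_big; apply: eq_bigr => a _; apply: eq_bigr => b _.
  by rewrite mulgA.
exact: avg_dist.
Qed.

(** Lists are composed: a further average keeps nearly constant functions nearly constant and treats
    the next function without changing its mean. One list for several functions is what gives
    monotonicity and additivity. *)
Lemma mean_common (fs : seq (G -> R)) e : (forall i, (i < size fs)%N -> continuous (nth (fun=> 0) fs i)) ->
  0 < e -> exists2 s : seq G, (0 < size s)%N &
  forall i, (i < size fs)%N -> forall x, `|lavg s (nth (fun=> 0) fs i) x - mean (nth (fun=> 0) fs i)| <= e.
Proof.
move=> + e0; elim: fs => [|f fs IH] cfs; first by exists [:: 1%g].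
have [s s0 Hs] := IH (fun i => cfs i.+1); have cf := cfs 0%N isT; rewrite /= in cf.
have [t [t0 Ht]] := mean_l (cts_lavg (s := s) cf) e0.
exists [seq (a * b)%g | a <- s, b <- t]; first by rewrite size_allpairs muln_gt0 s0.
move=> [_|i si] x; rewrite lavgM.
  by rewrite -[mean _](mean_lavg s0 cf) //; exact: Ht.
by apply: avg_dist => // b; exact: Hs.
Qed.

Lemma mean_common2 f g e : continuous f -> continuous g -> 0 < e ->
  exists2 s : seq G, (0 < size s)%N & `|avg s f - mean f| <= e /\ `|avg s g - mean g| <= e.
Proof.
move=> cf cg e0; have [|s s0 Hs] := @mean_common [:: f; g] e _ e0.
  by case=> [|[|]].
exists s => //; have := Hs 0%N isT 1%g; have := Hs 1%N isT 1%g; rewrite /lavg /=.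
under eq_avg do rewrite mulg1; move=> h1.
by under eq_avg do rewrite mulg1; move=> h2.
Qed.

Lemma mean_cst c : mean (fun=> c) = c.
Proof.
apply: mean_unique_l => [|e e0]; first exact: cts_cst.
exists [:: 1%g]; split=> // x; rewrite /lavg avg_cst // subrr normr0; exact: ltW.
Qed.

Lemma real_eq_eps (a b : R) : (forall e, 0 < e -> `|a - b| <= e) -> a = b.
Proof.
move=> H; apply/eqP; rewrite -subr_eq0 -normr_le0; apply/ler_addgt0Pl => e e0.
by rewrite addr0; exact: H.
Qed.

Lemma mean_le f g : continuous f -> continuous g -> (forall x, f x <= g x) -> mean f <= mean g.
Proof.
move=> cf cg fg; apply/ler_addgt0Pl => e e0; have e2 : 0 < e / 2 by rewrite divr_gt0.
have [s s0 [sf sg]] := mean_common2 cf cg e2; have := avg_le s fg.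
move: sf sg; rewrite !ler_distl => /andP[h1 _] /andP[_ h2].
by move: h1 h2; set p := e / 2 => ? ? ?; rewrite [e]splitr -/p; lra.
Qed.

Lemma meanZ c f : continuous f -> mean (fun x => c * f x) = c * mean f.
Proof.
move=> cf; apply: mean_unique_l => [|e e0]; first by apply: ctsM => //; exact: cts_cst.
have c1 : 0 < `|c| + 1 by rewrite ltr_wpDl.
have ec : 0 < e / (`|c| + 1) by rewrite divr_gt0.
have [s [s0 Hs]] := mean_l cf ec; exists s; split=> // x.
rewrite /lavg avgZ -mulrBr normrM; apply: (@le_trans _ _ (`|c| * (e / (`|c| + 1)))).
  by rewrite ler_wpM2l //; exact: Hs.
by rewrite mulrCA ler_piMr ?ltW // ltr_pdivrMr // mul1r ltrDl.
Qed.

Lemma meanD f g : continuous f -> continuous g -> mean (fun x => f x + g x) = mean f + mean g.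
Proof.
move=> cf cg; apply: real_eq_eps => e e0; have e3 : 0 < e / 3 by rewrite divr_gt0.
have [|s s0 Hs] := @mean_common [:: f; g; fun x => f x + g x] (e / 3) _ e3.
  by case=> [|[|[|]]] //= _; exact: ctsD.
have := Hs 0%N isT 1%g; have := Hs 1%N isT 1%g; have := Hs 2%N isT 1%g; rewrite /lavg /= avgD.
set A := avg _ _; set B := avg _ _; rewrite !ler_distl => /andP[h1 h2] /andP[h3 h4] /andP[h5 h6].
have -> : e = e / 3 + e / 3 + e / 3 by field.
move: (e / 3) h1 h2 h3 h4 h5 h6 => q *; apply/andP; split; lra.
Qed.

Lemma meanN f : continuous f -> mean (fun x => - f x) = - mean f.
Proof.
move=> cf; rewrite -mulN1r -meanZ //; congr mean; apply/funext => x; by rewrite mulN1r.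
Qed.

Lemma meanB f g : continuous f -> continuous g -> mean (fun x => f x - g x) = mean f - mean g.
Proof. by move=> cf cg; rewrite meanD ?meanN //; exact: ctsN. Qed.

Lemma mean_sum (I : Type) (r : seq I) (F : I -> G -> R) : (forall i, continuous (F i)) ->
  mean (fun x => \sum_(i <- r) F i x) = \sum_(i <- r) mean (F i).
Proof.
move=> cF; elim: r => [|i r IH].
  by rewrite big_nil -[RHS]mean_cst; congr mean; apply/funext => x; rewrite big_nil.
rewrite big_cons -IH -meanD //; last by apply: cts_sum.
by congr mean; apply/funext => x; rewrite big_cons.
Qed.

Lemma mean_ge0 f : continuous f -> (forall x, 0 <= f x) -> 0 <= mean f.
Proof. by move=> cf f0; rewrite -(mean_cst 0); apply: mean_le => //; exact: cts_cst. Qed.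

Lemma mean_dist_le f g e : continuous f -> continuous g -> (forall x, `|f x - g x| <= e) ->
  `|mean f - mean g| <= e.
Proof.
move=> cf cg H; rewrite -meanB // ler_norml; apply/andP; split.
  rewrite -[- e]mean_cst; apply: mean_le; [exact: cts_cst|exact: ctsB|move=> x].
  by have := H x; rewrite ler_norml => /andP[].
rewrite -[e]mean_cst; apply: mean_le; [exact: ctsB|exact: cts_cst|move=> x].
by have := H x; rewrite ler_norml => /andP[].
Qed.

Lemma mean_norm_le f g : continuous f -> continuous g -> (forall x, `|f x| <= g x) ->
  `|mean f| <= mean g.
Proof.
move=> cf cg H; rewrite ler_norml -meanN //; apply/andP; split; apply: mean_le => //.
- exact: ctsN.
- by move=> x; have := H x; rewrite ler_norml => /andP[].
- by move=> x; have := H x; rewrite ler_norml => /andP[].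
Qed.

(** By compactness, at every point one of finitely many translates of [f] exceeds [f x0 / 2]. Their
    sum has positive mean, and that mean is a multiple of [mean f]. *)
Lemma mean_gt0 f x0 : continuous f -> (forall x, 0 <= f x) -> 0 < f x0 -> 0 < mean f.
Proof.
move=> cf f0 fx0.
have [s Hs] : exists s : seq G, forall x, exists2 y, y \in s & f x0 / 2 < f (x0 * y^-1 * x)%g.
  apply: (@finite_cover _ (fun y => [set x | f x0 / 2 < f (x0 * y^-1 * x)%g])) => // y.
  have h2 : 0 < f x0 / 2 by rewrite divr_gt0.
  have := iffLR (ctsP _) (cts_lmul (a := (x0 * y^-1)%g) cf) y (f x0 / 2) h2.
  rewrite -mulgA mulVg mulg1; apply: filterS => x; rewrite ltr_distl => /andP[+ _].
  by apply: le_lt_trans; lra.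
have cF y : continuous (fun x => f (x0 * y^-1 * x)%g) by exact: cts_lmul.
have : f x0 / 2 <= mean (fun x => \sum_(y <- s) f (x0 * y^-1 * x)%g).
  rewrite -[leLHS]mean_cst; apply: mean_le; [exact: cts_cst|exact: cts_sum|move=> x].
  have [y ys /ltW h] := Hs x; rewrite (le_trans h) // (big_rem y) //= lerDl.
  exact: sumr_ge0.
rewrite mean_sum // (eq_bigr (fun=> mean f)); last by move=> y _; rewrite mean_lmul.
move=> h; rewrite lt_neqAle eq_sym mean_ge0 // andbT; apply/eqP => m0.
by move: h; rewrite m0 big1 // leNgt divr_gt0.
Qed.

Lemma mean_cauchy_schwarz f g : continuous f -> continuous g ->
  mean (fun x => f x * g x) ^+ 2 <= mean (fun x => f x ^+ 2) * mean (fun x => g x ^+ 2).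
Proof.
move=> cf cg; have cg2 : continuous (fun x => g x ^+ 2) by exact: ctsX.
have cf2 : continuous (fun x => f x ^+ 2) by exact: ctsX.
have cfg : continuous (fun x => f x * g x) by exact: ctsM.
apply: discriminant_le => [|t]; first by apply: mean_ge0 => // x; rewrite sqr_ge0.
rewrite -!meanZ // -meanD //; last by apply: ctsM => //; exact: cts_cst.
rewrite -meanD; last 2 first.
- by apply: ctsD => //; apply: ctsM => //; exact: cts_cst.
- by apply: ctsM => //; exact: cts_cst.
rewrite (_ : (fun x => _) = fun x => (f x + t * g x) ^+ 2); last by apply/funext => x; ring.
apply: mean_ge0 => [|x]; last by rewrite sqr_ge0.
by apply: ctsX; apply: ctsD => //; apply: ctsM => //; exact: cts_cst.
Qed.

Lemma cts_slice_l (F : G * G -> R) y : continuous F -> continuous (fun x => F (x, y)).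
Proof.
move=> cF; apply: (cts_comp cF) => x; apply: cvg_pair; [exact: cvg_id|exact: cvg_cst].
Qed.

Lemma cts_slice_r (F : G * G -> R) x : continuous F -> continuous (fun y => F (x, y)).
Proof.
move=> cF; apply: (cts_comp cF) => y; apply: cvg_pair; [exact: cvg_cst|exact: cvg_id].
Qed.

Lemma cts_swap (F : G * G -> R) : continuous F -> continuous (fun p => F (p.2, p.1)).
Proof.
move=> cF; apply: (cts_comp cF) => p; apply: cvg_pair; [exact: cts_snd|exact: cts_fst].
Qed.

Lemma cts_mean (F : G * G -> R) : continuous F -> continuous (fun x => mean (fun y => F (x, y))).
Proof.
move=> cF; apply/ctsP => x e e0; have e2 : 0 < e / 2 by rewrite divr_gt0.
have := near_uniform x cG (cts_swap cF) e2; apply: filterS => x' Hx'.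
apply: (@le_lt_trans _ _ (e / 2)); last by rewrite ltr_pdivrMr // ltr_pMr // ltr1n.
by apply: mean_dist_le => [||y]; [exact: cts_slice_r|exact: cts_slice_r|exact/ltW/Hx'].
Qed.

(** Finite averages commute with [mean], so one list that averages all slices [F (-, y)] well
    suffices. Compactness reduces these to finitely many slices; a general slice costs three errors
    [e / 4], the outer function a fourth. *)
Lemma mean_fubini (F : G * G -> R) : continuous F ->
  mean (fun x => mean (fun y => F (x, y))) = mean (fun y => mean (fun x => F (x, y))).
Proof.
move=> cF; apply: real_eq_eps => e e0; have e4 : 0 < e / 4 by rewrite divr_gt0.
have [ys Hys] : exists ys : seq G, forall y, exists2 y', y' \in ys &
    forall x, `|F (x, y) - F (x, y')| < e / 4.
  apply: (@finite_cover _ (fun y' => [set y | forall x, `|F (x, y) - F (x, y')| < e / 4])) => // y'.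
  exact: near_uniform.
pose m x := mean (fun y => F (x, y)); have cm : continuous m by exact: cts_mean.
have [|s s0 Hs] := @mean_common (m :: [seq (fun x => F (x, y)) | y <- ys]) _ _ e4.
  case=> [_ //|i]; rewrite /= ltnS size_map => si.
  by rewrite (nth_map 1%g) //; exact: cts_slice_l.
have sm : `|avg s m - mean m| <= e / 4.
  by have := Hs 0%N isT 1%g; rewrite /lavg; under eq_avg do rewrite mulg1.
have sF y : `|avg s (fun x => F (x, y)) - mean (fun x => F (x, y))| <= e / 4 + e / 4 + e / 4.
  have [y' y's Hy'] := Hys y.
  have h1 : `|avg s (fun x => F (x, y')) - mean (fun x => F (x, y'))| <= e / 4.
    have := Hs (index y' ys).+1; rewrite /= ltnS size_map index_mem => /(_ y's 1%g).
    by rewrite (nth_map 1%g) ?index_mem // nth_index // /lavg; under eq_avg do rewrite mulg1.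
  have h2 : `|mean (fun x => F (x, y)) - mean (fun x => F (x, y'))| <= e / 4.
    by apply: mean_dist_le => [||x]; [exact: cts_slice_l|exact: cts_slice_l|exact/ltW].
  have h3 : `|avg s (fun x => F (x, y)) - avg s (fun x => F (x, y'))| <= e / 4.
    by rewrite -avgN -avgD -[X in `|X|]subr0; apply: avg_dist => // x; rewrite subr0 ltW.
  move: h1 h2 h3; rewrite !ler_distl => /andP[a1 a2] /andP[a3 a4] /andP[a5 a6].
  by move: (e / 4) a1 a2 a3 a4 a5 a6 => q *; apply/andP; split; lra.
have cs : continuous (fun y => avg s (fun x => F (x, y))).
  apply: ctsM; first exact: cts_cst.
  by apply: cts_sum => x _; exact: cts_slice_r.
have savg : avg s m = mean (fun y => avg s (fun x => F (x, y))).
  rewrite /avg meanZ; last by apply: cts_sum => x _; exact: cts_slice_r.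
  by rewrite mean_sum // => x; exact: cts_slice_r.
have cmx : continuous (fun y => mean (fun x => F (x, y))).
  exact: (cts_mean (cts_swap cF)).
have := mean_dist_le cs cmx sF; rewrite -savg; move: sm; rewrite -/m !ler_distl.
move=> /andP[a1 a2] /andP[a3 a4]; rewrite -/(m _).
have -> : e = e / 4 + e / 4 + e / 4 + e / 4 by field.
by move: (e / 4) a1 a2 a3 a4 => q *; apply/andP; split; lra.
Qed.

End HaarMean.

(** * Finite-dimensional invariant spaces of functions *)

Lemma norm_le_of_sqr (R : realType) (y b : R) : 0 <= b -> y ^+ 2 <= b ^+ 2 -> `|y| <= b.
Proof.
by move=> b0 h; rewrite -(ler_pXn2r (n := 2)) ?nnegrE // real_normK ?num_real.
Qed.

(** Serves for the modulus of continuity that localises the kernel in [peter_weyl], and for making a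
    Urysohn function invariant under [H]. *)
Lemma cts_sup (R : realType) (X Y : topologicalType) (A : set X) (F : X * Y -> R) :
  compact [set: X] -> A !=set0 -> continuous F ->
  [/\ continuous (fun y => sup [set F (x, y) | x in A]),
      (forall x y, A x -> F (x, y) <= sup [set F (x, y) | x in A]) &
      (forall y b, (forall x, A x -> F (x, y) <= b) -> sup [set F (x, y) | x in A] <= b)].
Proof.
move=> cX [x0 Ax0] cF.
have cFx y : continuous (fun x => F (x, y)).
  by apply: (cts_comp cF) => x; apply: cvg_pair; [exact: cvg_id|exact: cvg_cst].
have F_ub y : has_sup [set F (x, y) | x in A].
  split; first by exists (F (x0, y)), x0.
  have [C C0 HC] := compact_bounded_fun cX (cFx y).
  by exists C => _ [x Ax <-]; rewrite (le_trans (ler_norm _)).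
have Fle x y : A x -> F (x, y) <= sup [set F (x, y) | x in A].
  by move=> Ax; apply: sup_upper_bound => //; exists x.
have leF y b : (forall x, A x -> F (x, y) <= b) -> sup [set F (x, y) | x in A] <= b.
  by move=> H; apply: ge_sup; [exists (F (x0, y)), x0|move=> _ [x Ax <-]; exact: H].
split=> //; apply/ctsP => y e e0; have e2 : 0 < e / 2 by rewrite divr_gt0.
have := near_uniform y cX cF e2; apply: filterS => y' H.
apply: (@le_lt_trans _ _ (e / 2)); last by rewrite ltr_pdivrMr // ltr_pMr // ltr1n.
rewrite ler_distl; apply/andP; split.
  rewrite lerBlDr; apply: leF => x Ax.
  have := H x; rewrite ltr_distl => /andP[/ltW + _]; rewrite lerBlDr => /le_trans; apply.
  by rewrite lerD2r Fle.
apply: leF => x Ax; have := H x; rewrite ltr_distl => /andP[_ /ltW /le_trans]; apply.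
by rewrite lerD2r Fle.
Qed.

Section PeterWeyl.
Variables (R : realType) (G : topologicalGroupType) (H : set G).
Hypothesis cG : compact [set: G].
Implicit Types (phi psi chi : G -> R) (x y g : G).

Definition right_invariant phi := forall x h, H h -> phi (x * h)%g = phi x.

Definition ctsH phi := continuous phi /\ right_invariant phi.

Lemma ctsHZ c phi : ctsH phi -> ctsH (fun x => c * phi x).
Proof.
move=> [cp ip]; split; first by apply: ctsM => //; exact: cts_cst.
by move=> x h Hh; rewrite ip.
Qed.

Lemma ctsHB phi psi : ctsH phi -> ctsH psi -> ctsH (fun x => phi x - psi x).
Proof.
move=> [cp ip] [cq iq]; split; first exact: ctsB.
by move=> x h Hh; rewrite ip // iq.
Qed.

Lemma ctsH_sum (I : finType) (F : I -> G -> R) : (forall i, ctsH (F i)) ->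
  ctsH (fun x => \sum_i F i x).
Proof.
move=> cF; split; first by apply: cts_sum => i _; have [] := cF i.
move=> x h Hh /=; apply: eq_bigr => i _; have [_ iF] := cF i.
by rewrite iF.
Qed.

Lemma ctsH_lmul g phi : ctsH phi -> ctsH (fun x => phi (g * x)%g).
Proof.
move=> [cp ip]; split; first exact: cts_lmul.
by move=> x h Hh /=; rewrite mulgA; exact: ip.
Qed.

(** * A positive compact operator commuting with translations, and its eigenfunctions *)

Section Operator.
Variable a : G -> R.
Hypothesis aH : ctsH a.
Let ca : continuous a := proj1 aH.

(** [synthesis] is adjoint to [analysis], so [frame] is positive and self-adjoint. It commutes with
    left translations by invariance of the mean, and its values inherit right invariance under [H]
    from [a]. *)
Definition analysis phi g := mean (fun y => a (g * y)%g * phi y).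
Definition synthesis phi x := mean (fun g => a (g * x)%g * phi g).
Definition frame phi := synthesis (analysis phi).
Local Notation A := analysis.
Local Notation T := frame.
Let kappa := mean (fun y => a y ^+ 2).

Let kappa_ge0 : 0 <= kappa.
Proof. by apply: mean_ge0 => //; [exact: ctsX|move=> x; exact: sqr_ge0]. Qed.

Let ca2 : continuous (fun p : G * G => a (p.1 * p.2)%g). Proof. exact: cts_mul2. Qed.

Lemma cts_analysis phi : continuous phi -> continuous (A phi).
Proof.
move=> cp; apply: (@cts_mean _ _ cG (fun p => a (p.1 * p.2)%g * phi p.2)).
by apply: ctsM => //; apply: (cts_comp cp); exact: cts_snd.
Qed.

Lemma cts_synthesis phi : continuous phi -> continuous (synthesis phi).
Proof.
move=> cp; apply: (@cts_mean _ _ cG (fun p => a (p.2 * p.1)%g * phi p.2)).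
apply: ctsM; last by apply: (cts_comp cp); exact: cts_snd.
exact: (cts_swap ca2).
Qed.

Lemma ctsH_frame phi : continuous phi -> ctsH (T phi).
Proof.
move=> cp; split; first exact/cts_synthesis/cts_analysis.
move=> x h Hh; congr mean; apply/funext => g; have [_ ia] := aH; rewrite mulgA; congr (_ * _).
exact: ia.
Qed.

Let cT phi : continuous phi -> continuous (T phi). Proof. by move=> /ctsH_frame[]. Qed.

Let ca_l g : continuous (fun y => a (g * y)%g). Proof. exact: cts_lmul. Qed.
Let ca_r x : continuous (fun g => a (g * x)%g). Proof. exact: cts_rmul. Qed.

Lemma frame_dot phi psi : continuous phi -> continuous psi ->
  mean (fun x => T phi x * psi x) = mean (fun g => A phi g * A psi g).
Proof.
move=> cp cq; have cA := cts_analysis cp.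
transitivity (mean (fun x => mean (fun g => a (g * x)%g * A phi g * psi x))).
  congr mean; apply/funext => x; rewrite mulrC -meanZ //.
    by congr mean; apply/funext => g; rewrite mulrC.
  exact: ctsM.
rewrite (@mean_fubini _ _ cG (fun p => a (p.2 * p.1)%g * A phi p.2 * psi p.1)) /=; last first.
  apply: ctsM; last by apply: (cts_comp cq); exact: cts_fst.
  apply: ctsM; last by apply: (cts_comp cA); exact: cts_snd.
  exact: (cts_swap ca2).
congr mean; apply/funext => g; rewrite -meanZ //; last exact: ctsM.
by congr mean; apply/funext => x; rewrite mulrAC mulrC.
Qed.

Lemma frame_sym phi psi : continuous phi -> continuous psi ->
  mean (fun x => T phi x * psi x) = mean (fun x => phi x * T psi x).
Proof.
move=> cp cq; rewrite frame_dot //.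
rewrite (_ : (fun x => phi x * _) = fun x => T psi x * phi x); last by apply/funext => x; rewrite mulrC.
by rewrite frame_dot //; congr mean; apply/funext => g; rewrite mulrC.
Qed.

Lemma frameZ c phi : continuous phi -> T (fun x => c * phi x) = fun x => c * T phi x.
Proof.
move=> cp; have -> : T (fun x => c * phi x) = synthesis (fun g => c * A phi g).
  congr synthesis; apply/funext => g; rewrite /analysis -meanZ //; last exact: ctsM.
  by congr mean; apply/funext => y; rewrite mulrCA.
apply/funext => x; rewrite /frame /synthesis -meanZ //; last by apply: ctsM => //; exact: cts_analysis.
by congr mean; apply/funext => g; rewrite mulrCA.
Qed.

Lemma frameB phi psi : continuous phi -> continuous psi ->
  T (fun x => phi x - psi x) = fun x => T phi x - T psi x.
Proof.
move=> cp cq; have -> : T (fun x => phi x - psi x) = synthesis (fun g => A phi g - A psi g).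
  congr synthesis; apply/funext => g; rewrite /analysis -meanB //; last 2 first.
  - exact: ctsM.
  - exact: ctsM.
  by congr mean; apply/funext => y; rewrite mulrBr.
apply/funext => x; rewrite /frame /synthesis -meanB //; last 2 first.
- by apply: ctsM => //; exact: cts_analysis.
- by apply: ctsM => //; exact: cts_analysis.
by congr mean; apply/funext => g; rewrite mulrBr.
Qed.

Lemma frame_sum (I : finType) (F : I -> G -> R) : (forall i, continuous (F i)) ->
  T (fun x => \sum_i F i x) = fun x => \sum_i T (F i) x.
Proof.
move=> cF; have -> : T (fun x => \sum_i F i x) = synthesis (fun g => \sum_i A (F i) g).
  congr synthesis; apply/funext => g; rewrite /analysis -mean_sum //; last first.
    by move=> i; exact: ctsM.
  by congr mean; apply/funext => y; rewrite mulr_sumr.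
apply/funext => x; rewrite /frame /synthesis -mean_sum //; last first.
  by move=> i; apply: ctsM => //; exact: cts_analysis.
by congr mean; apply/funext => g; rewrite mulr_sumr.
Qed.

Lemma frame_lmul h phi : continuous phi -> T (fun x => phi (h * x)%g) = fun x => T phi (h * x)%g.
Proof.
move=> cp; have cA := cts_analysis cp.
have E g : A (fun x => phi (h * x)%g) g = A phi (g * h^-1)%g.
  rewrite /analysis -[RHS](mean_lmul cG h); last by apply: ctsM.
  by congr mean; apply/funext => y; rewrite !mulgA mulgVK.
apply/funext => x; rewrite /frame /synthesis -[RHS](mean_rmul cG h^-1%g); last by apply: ctsM.
by congr mean; apply/funext => g; rewrite E -!mulgA mulKg.
Qed.

Lemma synthesis_bound phi x : continuous phi ->
  synthesis phi x ^+ 2 <= kappa * mean (fun g => phi g ^+ 2).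
Proof.
move=> cp; apply: le_trans (mean_cauchy_schwarz cG _ cp) _; first exact: ca_r.
rewrite (@mean_rmul _ _ cG x (fun g => a g ^+ 2)) //.
exact: ctsX.
Qed.

Lemma analysis_bound phi g : continuous phi ->
  A phi g ^+ 2 <= kappa * mean (fun y => phi y ^+ 2).
Proof.
move=> cp; apply: le_trans (mean_cauchy_schwarz cG _ cp) _; first exact: ca_l.
rewrite (@mean_lmul _ _ cG g (fun g => a g ^+ 2)) //.
exact: ctsX.
Qed.

Lemma mean_sqr_ge0 phi : continuous phi -> 0 <= mean (fun y => phi y ^+ 2).
Proof. by move=> cp; apply: mean_ge0 => //; [exact: ctsX|move=> x; exact: sqr_ge0]. Qed.

Lemma mean_analysis_bound phi : continuous phi ->
  mean (fun g => A phi g ^+ 2) <= kappa * mean (fun y => phi y ^+ 2).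
Proof.
move=> cp; rewrite -[leRHS](mean_cst cG); apply: mean_le => //.
- by apply: ctsX; exact: cts_analysis.
- exact: cts_cst.
- by move=> g; exact: analysis_bound.
Qed.

Lemma frame_quad phi : continuous phi ->
  mean (fun x => T phi x * phi x) = mean (fun g => A phi g ^+ 2).
Proof. by move=> cp; rewrite frame_dot //; congr mean; apply/funext => g; rewrite expr2. Qed.

Lemma frame_bound_quad phi x : continuous phi ->
  T phi x ^+ 2 <= kappa * mean (fun x => T phi x * phi x).
Proof. by move=> cp; rewrite frame_quad //; apply: synthesis_bound; exact: cts_analysis. Qed.

Lemma frame_bound phi x : continuous phi ->
  T phi x ^+ 2 <= kappa ^+ 2 * mean (fun x => phi x ^+ 2).
Proof.
move=> cp; apply: le_trans (frame_bound_quad x cp) _.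
by rewrite frame_quad // expr2 -mulrA ler_wpM2l // mean_analysis_bound.
Qed.

(** The neighbourhood does not depend on [phi] in the mean-square unit ball: this is the compactness
    of the operator, in the form of equicontinuity. *)
Lemma frame_equicontinuous x e : 0 < e -> \forall x' \near x, forall phi, continuous phi ->
  mean (fun y => phi y ^+ 2) <= 1 -> `|T phi x' - T phi x| <= e.
Proof.
move=> e0; have k1 : 0 < kappa + 1 by rewrite ltr_wpDl.
have d0 : 0 < e / (kappa + 1) by rewrite divr_gt0.
have := near_uniform x cG ca2 d0; apply: filterS => x' Hx' phi cp p1.
have cA := cts_analysis cp; apply: norm_le_of_sqr; first exact: ltW.
have cdiff : continuous (fun g => a (g * x')%g - a (g * x)%g) by exact: ctsB.
have -> : T phi x' - T phi x = mean (fun g => (a (g * x')%g - a (g * x)%g) * A phi g).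
  rewrite /frame /synthesis -meanB //; last 2 first.
  - exact: ctsM.
  - exact: ctsM.
  by congr mean; apply/funext => g; rewrite mulrBl.
apply: le_trans (mean_cauchy_schwarz cG cdiff cA) _.
have m1 : mean (fun g => (a (g * x')%g - a (g * x)%g) ^+ 2) <= (e / (kappa + 1)) ^+ 2.
  rewrite -[leRHS](mean_cst cG); apply: mean_le => //; [exact: ctsX|exact: cts_cst|move=> g].
  rewrite -[leLHS]real_normK ?num_real // ler_pXn2r ?nnegrE //; first exact/ltW/Hx'.
  exact: ltW.
have m2 : mean (fun g => A phi g ^+ 2) <= kappa.
  by apply: le_trans (mean_analysis_bound cp) _; rewrite ler_piMr.
apply: (@le_trans _ _ ((e / (kappa + 1)) ^+ 2 * (kappa + 1) ^+ 2)); last first.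
  by rewrite -exprMn divfK // gt_eqF.
apply: ler_pM => //; [exact: mean_sqr_ge0|exact: mean_sqr_ge0|].
by apply: le_trans m2 _; rewrite expr2; move: kappa_ge0; move: (kappa) => k; nra.
Qed.

(** [T f x] averages [f y] with weight [a (g x) a (g y)], of total mass [mean a ^+ 2]. Where the
    weight is nonzero, [x = g^-1 u] and [y = g^-1 v] with [a] nonzero at [u] and [v], so [f y] is
    within [d] of [f x]. *)
Lemma frame_approx f d x : continuous f -> (forall x, 0 <= a x) -> 0 <= d ->
  (forall u v, a u != 0 -> a v != 0 -> forall g, `|f (g * u)%g - f (g * v)%g| <= d) ->
  `|T f x - mean a ^+ 2 * f x| <= mean a ^+ 2 * d.
Proof.
move=> cf a0 d0 Hd.
have cD : continuous (fun y => f y - f x) by apply: ctsB => //; exact: cts_cst.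
have mA g : mean (fun y => a (g * y)%g) = mean a by exact: mean_lmul.
have mAr : mean (fun g => a (g * x)%g) = mean a by exact: mean_rmul.
have E : T f x - mean a ^+ 2 * f x =
    mean (fun g => a (g * x)%g * mean (fun y => a (g * y)%g * (f y - f x))).
  have -> : (fun g => a (g * x)%g * mean (fun y => a (g * y)%g * (f y - f x))) =
      (fun g => a (g * x)%g * A f g - (mean a * f x) * a (g * x)%g).
    apply/funext => g; rewrite (_ : mean _ = A f g - mean a * f x); first by ring.
    rewrite -(mA g) [_ * f x]mulrC -meanZ // -meanB //.
    - by congr mean; apply/funext => y; ring.
    - exact: ctsM.
    - by apply: ctsM => //; exact: cts_cst.
  rewrite meanB //.
  - by rewrite meanZ // mAr /frame /synthesis; ring.
  - by apply: ctsM => //; exact: cts_analysis.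
  - by apply: ctsM => //; exact: cts_cst.
rewrite E.
have -> : mean a ^+ 2 * d = mean (fun g => mean a * d * a (g * x)%g).
  by rewrite meanZ // mAr; ring.
apply: mean_norm_le => //.
- apply: ctsM => //; apply: (@cts_mean _ _ cG (fun p => a (p.1 * p.2)%g * (f p.2 - f x))).
  by apply: ctsM => //; apply: (cts_comp cD); exact: cts_snd.
- by apply: ctsM => //; exact: cts_cst.
move=> g; rewrite normrM ger0_norm // [leRHS]mulrC.
have [->|agx] := eqVneq (a (g * x)%g) 0; first by rewrite !mul0r.
rewrite ler_wpM2l // -(mA g) [_ * d]mulrC -meanZ //.
apply: mean_norm_le => //; [exact: ctsM|by apply: ctsM => //; exact: cts_cst|].
move=> y; rewrite normrM ger0_norm // [leRHS]mulrC.
have [->|agy] := eqVneq (a (g * y)%g) 0; first by rewrite !mul0r.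
rewrite ler_wpM2l //; have := Hd _ _ agy agx g^-1%g.
by rewrite !mulKg.
Qed.

Definition eigensystem (eta : R) n (e : 'I_n -> G -> R) (lam : 'I_n -> R) :=
  [/\ forall i, ctsH (e i), forall i j, mean (fun x => e i x * e j x) = (i == j)%:R,
      forall i, T (e i) = (fun x => lam i * e i x) & forall i, eta <= lam i].

Lemma bessel n (e : 'I_n -> G -> R) phi : (forall i, continuous (e i)) ->
  (forall i j, mean (fun x => e i x * e j x) = (i == j)%:R) -> continuous phi ->
  mean (fun x => (phi x - \sum_i mean (fun y => phi y * e i y) * e i x) ^+ 2) =
  mean (fun x => phi x ^+ 2) - \sum_i mean (fun y => phi y * e i y) ^+ 2.
Proof.
move=> ce oe cp; set c := fun i => mean (fun y => phi y * e i y).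
have cce i : continuous (fun x => c i * e i x) by apply: ctsM => //; exact: cts_cst.
have cS : continuous (fun x => \sum_i c i * e i x) by apply: cts_sum => i _.
have phiS : mean (fun x => phi x * (\sum_i c i * e i x)) = \sum_i c i ^+ 2.
  transitivity (mean (fun x => \sum_i c i * (phi x * e i x))).
    by congr mean; apply/funext => x; rewrite mulr_sumr; apply: eq_bigr => i _; ring.
  rewrite mean_sum // => [|i]; last by apply: ctsM; [exact: cts_cst|exact: ctsM].
  by apply: eq_bigr => i _; rewrite meanZ ?expr2 //; exact: ctsM.
have SS : mean (fun x => (\sum_i c i * e i x) ^+ 2) = \sum_i c i ^+ 2.
  transitivity (mean (fun x => \sum_i c i * (\sum_j c j * (e i x * e j x)))).
    congr mean; apply/funext => x; rewrite expr2 mulr_suml; apply: eq_bigr => i _.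
    by rewrite -mulrA mulr_sumr; congr (_ * _); apply: eq_bigr => j _; ring.
  have cij i : continuous (fun x => \sum_j c j * (e i x * e j x)).
    by apply: cts_sum => j _; apply: ctsM; [exact: cts_cst|exact: ctsM].
  rewrite mean_sum // => [|i]; last by apply: ctsM; [exact: cts_cst|].
  apply: eq_bigr => i _; rewrite meanZ // expr2; congr (_ * _).
  rewrite mean_sum // => [|j]; last by apply: ctsM; [exact: cts_cst|exact: ctsM].
  rewrite (bigD1 i) //= meanZ ?oe ?eqxx ?mulr1 //; last exact: ctsM.
  rewrite big1 ?addr0 // => j ji; rewrite meanZ ?oe //; last exact: ctsM.
  by rewrite eq_sym (negPf ji) mulr0.
rewrite (_ : (fun x => _) = (fun x => phi x ^+ 2 + ((- 2) * (phi x * (\sum_i c i * e i x)) +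
    (\sum_i c i * e i x) ^+ 2))); last by apply/funext => x; rewrite -/(c _); ring.
have cps : continuous (fun x => phi x * (\sum_i c i * e i x)) by exact: ctsM.
have cps2 : continuous (fun x => (- 2) * (phi x * (\sum_i c i * e i x))).
  by apply: ctsM => //; exact: cts_cst.
have cS2 : continuous (fun x => (\sum_i c i * e i x) ^+ 2) by exact: ctsX.
rewrite meanD //; [|exact: ctsX|exact: ctsD].
rewrite meanD // meanZ // phiS SS; ring.
Qed.

(** A Hilbert-Schmidt trace bound: [A (e i) g] is the coefficient along [e i] of the translate of
    [a] by [g], so Bessel bounds the sum of the squares by [kappa] for every [g], and the mean of
    the square over [g] is [lam i]. *)
Lemma eigensystem_size eta n e lam : 0 < eta -> @eigensystem eta n e lam -> n%:R * eta <= kappa.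
Proof.
move=> eta0 [eH oe Te le]; have ce i : continuous (e i) by have [] := eH i.
have Alam i : mean (fun g => A (e i) g ^+ 2) = lam i.
  rewrite -frame_quad // Te -[RHS]mulr1 -[X in _ * X](_ : mean (fun x => e i x * e i x) = 1).
    by rewrite -meanZ //; [congr mean; apply/funext => x; rewrite mulrA|exact: ctsM].
  by rewrite oe eqxx.
have S g : \sum_i A (e i) g ^+ 2 <= kappa.
  have := bessel ce oe (@ca_l g); set B := mean _ => BE.
  have : 0 <= B.
    apply: mean_sqr_ge0; apply: ctsB => //.
    by apply: cts_sum => i _; apply: ctsM => //; exact: cts_cst.
  by rewrite BE subr_ge0 (@mean_lmul _ _ cG g (fun y => a y ^+ 2)) //; exact: ctsX.
have cA2 i : continuous (fun g => A (e i) g ^+ 2) by apply: ctsX; exact: cts_analysis.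
have : mean (fun g => \sum_i A (e i) g ^+ 2) <= kappa.
  by rewrite -[leRHS](mean_cst cG); apply: mean_le => //; [exact: cts_sum|exact: cts_cst].
rewrite mean_sum //; apply: le_trans; rewrite -[n in n%:R](card_ord n) -sum1_card natr_sum mulr_suml.
by apply: ler_sum => i _; rewrite mul1r Alam.
Qed.

Lemma eigensystem_extend eta n (e : 'I_n -> G -> R) lam psi mu : eigensystem eta e lam ->
  ctsH psi -> T psi = (fun x => mu * psi x) -> eta <= mu ->
  (forall i, mean (fun x => psi x * e i x) = 0) -> 0 < mean (fun x => psi x ^+ 2) ->
  exists e' lam', @eigensystem eta n.+1 e' lam'.
Proof.
move=> [eH oe Te le] pH Tp mle po p0; have [cp _] := pH.
set N := mean _ in p0; pose s := Num.sqrt N.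
have s0 : 0 < s by rewrite sqrtr_gt0.
have sN : s ^+ 2 = N by rewrite sqr_sqrtr // ltW.
pose q x := s^-1 * psi x.
have qH : ctsH q by exact: ctsHZ.
exists (fun i => if unlift ord0 i is Some j then e j else q).
exists (fun i => if unlift ord0 i is Some j then lam j else mu).
have ce i : continuous (e i) by have [] := eH i.
have qe j : mean (fun x => q x * e j x) = 0.
  transitivity (mean (fun x => s^-1 * (psi x * e j x))).
    by congr mean; apply/funext => x; rewrite mulrA.
  by rewrite meanZ ?po ?mulr0 //; exact: ctsM.
split=> i.
- by case: unliftP.
- move=> j; case: unliftP => [i'|] ->; case: unliftP => [j'|] ->.
  + by rewrite oe (inj_eq lift_inj).
  + rewrite eq_sym (negPf (neq_lift _ _)) mulr0n -(qe i').
    by congr mean; apply/funext => x; rewrite mulrC.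
  + by rewrite qe (negPf (neq_lift _ _)).
  + rewrite eqxx; transitivity (mean (fun x => s^-1 ^+ 2 * psi x ^+ 2)).
      by congr mean; apply/funext => x; rewrite /q; ring.
    by rewrite meanZ //; [rewrite -/N -sN exprVn mulVf // gt_eqF // exprn_gt0|exact: ctsX].
- case: unliftP => [j|] _; first exact: Te.
  by rewrite frameZ // Tp; apply/funext => x; rewrite mulrCA.
- by case: unliftP.
Qed.

(** Stands in for the spectral theorem: maximality alone will make the span invariant under
    translations and the operator small on the complement. *)
Lemma eigensystem_max eta : 0 < eta -> exists n (e : 'I_n -> G -> R) lam, eigensystem eta e lam /\
  forall e' lam', ~ @eigensystem eta n.+1 e' lam'.
Proof.
move=> eta0; pose P n := `[< exists e lam, @eigensystem eta n e lam >].
have P0 : exists n, P n.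
  by exists 0%N; apply/asboolP; exists (fun _ _ => 0), (fun=> 0); split; case.
have Pb n : P n -> (n <= Num.truncn (kappa / eta))%N.
  move=> /asboolP [e [lam /(eigensystem_size eta0)]]; rewrite -ler_pdivlMr // => h.
  by rewrite truncn_ge_nat // (le_trans _ h).
case: (ex_maxnP P0 Pb) => n /asboolP [e [lam E]] nmax; exists n, e, lam; split=> // e' lam' E'.
have := nmax n.+1; rewrite ltnn => /(_ _)/negP; apply => //.
by apply/asboolP; exists e', lam'.
Qed.

Lemma cts_sqr_mean0 phi : continuous phi -> mean (fun x => phi x ^+ 2) <= 0 -> forall x, phi x = 0.
Proof.
move=> cp m0 x; apply/eqP/negPn/negP => px; have : 0 < mean (fun x => phi x ^+ 2).
  apply: (@mean_gt0 _ _ cG _ x); [exact: ctsX|by move=> y; exact: sqr_ge0|].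
  by rewrite lt_neqAle sqr_ge0 eq_sym sqrf_eq0 px.
by rewrite ltNge m0.
Qed.

(** A left translate of [e i] is an eigenfunction for [lam i]; by symmetry of the operator it has
    coefficients only along those [e j] with [lam j = lam i]. Its component orthogonal to the system
    is then an eigenfunction too, and would extend the system unless it is zero. *)
Lemma eigensystem_max_lmul eta n (e : 'I_n -> G -> R) lam : eigensystem eta e lam ->
  (forall e' lam', ~ @eigensystem eta n.+1 e' lam') ->
  forall g i x, e i (g * x)%g = \sum_j mean (fun y => e i (g * y)%g * e j y) * e j x.
Proof.
move=> E Emax g i; have [eH oe Te le] := E; have ce j : continuous (e j) by have [] := eH j.
pose f x := e i (g * x)%g; have fH : ctsH f by exact: ctsH_lmul.
have cf := proj1 fH.
have Tf : T f = fun x => lam i * f x by rewrite frame_lmul // Te.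
pose c j := mean (fun y => f y * e j y).
have ceH j : ctsH (fun x => c j * e j x) by exact: ctsHZ.
pose psi x := f x - \sum_j c j * e j x.
have pH : ctsH psi by apply: ctsHB => //; exact: ctsH_sum.
have cp := proj1 pH.
have lamc j : lam j * c j = lam i * c j.
  have := frame_sym cf (ce j); rewrite Tf Te.
  rewrite (_ : (fun x => _) = fun x => lam i * (f x * e j x)); last by apply/funext => x; rewrite mulrA.
  rewrite (_ : (fun x => f x * _) = fun x => lam j * (f x * e j x)); last by apply/funext => x; rewrite mulrCA.
  by rewrite !meanZ //; exact: ctsM.
have Tp : T psi = fun x => lam i * psi x.
  rewrite frameB //; last by apply: (proj1 (ctsH_sum _)) => j; exact: ceH.
  rewrite frame_sum; last by move=> j; have [] := ceH j.
  apply/funext => x; rewrite Tf /psi mulrBr; congr (_ - _).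
  rewrite mulr_sumr; apply: eq_bigr => j _; rewrite frameZ // Te mulrCA.
  by rewrite mulrA lamc mulrA.
have po j : mean (fun x => psi x * e j x) = 0.
  transitivity (mean (fun x => f x * e j x - \sum_k c k * (e k x * e j x))).
    congr mean; apply/funext => x; rewrite mulrBl mulr_suml; congr (_ - _).
    by apply: eq_bigr => k _; rewrite mulrA.
  have ck k : continuous (fun x => c k * (e k x * e j x)).
    by apply: ctsM; [exact: cts_cst|exact: ctsM].
  rewrite meanB //; [|exact: ctsM|exact: cts_sum].
  rewrite mean_sum // (bigD1 j) //= meanZ ?oe ?eqxx ?mulr1 //; last exact: ctsM.
  rewrite big1 ?addr0 ?subrr // => k kj; rewrite meanZ ?oe ?(negPf kj) ?mulr0 //.
  exact: ctsM.
have psi0 : mean (fun x => psi x ^+ 2) <= 0.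
  rewrite leNgt; apply/negP => p0.
  have [e' [lam' E']] := eigensystem_extend E pH Tp (le i) po p0.
  exact: Emax E'.
by move=> x; apply/eqP; rewrite -subr_eq0; apply/eqP; exact: (cts_sqr_mean0 cp psi0).
Qed.

Lemma frame_norm_bound phi x d : continuous phi -> 0 <= d ->
  mean (fun y => phi y ^+ 2) <= d ^+ 2 -> `|T phi x| <= kappa * d.
Proof.
move=> cp d0 pd; apply: norm_le_of_sqr; first exact: mulr_ge0.
by apply: le_trans (frame_bound x cp) _; rewrite exprMn ler_wpM2l // sqr_ge0.
Qed.

Lemma mean_sqr_le phi d : continuous phi -> (forall x, `|phi x| <= d) ->
  mean (fun y => phi y ^+ 2) <= d ^+ 2.
Proof.
move=> cp pd; rewrite -[leRHS](mean_cst cG); apply: mean_le => //; [exact: ctsX|exact: cts_cst|].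
move=> x; rewrite -[leLHS]real_normK ?num_real // ler_pXn2r ?nnegrE //.
exact: le_trans (pd x).
Qed.

Lemma mean_mul_norm_le phi psi d : continuous phi -> continuous psi -> 0 <= d ->
  mean (fun y => phi y ^+ 2) <= d ^+ 2 -> mean (fun y => psi y ^+ 2) <= 1 ->
  `|mean (fun x => phi x * psi x)| <= d.
Proof.
move=> cp cq d0 pd q1; apply: norm_le_of_sqr => //.
apply: le_trans (mean_cauchy_schwarz cG cp cq) _; rewrite -[leRHS]mulr1.
by apply: ler_pM => //; exact: mean_sqr_ge0.
Qed.

(* Along a maximizing sequence for the quadratic form, [T phi_k] converges
   uniformly (by equicontinuity) to an eigenfunction. *)
Lemma eigensystem_max_quad eta n (e : 'I_n -> G -> R) lam : 0 < eta -> eigensystem eta e lam ->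
  (forall e' lam', ~ @eigensystem eta n.+1 e' lam') ->
  forall phi, ctsH phi -> (forall i, mean (fun x => phi x * e i x) = 0) ->
  mean (fun x => T phi x * phi x) <= eta * mean (fun x => phi x ^+ 2).
Proof.
move=> eta0 E Emax; have [eH oe Te le] := E; have ce j : continuous (e j) by have [] := eH j.
pose good phi := ctsH phi /\ forall i, mean (fun x => phi x * e i x) = 0.
(* Values of the quadratic form on the unit ball of the complement of the system. A supremum above
   [eta] would be attained by an eigenfunction extending the system. *)
pose S := [set t | exists phi, [/\ good phi, mean (fun x => phi x ^+ 2) <= 1 &
  t = mean (fun x => T phi x * phi x)]].
have S_ub t : S t -> t <= kappa.
  move=> [phi [[[cp _] _] p1 ->]]; rewrite frame_quad //.
  by apply: le_trans (mean_analysis_bound cp) _; rewrite ler_piMr.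
have S_sup : has_sup S.
  split; last by exists kappa; move=> t /S_ub.
  exists (mean (fun x => T (fun=> 0) x * 0)), (fun=> 0); split=> //.
    split; first by split; [exact: cts_cst|].
    by move=> i; rewrite -[RHS](mean_cst cG); congr mean; apply/funext => x; rewrite mul0r.
  by rewrite (_ : (fun=> _) = fun=> 0); [rewrite mean_cst|apply/funext => x; rewrite expr0n].
set mu := sup S.
have quad_mu phi : good phi -> mean (fun x => T phi x * phi x) <= mu * mean (fun x => phi x ^+ 2).
  move=> [[cp ip] op]; have := mean_sqr_ge0 cp; rewrite le_eqVlt => /predU1P[N0|N0].
    rewrite -N0 mulr0 frame_quad //; apply: le_trans (mean_analysis_bound cp) _.
    by rewrite -N0 mulr0.
  set N := mean _ in N0 *; pose s := Num.sqrt N.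
  have s0 : 0 < s by rewrite sqrtr_gt0.
  have sN : s ^+ 2 = N by rewrite sqr_sqrtr // ltW.
  have : mean (fun x => T (fun x => s^-1 * phi x) x * (s^-1 * phi x)) <= mu.
    apply: sup_upper_bound => //; exists (fun x => s^-1 * phi x); split=> //.
      split; first exact: ctsHZ.
      move=> i; transitivity (mean (fun x => s^-1 * (phi x * e i x))).
        by congr mean; apply/funext => x; rewrite mulrA.
      by rewrite meanZ ?op ?mulr0 //; exact: ctsM.
    rewrite (_ : (fun x => _) = fun x => s^-1 ^+ 2 * phi x ^+ 2); last first.
      by apply/funext => x; rewrite exprMn.
    by rewrite meanZ //; [rewrite -/N -sN exprVn mulVf // gt_eqF // exprn_gt0|exact: ctsX].
  rewrite (_ : (fun x => _) = fun x => N^-1 * (T phi x * phi x)); last first.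
    by apply/funext => x; rewrite frameZ // -sN; field; rewrite gt_eqF.
  rewrite meanZ //; last by apply: ctsM => //; exact: cT.
  by rewrite mulrC ler_pdivrMr.
suff mu_eta : mu <= eta.
  move=> phi pH po; have [cp _] := pH; apply: le_trans (quad_mu phi _) _ => //.
  by rewrite ler_wpM2r // mean_sqr_ge0.
rewrite leNgt; apply/negP => eta_mu; have mu0 : 0 < mu by exact: lt_trans eta_mu.
have [U [UU Uoo]] := ultra_nat; have UP : ProperFilter U by exact: ultra_proper.
have exk k : exists phi, [/\ good phi, mean (fun x => phi x ^+ 2) <= 1 &
    mu - k.+1%:R^-1 < mean (fun x => T phi x * phi x)].
  have k0 : 0 < k.+1%:R^-1 :> R by rewrite invr_gt0.
  have [t [phi [gp p1 ->]] tm] := sup_adherent k0 S_sup.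
  by exists phi.
have [phi Hphi] := choice exk.
have gphi k : good (phi k) by have [] := Hphi k.
have cphi k : continuous (phi k) by have [[[]]] := Hphi k.
have phi1 k : mean (fun x => phi k x ^+ 2) <= 1 by have [] := Hphi k.
have phit k : mu - k.+1%:R^-1 < mean (fun x => T (phi k) x * phi k x) by have [] := Hphi k.
have Tb k x : `|T (phi k) x| <= kappa.
  by rewrite -[kappa]mulr1 frame_norm_bound // expr1n.
have lims x : exists l : R, (fun k => T (phi k) x) @ U --> l.
  exact: (@ultra_real_cvg _ _ _ kappa).
have [psi Hpsi] := choice lims.
have psi_near x d : 0 < d -> \forall k \near U, `|T (phi k) x - psi x| < d.
  move=> d0; have := Hpsi x; move=> /cvgrPdist_lt /(_ d d0).
  by apply: filterS => k; rewrite distrC.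
have psi_equi x d : 0 < d -> \forall x' \near x, `|psi x' - psi x| <= d /\
    forall k, `|T (phi k) x' - T (phi k) x| <= d.
  move=> d0; have := frame_equicontinuous x d0; apply: filterS => x' Hx'.
  have HT k : `|T (phi k) x' - T (phi k) x| <= d by exact: Hx'.
  split=> //.
  have c1 : (fun k => `|T (phi k) x' - T (phi k) x|) @ U --> `|psi x' - psi x|.
    by apply: cvg_norm; apply: cvgB; exact: Hpsi.
  by apply: (ler_cvg_to c1 (cvg_cst d)); exact: nearW.
have cpsi : continuous psi.
  apply/ctsP => x d d0; have d2 : 0 < d / 2 by rewrite divr_gt0.
  apply: filterS (psi_equi x _ d2) => x' [h _]; rewrite (le_lt_trans h) //.
  by rewrite ltr_pdivrMr // ltr_pMr // ltr1n.
have psiH : ctsH psi.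
  split=> // x h Hh; apply: (real_cvg_unique (Hpsi _)).
  rewrite (_ : (fun k => _) = fun k => T (phi k) x); first exact: Hpsi.
  apply/funext => k; have [_ iT] := ctsH_frame (cphi k); exact: iT.
have unif d : 0 < d -> \forall k \near U, forall x, `|T (phi k) x - psi x| < d.
  move=> d0; have d4 : 0 < d / 4 by rewrite divr_gt0.
  have /compact_near_coveringP/(_ _ U (fun k x => `|T (phi k) x - psi x| < d) _) := cG.
  move=> HU; have : \forall k \near U, [set: G] `<=` (fun x => `|T (phi k) x - psi x| < d).
    apply: HU => x _.
    exists ([set x' | `|psi x' - psi x| <= d / 4 /\ forall k, `|T (phi k) x' - T (phi k) x| <= d / 4],
            [set k | `|T (phi k) x - psi x| < d / 4]).
      by split; [exact: psi_equi|exact: psi_near].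
    move=> [x' k] /= [[h1 /(_ k) h2] h3].
    move: h1 h2 h3; rewrite !ler_distl !ltr_distl => /andP[a1 a2] /andP[a3 a4] /andP[a5 a6].
    have -> : d = d / 4 + d / 4 + d / 4 + d / 4 by field.
    by move: (d / 4) d4 a1 a2 a3 a4 a5 a6 => q *; apply/andP; split; lra.
  by apply: filterS => k Hk x; exact: Hk.
have pick d : 0 < d -> exists k, (forall x, `|T (phi k) x - psi x| <= d) /\
    mu - d <= mean (fun x => T (phi k) x * phi k x).
  move=> d0; have h : U [set k | k.+1%:R^-1 < d].
    apply: Uoo; have /cvgrPdist_lt/(_ d d0) := @cvg_harmonic R.
    by apply: filterS => k; rewrite sub0r normrN ger0_norm // ltW // invr_gt0.
  have [k [k1 k2]] := filter_ex (filterI (unif d d0) h).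
  exists k; split=> [x|]; first exact/ltW/k1.
  by apply/ltW; apply: le_lt_trans (phit k); rewrite lerD2l lerN2 ltW.
have Tpsi : T psi = fun x => mu * psi x.
  apply/funext => x; apply: real_eq_eps => ep ep0.
  (* Three errors are collected below, bounded by [kappa * d], [kappa * d] and [mu * d]. *)
  pose d := ep / (2 * kappa + mu).
  have K0 : 0 < 2 * kappa + mu by rewrite ltr_wpDl // mulr_ge0.
  have d0 : 0 < d by rewrite divr_gt0.
  (* The second bound gives [mu * (mu - t) <= d ^+ 2], which controls the mean square of
     [T (phi k) - mu phi k]. *)
  have dd0 : 0 < Num.min d (d ^+ 2 / mu) by rewrite lt_min d0 divr_gt0 // exprn_gt0.
  have [k [k1 k2]] := pick _ dd0; set th := T (phi k) in k1 k2.
  have cth : continuous th by exact: cT.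
  set t := mean _ in k2.
  have t_mu : mu * (mu - t) <= d ^+ 2.
    rewrite mulrC -ler_pdivlMr // lerBlDr -lerBlDl (le_trans _ k2) // lerD2l lerN2.
    by rewrite ge_min lexx orbT.
  have thd y : `|th y - psi y| <= d.
    by apply: le_trans (k1 y) _; rewrite ge_min lexx.
  have gth : good th.
    split; first exact: ctsH_frame.
    move=> i; rewrite /th frame_sym // Te.
    rewrite (_ : (fun x => _) = fun x => lam i * (phi k x * e i x)); last first.
      by apply/funext => y; rewrite mulrCA.
    by rewrite meanZ; [have [_ ->] := gphi k; rewrite mulr0|done|exact: ctsM].
  pose s := mean (fun x => th x ^+ 2).
  have s0 : 0 <= s by exact: mean_sqr_ge0.
  have t0 : 0 <= t by rewrite /t /th frame_quad // mean_sqr_ge0 //; exact: cts_analysis.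
  (* Cauchy-Schwarz for the positive form of the operator, at [phi k] and [th]; the form at [th] is
     at most [mu * s]. *)
  have st : s <= mu * t.
    have cA := cts_analysis (cphi k); have cA' := cts_analysis cth.
    have := mean_cauchy_schwarz cG cA cA'.
    rewrite -frame_dot // -!frame_quad // -/th -/t.
    have -> : mean (fun x => th x * th x) = s by congr mean; apply/funext => y; rewrite expr2.
    have := quad_mu _ gth; rewrite -/s => h1 h2.
    have h3 : s ^+ 2 <= t * (mu * s) by apply: le_trans h2 _; rewrite ler_wpM2l.
    move: s0; rewrite le_eqVlt => /predU1P[<-|sp]; first by rewrite mulr_ge0 // ltW.
    by rewrite -(ler_pM2r sp) -expr2 [mu * t]mulrC -mulrA.
  pose chi y := th y - mu * phi k y.
  have cmp : continuous (fun y => mu * phi k y) by apply: ctsM => //; exact: cts_cst.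
  have cchi : continuous chi by exact: ctsB.
  have chid : mean (fun y => chi y ^+ 2) <= d ^+ 2.
    have -> : mean (fun y => chi y ^+ 2) =
        s + ((- 2) * mu * t + mu ^+ 2 * mean (fun y => phi k y ^+ 2)).
      have ctp : continuous (fun y => th y * phi k y) by exact: ctsM.
      have cth2 : continuous (fun y => th y ^+ 2) by exact: ctsX.
      have cp2 : continuous (fun y => phi k y ^+ 2) by exact: ctsX.
      rewrite /t -meanZ // -meanZ // -meanD //; last 2 first.
      - by apply: ctsM => //; exact: cts_cst.
      - by apply: ctsM => //; exact: cts_cst.
      rewrite /s -meanD //; last first.
        by apply: ctsD; apply: ctsM => //; exact: cts_cst.
      by congr mean; apply/funext => y; rewrite /chi; ring.
    apply: le_trans t_mu; have := phi1 k; set m := mean _ => m1.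
    have := ler_wpM2l (sqr_ge0 mu) m1; move: st; clear; rewrite mulr1.
    move: (mu ^+ 2 * m) => q h1 h2; rewrite mulrBr -expr2 -!mulrA.
    by move: (mu * t) (mu ^+ 2) h1 h2 => p p'; lra.
  have b1 : `|T (fun y => th y - psi y) x| <= kappa * d.
    by apply: frame_norm_bound; [exact: ctsB|exact: ltW|apply: mean_sqr_le => //; exact: ctsB].
  have b2 : `|T chi x| <= kappa * d by apply: frame_norm_bound => //; exact: ltW.
  have b3 := thd x.
  have b4 : `|mu * (th x - psi x)| <= mu * d by rewrite normrM gtr0_norm // ler_wpM2l // ltW.
  have -> : T psi x - mu * psi x = - T (fun y => th y - psi y) x + T chi x + mu * (th x - psi x).
    by rewrite frameB // /chi frameB // frameZ // -/th; ring.
  apply: le_trans (ler_normD _ _) _; apply: le_trans (lerD (ler_normD _ _) b4) _.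
  rewrite normrN; apply: le_trans (lerD (lerD b1 b2) (lexx _)) _.
  by rewrite -!mulrDl -mulr2n -mulr_natl mulrC divfK // gt_eqF.
have psi_o i : mean (fun x => psi x * e i x) = 0.
  apply: real_eq_eps => d d0; rewrite subr0; have [k [k1 _]] := pick d d0.
  have cTk : continuous (T (phi k)) by exact: cT.
  have Tk0 : mean (fun x => T (phi k) x * e i x) = 0.
    rewrite frame_sym // Te.
    rewrite (_ : (fun x => _) = fun x => lam i * (phi k x * e i x)); last first.
      by apply/funext => y; rewrite mulrCA.
    by rewrite meanZ; [have [_ ->] := gphi k; rewrite mulr0|done|exact: ctsM].
  rewrite -[X in `|X|]subr0 -Tk0 -meanB //; [|exact: ctsM|exact: ctsM].
  rewrite (_ : (fun x => _) = fun x => (psi x - T (phi k) x) * e i x); last first.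
    by apply/funext => y; rewrite mulrBl.
  apply: mean_mul_norm_le => //; [exact: ctsB|exact: ltW| |].
    by apply: mean_sqr_le => [|y]; [exact: ctsB|rewrite distrC].
  by rewrite (_ : (fun y => _) = fun y => e i y * e i y) ?oe ?eqxx //; apply/funext => y; rewrite expr2.
(* If the limit vanished, [T (phi k)] would be uniformly small while the form stays at least
   [3 mu / 4]. *)
have psi_gt0 : 0 < mean (fun x => psi x ^+ 2).
  rewrite ltNge; apply/negP => /(cts_sqr_mean0 cpsi) psi0.
  have m4 : 0 < mu / 4 by rewrite divr_gt0.
  have [k [k1 k2]] := pick _ m4.
  have cTk : continuous (T (phi k)) by exact: cT.
  have : `|mean (fun x => T (phi k) x * phi k x)| <= mu / 4.
    apply: mean_mul_norm_le => //; first exact: ltW.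
    by apply: mean_sqr_le => // y; have := k1 y; rewrite psi0 subr0.
  rewrite ler_norml => /andP[_ h]; have := le_trans k2 h; rewrite lerBlDr.
  by move: mu0; lra.
have [e' [lam' E']] := eigensystem_extend E psiH Tpsi (ltW eta_mu) psi_o psi_gt0.
exact: Emax E'.
Qed.

End Operator.

(** The kernel [a] is a bump concentrated where right translation hardly moves the [fs l], so
    [frame a] acts on them almost as [mean a ^+ 2]. The eigenfunctions approximate [frame a (fs l)]
    rather than [fs l] itself: the orthogonal remainder is uniformly small only after the operator
    is applied. *)
Lemma peter_weyl m (fs : 'I_m -> G -> R) d : 0 < d -> (forall l, ctsH (fs l)) ->
  exists n (e : 'I_n -> G -> R), [/\ forall i, ctsH (e i),
    forall i j, mean (fun x => e i x * e j x) = (i == j)%:R,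
    forall g i x, e i (g * x)%g = \sum_j mean (fun y => e i (g * y)%g * e j y) * e j x &
    forall l, exists c : 'I_n -> R, forall x, `|fs l x - \sum_i c i * e i x| <= d].
Proof.
move=> d0 fH; have cf l : continuous (fs l) by have [] := fH l.
have d2 : 0 < d / 2 by rewrite divr_gt0.
have d4 : 0 < d / 4 by rewrite divr_gt0.
pose D (p : G * G) := \sum_l `|fs l (p.1 * p.2)%g - fs l p.1|.
have cD : continuous D.
  apply: cts_sum => l _; apply: cts_norm; apply: ctsB; first exact: cts_mul2.
  by apply: (cts_comp (cf l)); exact: cts_fst.
have [cN N_ub leN] := cts_sup cG (ex_intro _ 1%g I : [set: G] !=set0) cD.
set N := fun y => sup _ in cN N_ub leN.
pose a z := Num.max (d / 4 - N z) 0.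
have ca : continuous a.
  by apply: cts_max; [apply: ctsB => //; exact: cts_cst|exact: cts_cst].
have N_inv z h : H h -> N (z * h)%g = N z.
  move=> Hh; congr sup; apply/seteqP; split=> _ [x _ <-]; exists x => //;
    by apply: eq_bigr => l _ /=; have [_ il] := fH l; rewrite mulgA (il _ h).
have aH : ctsH a by split=> // z h Hh; rewrite /a N_inv.
have a0 z : 0 <= a z by rewrite /a le_max lexx orbT.
have N1 : N 1%g <= 0.
  by apply: leN => x _; rewrite /D /= big1 // => l _; rewrite mulg1 subrr normr0.
have a1 : 0 < a 1%g by rewrite /a lt_max; apply/orP; left; move: N1 d4; lra.
have ma : 0 < mean a by exact: (@mean_gt0 _ _ cG _ 1%g).
have a_small z l g : a z != 0 -> `|fs l (g * z)%g - fs l g| <= d / 4.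
  move=> az; have : 0 < a z by rewrite lt_neqAle eq_sym az a0.
  rewrite /a lt_max ltxx orbF subr_gt0 => /ltW; apply: le_trans.
  apply: le_trans (N_ub g z I); rewrite /D (bigD1 l) //= lerDl.
  by apply: sumr_ge0 => *; exact: normr_ge0.
have approx l x : `|frame a (fs l) x - mean a ^+ 2 * fs l x| <= mean a ^+ 2 * (d / 2).
  apply: frame_approx => //; first exact: ltW.
  move=> u v au av g; have := a_small u l g au; have := a_small v l g av.
  rewrite !ler_distl => /andP[b1 b2] /andP[b3 b4].
  have -> : d / 2 = d / 4 + d / 4 by field.
  by apply/andP; split; lra.
set kappa := mean (fun y => a y ^+ 2).
have kappa0 : 0 <= kappa by exact: mean_sqr_ge0.
pose Mx := 1 + \sum_l mean (fun x => fs l x ^+ 2).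
have Mx_ge l : mean (fun x => fs l x ^+ 2) <= Mx.
  rewrite /Mx (bigD1 l) //= addrCA lerDl addr_ge0 //.
  by apply: sumr_ge0 => i _; exact: mean_sqr_ge0.
have Mx0 : 0 < Mx by rewrite ltr_pwDl // sumr_ge0 // => l _; exact: mean_sqr_ge0.
pose b := mean a ^+ 2 * (d / 2).
have b0 : 0 < b by rewrite mulr_gt0 // exprn_gt0.
(* Chosen so that [frame_bound_quad] bounds the image of the remainder by [b]: the form is at most
   [eta] times a mean square, itself at most [Mx]. *)
pose eta := b ^+ 2 / ((kappa + 1) * Mx).
have K0 : 0 < (kappa + 1) * Mx by rewrite mulr_gt0 // ltr_wpDl.
have eta0 : 0 < eta by rewrite divr_gt0 // exprn_gt0.
have eta_b : kappa * (eta * Mx) <= b ^+ 2.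
  rewrite mulrCA /eta mulrAC ler_pdivrMr // ler_wpM2l ?sqr_ge0 //.
  by rewrite ler_wpM2r ?(ltW Mx0) // lerDl.
have [n [e [lam [E Emax]]]] := eigensystem_max aH eta0; exists n, e.
have [eH oe Te le] := E; have ce j : continuous (e j) by have [] := eH j.
split=> //; first by move=> g i x; exact: (eigensystem_max_lmul aH E Emax).
move=> l; pose c i := mean (fun y => fs l y * e i y).
have ceH j : ctsH (fun x => c j * e j x) by exact: ctsHZ.
have cce j : continuous (fun x => c j * e j x) by have [] := ceH j.
pose r x := fs l x - \sum_i c i * e i x.
have rH : ctsH r by apply: ctsHB => //; exact: ctsH_sum.
have [cr _] := rH.
have ro i : mean (fun x => r x * e i x) = 0.
  transitivity (mean (fun x => fs l x * e i x - \sum_k c k * (e k x * e i x))).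
    congr mean; apply/funext => x; rewrite mulrBl mulr_suml; congr (_ - _).
    by apply: eq_bigr => k _; rewrite mulrA.
  have ck k : continuous (fun x => c k * (e k x * e i x)).
    by apply: ctsM; [exact: cts_cst|exact: ctsM].
  rewrite meanB //; [|exact: ctsM|exact: cts_sum].
  rewrite mean_sum // (bigD1 i) //= meanZ ?oe ?eqxx ?mulr1 //; last exact: ctsM.
  rewrite big1 ?addr0 ?subrr // => k ki; rewrite meanZ ?oe ?(negPf ki) ?mulr0 //.
  exact: ctsM.
have r2 : mean (fun x => r x ^+ 2) <= Mx.
  rewrite (bessel ce oe (cf l)) -/(c _); apply: le_trans (Mx_ge l).
  by rewrite gerBl sumr_ge0 // => i _; exact: sqr_ge0.
have Tr x : `|frame a r x| <= b.
  apply: norm_le_of_sqr; first exact: ltW.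
  apply: le_trans (frame_bound_quad aH x cr) _; apply: le_trans eta_b.
  rewrite ler_wpM2l //; apply: le_trans (eigensystem_max_quad aH eta0 E Emax rH ro) _.
  by rewrite ler_wpM2l // ltW.
(* The eigenvalues enter because [frame a (fs l)] is what is expanded. Both errors are at most [b],
   and [2 b / mean a ^+ 2 = d]. *)
exists (fun i => c i * lam i / mean a ^+ 2) => x.
have Tf : frame a (fs l) x = frame a r x + \sum_i c i * lam i * e i x.
  rewrite /r frameB //; last by apply: cts_sum => i _.
  rewrite frame_sum // (eq_bigr (fun i => c i * lam i * e i x)) ?subrK //.
  by move=> i _; rewrite frameZ // Te mulrA.
have ma2 : 0 < mean a ^+ 2 by rewrite exprn_gt0.
rewrite -(ler_pM2l ma2) -{1}(gtr0_norm ma2) -normrM mulrBr mulr_sumr.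
rewrite (eq_bigr (fun i => c i * lam i * e i x)); last first.
  by move=> i _; field; rewrite gt_eqF.
have -> : mean a ^+ 2 * fs l x - \sum_i c i * lam i * e i x =
    frame a r x - (frame a (fs l) x - mean a ^+ 2 * fs l x) by rewrite Tf; ring.
apply: le_trans (ler_normB _ _) _; apply: le_trans (lerD (Tr x) (approx l x)) _.
by rewrite /b le_eqVlt; apply/orP; left; apply/eqP; field.
Qed.

End PeterWeyl.

(** * One-parameter paths in orthogonal representations *)

(** Cutting [t] into [m] equal pieces leaves at most [C t^2 / m]. This replaces uniqueness for
    linear differential equations: the distance between two paths with the same generator is
    subadditive by orthogonality and quadratic at [0]. *)
Lemma subadditive_quadratic_eq0 (R : realType) (f : R -> R) (C : R) :
  (forall t, 0 <= f t) -> (forall s t, f (s + t) <= f s + f t) ->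
  (forall t, f t <= C * t ^+ 2) -> forall t, f t = 0.
Proof.
move=> f0 fD fC t.
have fM m s : f (m.+1%:R * s) <= m.+1%:R * f s.
  elim: m => [|m IH]; first by rewrite !mul1r.
  by rewrite -[m.+2]addn1 natrD !mulrDl !mul1r (le_trans (fD _ _)) // lerD2r.
have H m : f t <= `|C| * t ^+ 2 * m.+1%:R^-1.
  have := fM m (t / m.+1%:R); rewrite mulrC divfK ?pnatr_eq0 // => /le_trans; apply.
  have := fC (t / m.+1%:R); set x := f _ => h.
  have : m.+1%:R * x <= m.+1%:R * (C * (t / m.+1%:R) ^+ 2) by rewrite ler_wpM2l.
  move=> /le_trans; apply.
  have -> : m.+1%:R * (C * (t / m.+1%:R) ^+ 2) = C * t ^+ 2 * m.+1%:R^-1.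
    by have : m.+1%:R != 0 :> R by []; move: (m.+1%:R : R) => q q0; field.
  by rewrite ler_wpM2r ?invr_ge0 // ler_wpM2r ?sqr_ge0 // ler_norm.
apply/eqP; rewrite eq_le f0 andbT.
have c0 : (fun m => `|C| * t ^+ 2 * m.+1%:R^-1) @ \oo --> (0 : R).
  by rewrite -[X in _ --> X](mulr0 (`|C| * t ^+ 2)); apply: cvgM; [exact: cvg_cst|exact: cvg_harmonic].
by apply: (ler_cvg_to (cvg_cst (f t)) c0); exact: nearW.
Qed.

Section Representations.
Variables (R : realType) (G : topologicalGroupType).
Hypothesis cG : compact [set: G].

Definition orep n (rho : G -> 'M[R]_n) :=
  [/\ forall x y, rho (x * y)%g = rho x *m rho y, forall x, orthogonal (rho x) &
      forall i j, continuous (fun x => rho x i j)].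

(* The path [al] is only a one-parameter group as seen by [rho]: in [G] it may
   fail to be continuous. *)
Definition one_param n (rho : G -> 'M[R]_n) (B : 'M[R]_n) (al : R -> G) :=
  (forall s t, rho (al (s + t)) = rho (al s) *m rho (al t)) /\
  exists2 C, 0 <= C & forall t, fro (rho (al t) - 1%:M - t *: B) <= C * t ^+ 2.

Section OneRep.
Variables (n : nat) (rho : G -> 'M[R]_n).
Hypothesis rhoP : orep rho.
Let rhoM x y : rho (x * y)%g = rho x *m rho y. Proof. by have [] := rhoP. Qed.
Let rhoO x : orthogonal (rho x). Proof. by have [] := rhoP. Qed.

Lemma orep1 : rho 1%g = 1%:M.
Proof. by rewrite -[LHS]mul1mx -{1}(rhoO 1%g) -mulmxA -rhoM mulg1 rhoO. Qed.

Lemma orepV x : rho (x^-1)%g = (rho x)^T.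
Proof. by rewrite -[LHS]mul1mx -(rhoO x) -mulmxA -rhoM mulgV orep1 mulmx1. Qed.

Lemma orep_cvg (T : Type) (F : set_system T) (FF : ProperFilter F) (x : T -> G) y : x @ F --> y ->
  mxcvg F (fun t => rho (x t)) (rho y).
Proof.
move=> xy i j; have [_ _ c] := rhoP.
apply: (@cvg_comp _ _ _ x (fun z => rho z i j) F (nbhs y)) => //; exact: c.
Qed.

Definition disp x := fro (rho x - 1%:M).

Lemma disp_ge0 x : 0 <= disp x. Proof. exact: fro_ge0. Qed.

Lemma fro_rho_mul k x (A : 'M[R]_(n, k)) : fro (rho x *m A) = fro A.
Proof. exact: fro_orthl. Qed.

Lemma mulKmx_orth k x (A : 'M[R]_(n, k)) : (rho x)^T *m (rho x *m A) = A.
Proof. by rewrite mulmxA rhoO mul1mx. Qed.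

Lemma disp_divr x y : disp (x * y^-1)%g = fro (rho x - rho y).
Proof.
rewrite /disp -[RHS](fro_orthr (Q := (rho y)^T)); last by rewrite /orthogonal trmxK orthogonalT.
by rewrite mulmxBl orthogonalT // rhoM orepV.
Qed.

Lemma fro_exp_diff x k m : fro (rho (x ^+ (k + m))%g - rho (x ^+ k)%g) <= m%:R * disp x.
Proof.
elim: m => [|m IH]; first by rewrite addn0 subrr fro0 mul0r.
rewrite addnS expgS rhoM; apply: le_trans (fro_triangle (rho (x ^+ (k + m))%g) _ _) _.
rewrite -[m.+1]add1n natrD mulrDl mul1r lerD //.
by rewrite /disp -(fro_orthr (rho x - 1%:M) (rhoO (x ^+ (k + m))%g)) mulmxBl mul1mx.
Qed.

Lemma fro_exp_linear x m :
  fro (rho (x ^+ m)%g - 1%:M - m%:R *: (rho x - 1%:M)) <= (m%:R * disp x) ^+ 2.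
Proof.
elim: m => [|m IH]; first by rewrite expg0 orep1 subrr scale0r subrr fro0 sqr_ge0.
have -> : rho (x ^+ m.+1)%g - 1%:M - m.+1%:R *: (rho x - 1%:M) =
    (rho (x ^+ m)%g - 1%:M) *m (rho x - 1%:M) + (rho (x ^+ m)%g - 1%:M - m%:R *: (rho x - 1%:M)).
  rewrite expgSr rhoM mulmxBl !mulmxBr !mulmx1 mul1mx -[m.+1]add1n natrD scalerDl scale1r.
  move: (rho (x ^+ m)%g *m rho x) (rho (x ^+ m)%g) (rho x) (_ *: _) => A1 A2 A3 A4.
  by apply/matrixP => i j; rewrite !mxE; ring.
apply: le_trans (froD _ _) _; apply: le_trans (lerD (froM _ _) IH) _.
have h : fro (rho (x ^+ m)%g - 1%:M) <= m%:R * disp x.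
  by have := fro_exp_diff x 0 m; rewrite add0n expg0 orep1.
have := ler_wpM2r (disp_ge0 x) h; rewrite -/(disp x).
have := disp_ge0 x; move: (fro _ * disp x) => p; move: (disp x) => q q0.
have m0 : 0 <= m%:R :> R by []; move: m0; rewrite -[m.+1]add1n natrD; move: (m%:R) => y *.
have : 0 <= y * (q * q) by rewrite mulr_ge0 // mulr_ge0.
by nra.
Qed.

Lemma one_param0 B al : one_param rho B al -> rho (al 0) = 1%:M.
Proof.
move=> [H _]; have := H 0 0; rewrite addr0 => h.
by rewrite -[LHS]mul1mx -{1}(rhoO (al 0)) -mulmxA -h rhoO.
Qed.

Lemma one_param_diff B al : one_param rho B al -> exists2 C, 0 <= C &
  forall s t, fro (rho (al s) - rho (al t)) <= fro B * `|s - t| + C * `|s - t| ^+ 2.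
Proof.
move=> P; have [H [C C0 HC]] := P; exists C => // s t.
have -> : rho (al s) = rho (al (s - t)) *m rho (al t) by rewrite -H subrK.
rewrite -[X in _ - X]mul1mx -mulmxBl fro_orthr // real_normK ?num_real //.
have -> : rho (al (s - t)) - 1%:M = (s - t) *: B + (rho (al (s - t)) - 1%:M - (s - t) *: B).
  by rewrite subrKC.
by apply: le_trans (froD _ _) _; rewrite froZ mulrC lerD.
Qed.

Lemma one_param_cvg B al (T : Type) (F : set_system T) (FF : ProperFilter F) (s : T -> R) (t : R) :
  one_param rho B al -> s @ F --> t -> mxcvg F (fun z => rho (al (s z))) (rho (al t)).
Proof.
move=> P st; have [C C0 HC] := one_param_diff P; apply: mxcvg_fro0.
have nst : (fun z => `|s z - t|) @ F --> (0 : R).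
  rewrite -[X in _ --> X](normr0 R) -[X in `|X|](subrr t).
  by apply: cvg_norm; apply: cvgB => //; exact: cvg_cst.
apply: (@real_cvg0_le _ _ _ _ _ (fun z => fro B * `|s z - t| + C * (`|s z - t| * `|s z - t|))).
  rewrite -[X in _ --> X]addr0 -[X in _ --> X + _](mulr0 (fro B)) -[X in _ --> _ + X](mulr0 C).
  rewrite -[X in C * X](mulr0 0).
  apply: cvgD; apply: cvgM => //; [exact: cvg_cst|exact: cvg_cst|exact: cvgM].
by apply: nearW => z; rewrite ger0_norm ?fro_ge0 // -expr2.
Qed.

Lemma one_param_fixes k B al (v : 'M[R]_(n, k)) t :
  one_param rho B al -> B *m v = 0 -> rho (al t) *m v = v.
Proof.
move=> [H [C C0 HC]] Bv; apply/eqP; rewrite -subr_eq0; apply/eqP/fro_eq0; move: t.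
apply: (@subadditive_quadratic_eq0 _ (fun t => fro (rho (al t) *m v - v)) (C * fro v)).
- by move=> t; exact: fro_ge0.
- move=> s t; rewrite H [leRHS]addrC.
  apply: le_trans (fro_triangle (rho (al s) *m v) _ _) _.
  by rewrite lerD2r -mulmxA -mulmxBr fro_rho_mul.
- move=> t; have -> : rho (al t) *m v - v = (rho (al t) - 1%:M - t *: B) *m v.
    by rewrite !mulmxBl mul1mx -scalemxAl Bv scaler0 subr0.
  by apply: le_trans (froM _ _) _; rewrite mulrAC ler_wpM2r ?fro_ge0.
Qed.

Lemma one_param_eq B al be : one_param rho B al -> one_param rho B be ->
  forall t, rho (al t) = rho (be t).
Proof.
move=> [H [C C0 HC]] [H' [C' C0' HC']] t; apply/eqP; rewrite -subr_eq0; apply/eqP/fro_eq0; move: t.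
apply: (@subadditive_quadratic_eq0 _ (fun t => fro (rho (al t) - rho (be t))) (C + C')).
- by move=> t; exact: fro_ge0.
- move=> s t; rewrite H H' [leRHS]addrC.
  apply: le_trans (fro_triangle (rho (al s) *m rho (be t)) _ _) _.
  by rewrite -mulmxBr -mulmxBl fro_rho_mul fro_orthr.
- move=> t; apply: le_trans (fro_triangle (1%:M + t *: B) _ _) _.
  by rewrite mulrDl [X in _ + X]froB !opprD !addrA lerD.
Qed.

Lemma one_paramZ B al c : one_param rho B al -> one_param rho (c *: B) (fun t => al (c * t)).
Proof.
move=> [H [C C0 HC]]; split; first by move=> s t; rewrite mulrDr H.
exists (C * c ^+ 2); first by rewrite mulr_ge0 // sqr_ge0.
by move=> t; rewrite scalerA [t * c]mulrC -mulrA -exprMn; exact: HC.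
Qed.

Lemma one_paramJ B al x : one_param rho B al ->
  one_param rho (rho x *m B *m (rho x)^T) (fun t => (x * al t * x^-1)%g).
Proof.
move=> [H [C C0 HC]]; split.
  move=> s t; rewrite !rhoM orepV H !mulmxA -[_ *m (rho x)^T *m rho x]mulmxA rhoO.
  by rewrite mulmx1.
exists C => // t; have oT : orthogonal (rho x)^T by rewrite /orthogonal trmxK orthogonalT.
have -> : rho (x * al t * x^-1)%g - 1%:M - t *: (rho x *m B *m (rho x)^T) =
    rho x *m (rho (al t) - 1%:M - t *: B) *m (rho x)^T.
  rewrite !rhoM orepV !mulmxBr !mulmxBl -scalemxAr -scalemxAl mulmx1 orthogonalT //.
by rewrite (fro_orthr _ oT) fro_rho_mul.
Qed.

(** Limits of powers produce times [t >= 0] only; inverses supply the others. For [t < 0] the error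
    is multiplied by the orthogonal matrix [r (- t)], and the correction that appears accounts for
    [fro B * L] in the constant. *)
Lemma one_param_of_half B al L C : 0 <= L -> 0 <= C ->
  (forall t, 0 <= t -> fro (rho (al t) - 1%:M) <= L * t) ->
  (forall s t, 0 <= s -> 0 <= t -> rho (al (s + t)) = rho (al s) *m rho (al t)) ->
  (forall t, 0 <= t -> fro (rho (al t) - 1%:M - t *: B) <= C * t ^+ 2) ->
  exists be, one_param rho B be.
Proof.
move=> L0 C0 HL H HC; pose be t := if 0 <= t then al t else ((al (- t))^-1)%g.
pose r t := rho (be t).
have rO t : orthogonal (r t) by exact: rhoO.
have r_pos t : 0 <= t -> r t = rho (al t) by rewrite /r /be => ->.
have al0 : rho (al 0) = 1%:M.
  have := H 0 0 (lexx _) (lexx _); rewrite addr0 => h.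
  by rewrite -[LHS]mul1mx -{1}(rhoO (al 0)) -mulmxA -h rhoO.
have r_neg t : 0 <= t -> r (- t) = (r t)^T.
  move=> t0; rewrite [in RHS]r_pos // /r /be oppr_ge0 opprK.
  case: ifP => [t0'|_]; last exact: orepV.
  have -> : t = 0 by apply/eqP; rewrite eq_le t0' t0.
  by rewrite oppr0 al0 trmx1.
have rD s t : 0 <= s -> 0 <= t -> r (s + t) = r s *m r t.
  by move=> s0 t0; rewrite !r_pos ?addr_ge0 // H.
have rT s : r s *m (r s)^T = 1%:M by exact: orthogonalT.
have rBr s t : 0 <= s -> 0 <= t -> r (s - t) = r s *m (r t)^T.
  move=> s0 t0; case: (leP t s) => st.
    have -> : r s = r (s - t) *m r t by rewrite -rD ?subrK // subr_ge0.
    by rewrite -mulmxA rT mulmx1.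
  rewrite -opprB r_neg ?subr_ge0 ?(ltW st) //.
  have -> : r t = r (t - s) *m r s by rewrite -rD ?subrK // subr_ge0 ltW.
  by rewrite trmx_mul mulmxA rT mul1mx.
have rBl s t : 0 <= s -> 0 <= t -> r (s - t) = (r t)^T *m r s.
  move=> s0 t0; case: (leP t s) => st.
    have -> : r s = r t *m r (s - t) by rewrite -rD ?subr_ge0 // subrKC.
    by rewrite mulmxA rO mul1mx.
  rewrite -opprB r_neg ?subr_ge0 ?(ltW st) //.
  have -> : r t = r s *m r (t - s) by rewrite -rD ?subr_ge0 ?(ltW st) // subrKC.
  by rewrite trmx_mul -mulmxA rO mulmx1.
exists be; split.
  move=> s t; rewrite -!/(r _).
  case: (leP 0 s) => s0; case: (leP 0 t) => t0.
  - exact: rD.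
  - have u0 : 0 <= - t by rewrite oppr_ge0 ltW.
    have -> : r (s + t) = r s *m (r (- t))^T by rewrite -rBr // opprK.
    by have := r_neg _ u0; rewrite opprK => ->.
  - have u0 : 0 <= - s by rewrite oppr_ge0 ltW.
    have -> : r (s + t) = (r (- s))^T *m r t by rewrite -rBl // opprK addrC.
    by have := r_neg _ u0; rewrite opprK => ->.
  - have u0 : 0 <= - s by rewrite oppr_ge0 ltW.
    have v0 : 0 <= - t by rewrite oppr_ge0 ltW.
    have -> : r (s + t) = (r (- s))^T *m (r (- t))^T.
      by rewrite -trmx_mul -rD // -r_neg ?addr_ge0 // opprD !opprK addrC.
    by have := r_neg _ u0; rewrite opprK => ->; have := r_neg _ v0; rewrite opprK => ->.
exists (C + fro B * L); first by rewrite addr_ge0 // mulr_ge0 // fro_ge0.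
move=> t; rewrite -/(r t); case: (leP 0 t) => t0.
  rewrite r_pos // (le_trans (HC _ t0)) // ler_wpM2r ?sqr_ge0 // lerDl.
  by rewrite mulr_ge0 // fro_ge0.
have u0 : 0 <= - t by rewrite oppr_ge0 ltW.
have rt : r t = (r (- t))^T by rewrite -r_neg // opprK.
rewrite -(fro_orthr _ (rO (- t))).
have -> : (r t - 1%:M - t *: B) *m r (- t) =
    - (r (- t) - 1%:M - (- t) *: B) + (- t) *: (B *m (r (- t) - 1%:M)).
  rewrite !mulmxBl rt rO mul1mx mulmxBr mulmx1 -scalemxAl.
  move: (B *m r (- t)) => A1; move: (r (- t)) => A2; apply/matrixP => i j; rewrite !mxE; ring.
apply: le_trans (froD _ _) _; rewrite froN froZ ger0_norm // mulrDl -[t ^+ 2]sqrrN.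
rewrite lerD //; first by rewrite r_pos // HC.
apply: (@le_trans _ _ (- t * (fro B * (L * - t)))); last first.
  by rewrite le_eqVlt; apply/orP; left; apply/eqP; ring.
rewrite ler_wpM2l //; apply: le_trans (froM _ _) _.
by rewrite ler_wpM2l ?fro_ge0 // r_pos // HL.
Qed.

Section Limits.
Variable U : set_system nat.
Hypotheses (UU : UltraFilter U) (Uoo : \oo `<=` U).
Let UP : ProperFilter U := ultra_proper (F := U).

(** [al t] is a limit of powers of [g k], with exponent [t / disp (g k)] rounded down. It is chosen
    for each [t] separately by compactness of [G], so different times are related only through
    [rho]. *)
Lemma one_param_limit (g : nat -> G) (B : 'M[R]_n) :
  (forall k, 0 < disp (g k)) -> (fun k => disp (g k)) @ U --> (0 : R) ->
  mxcvg U (fun k => (disp (g k))^-1 *: (rho (g k) - 1%:M)) B ->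
  exists al, one_param rho B al.
Proof.
move=> g0 gU gB; pose m t k := Num.truncn (t / disp (g k)).
have m_le t k : 0 <= t -> (m t k)%:R * disp (g k) <= t.
  by move=> t0; rewrite -ler_pdivlMr // truncn_le // divr_ge0 // ltW.
have m_ge t k : 0 <= t -> t <= (m t k)%:R * disp (g k) + disp (g k).
  move=> t0; have := truncnS_gt (t / disp (g k)); rewrite -/(m t k) => /ltW.
  by rewrite ler_pdivrMr // -addn1 natrD mulrDl mul1r.
have m_cvg t : 0 <= t -> (fun k => (m t k)%:R * disp (g k)) @ U --> t.
  move=> t0; have c0 : (fun k => (m t k)%:R * disp (g k) - t) @ U --> (0 : R).
    apply: (real_cvg0_le gU); apply: nearW => k.
    have := m_le t k t0; have := m_ge t k t0 => h1 h2.
    by rewrite ler_norml; apply/andP; split; move: (g0 k) h1 h2; lra.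
  rewrite (_ : (fun k => _) = (fun k => ((m t k)%:R * disp (g k) - t) + t)); last first.
    by apply/funext => k; rewrite subrK.
  by rewrite -[X in _ --> X]add0r; apply: cvgD => //; exact: cvg_cst.
have ex t : exists p : G, (fun k => (g k ^+ m t k)%g) @ U --> p.
  by have [//|p _ Hp] := ultra_compact_cvg (x := fun k => (g k ^+ m t k)%g) UU cG; exists p.
have [al Hal] := choice ex.
have rho_al t : mxcvg U (fun k => rho (g k ^+ m t k)%g) (rho (al t)) by exact: orep_cvg.
apply: (@one_param_of_half B al 1 1) => //.
- move=> t t0; have c1 : (fun k => fro (rho (g k ^+ m t k)%g - 1%:M)) @ U --> fro (rho (al t) - 1%:M).
    by apply: mxcvg_fro; apply: mxcvgB => //; exact: mxcvg_cst.
  rewrite mul1r; apply: (ler_cvg_to c1 (cvg_cst t)); apply: nearW => k.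
  have := fro_exp_diff (g k) 0 (m t k); rewrite add0n expg0 orep1 => /le_trans; apply.
  exact: m_le.
- move=> s t s0 t0; apply/eqP; rewrite -subr_eq0; apply/eqP.
  have c1 : mxcvg U (fun k => rho (g k ^+ m (s + t) k)%g - rho (g k ^+ m s k)%g *m rho (g k ^+ m t k)%g)
      (rho (al (s + t)) - rho (al s) *m rho (al t)) by apply: mxcvgB => //; exact: mxcvgM.
  apply: (mxcvg_unique c1); apply: mxcvg_fro0; apply: (real_cvg0_le gU); apply: nearW => k.
  rewrite subr0 ger0_norm ?fro_ge0 // -rhoM -expgnDr.
  (* By the rounding, the exponent for [s + t] is the sum of the two exponents or its successor; one
     more factor [g k] costs [disp (g k)], which tends to [0]. *)
  have [e1 e2] : (m s k + m t k <= m (s + t)%R k)%N /\ (m (s + t)%R k <= (m s k + m t k).+1)%N.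
    split.
      rewrite truncn_ge_nat ?divr_ge0 ?addr_ge0 ?(ltW (g0 k)) // natrD mulrDl lerD //.
        by rewrite ler_pdivlMr // m_le.
      by rewrite ler_pdivlMr // m_le.
    rewrite -ltnS truncn_lt_nat ?divr_ge0 ?addr_ge0 ?(ltW (g0 k)) // mulrDl.
    have h1 := truncnS_gt (s / disp (g k)); have h2 := truncnS_gt (t / disp (g k)).
    by rewrite -addSn -addnS natrD ltrD.
  move: e1; rewrite leq_eqVlt => /predU1P[<-|e1].
    by rewrite subrr fro0 ltW.
  have -> : m (s + t) k = (m s k + m t k + 1)%N by apply/eqP; rewrite addn1 eqn_leq e2 e1.
  by have := fro_exp_diff (g k) (m s k + m t k) 1; rewrite mul1r.
- move=> t t0; rewrite mul1r.
  have c1 : (fun k => fro (rho (g k ^+ m t k)%g - 1%:M -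
      ((m t k)%:R * disp (g k)) *: ((disp (g k))^-1 *: (rho (g k) - 1%:M)))) @ U -->
      fro (rho (al t) - 1%:M - t *: B).
    apply: mxcvg_fro; apply: mxcvgB; first by apply: mxcvgB => //; exact: mxcvg_cst.
    by apply: mxcvgZ => //; exact: m_cvg.
  apply: (ler_cvg_to c1 (cvg_cst (t ^+ 2))); apply: nearW => k.
  rewrite scalerA mulfK ?gt_eqF //; apply: le_trans (fro_exp_linear _ _) _.
  by rewrite ler_pXn2r ?nnegrE ?mulr_ge0 ?disp_ge0 // m_le.
Qed.

(* Every limiting direction of the orbit of [v] at [v] is tangent to a
   one-parameter orbit.  The group elements realising the displacements are
   chosen (almost) as close to [1] as possible: otherwise their limiting
   direction could lie in the Lie algebra of the stabiliser of [v]. *)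
Lemma orbit_tangent k (v : 'M[R]_(n, k)) (g : nat -> G) (xi : 'M[R]_(n, k)) :
  (forall j, rho (g j) *m v - v != 0) ->
  (fun j => fro (rho (g j) *m v - v)) @ U --> (0 : R) ->
  mxcvg U (fun j => (fro (rho (g j) *m v - v))^-1 *: (rho (g j) *m v - v)) xi ->
  exists B al, one_param rho B al /\ B *m v = xi.
Proof.
set w := fun j => rho (g j) *m v - v => w_neq0 wU wxi.
have w0 j : 0 < fro (w j) by rewrite fro_gt0 // w_neq0.
have v0 : 0 < fro v.
  rewrite fro_gt0 //; apply: contraTneq (w0 0%N) => v0.
  by rewrite /w v0 mulmx0 subrr fro0 ltxx.
have w_disp h j : rho h *m v = rho (g j) *m v -> fro (w j) / fro v <= disp h.
  move=> hg; rewrite ler_pdivrMr // /w -hg /disp.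
  by rewrite -[X in _ - X]mul1mx -mulmxBl froM.
have exh j : exists h, rho h *m v = rho (g j) *m v /\
    forall h', rho h' *m v = rho (g j) *m v -> disp h <= 2 * disp h'.
  pose E := [set d | exists2 h, rho h *m v = rho (g j) *m v & disp h = d].
  have E_lb : lbound E (fro (w j) / fro v) by move=> _ [h hg <-]; exact: w_disp.
  have E_inf : has_inf E.
    by split; [exists (disp (g j)), (g j)|exists (fro (w j) / fro v)].
  (* Since the infimum is positive, some displacement lies below twice it: the source of the factor
     [2]. *)
  have i0 : 0 < inf E.
    apply: (@lt_le_trans _ _ (fro (w j) / fro v)); first by rewrite divr_gt0.
    by apply: lb_le_inf => //; case: E_inf.
  have [d [h hg <-]] := inf_adherent i0 E_inf.
  move=> hd; exists h; split=> // h' hg'.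
  have : inf E <= disp h'.
    by apply: ge_inf; [exists (fro (w j) / fro v)|exists h'].
  by move: hd; move: (inf E) (disp h) (disp h') => a b c; lra.
have [h Hh] := choice exh.
have hg j : rho (h j) *m v = rho (g j) *m v by have [] := Hh j.
have hmin j h' : rho h' *m v = rho (g j) *m v -> disp (h j) <= 2 * disp h'.
  by have [_] := Hh j; apply.
pose ep j := disp (h j).
have ep0 j : 0 < ep j.
  by apply: lt_le_trans (w_disp _ _ (hg j)); rewrite divr_gt0.
have [hoo _ hU] := ultra_compact_cvg (x := h) UU cG (fun=> I).
have rhU : mxcvg U (fun j => rho (h j)) (rho hoo) by exact: orep_cvg.
have wU0 : mxcvg U w 0.
  apply: mxcvg_fro0; rewrite (_ : (fun t => _) = fun j => fro (w j)) //.
  by apply/funext => j; rewrite subr0.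
have hoov : rho hoo *m v = v.
  have c1 : mxcvg U (fun j => rho (h j) *m v) (rho hoo *m v).
    by apply: mxcvgM => //; exact: mxcvg_cst.
  apply: (mxcvg_unique c1).
  rewrite (_ : (fun t => _) = fun j => w j + v); last first.
    by apply/funext => j; rewrite /w subrK hg.
  by rewrite -[X in mxcvg _ _ X]add0r; apply: mxcvgD => //; exact: mxcvg_cst.
(* The limit [hoo] stabilises [v], so [h j * hoo^-1] has the same effect on [v] as [h j] and
   competes with it. *)
have epU : ep @ U --> (0 : R).
  apply: (@real_cvg0_le _ _ _ _ _ (fun j => 2 * fro (rho (h j) - rho hoo))).
    rewrite -[X in _ --> X](mulr0 2) -[X in 2 * X](fro0 R n n) -[X in fro X](subrr (rho hoo)).
    apply: cvgM; first exact: cvg_cst.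
    by apply: mxcvg_fro; apply: mxcvgB => //; exact: mxcvg_cst.
  apply: nearW => j; rewrite ger0_norm ?(ltW (ep0 j)) // -disp_divr; apply: hmin.
  by rewrite rhoM -mulmxA orepV -[X in _ *m (_ *m X)]hoov mulKmx_orth hg.
have [B HB] : exists B, mxcvg U (fun j => (ep j)^-1 *: (rho (h j) - 1%:M)) B.
  apply: (mxcvg_ultra (C := 1)) => // j; rewrite froZ ger0_norm ?invr_ge0 ?(ltW (ep0 j)) // mulVf ?(gt_eqF (ep0 j)) //.
have [al Hal] := one_param_limit ep0 epU HB.
have wB : mxcvg U (fun j => (ep j)^-1 *: w j) (B *m v).
  rewrite (_ : (fun j => _) = fun j => ((ep j)^-1 *: (rho (h j) - 1%:M)) *m v).
    by apply: mxcvgM => //; exact: mxcvg_cst.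
  by apply/funext => j; rewrite -scalemxAl mulmxBl mul1mx hg.
(* Otherwise the path fixes [v], and [h j * (al (ep j))^-1] competes with [h j] with a displacement
   of smaller order than [ep j], against near-minimality. *)
have Bv : B *m v != 0.
  apply/eqP => Bv; have [_ [C C0 HC]] := Hal.
  have key j : 1 <= 2 * (fro ((ep j)^-1 *: (rho (h j) - 1%:M) - B) + C * ep j).
    have := hmin j (h j * (al (ep j))^-1)%g; rewrite disp_divr => H.
    have {}H : ep j <= 2 * fro (rho (h j) - rho (al (ep j))).
      apply: H; rewrite rhoM orepV -mulmxA -[X in _ *m (_ *m X)](one_param_fixes (ep j) Hal Bv).
      by rewrite mulKmx_orth hg.
    rewrite -(ler_pM2l (ep0 j)) mulr1 mulrCA; apply: le_trans H _; rewrite ler_pM2l //.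
    apply: le_trans (fro_triangle (1%:M + ep j *: B) _ _) _.
    rewrite mulrDr lerD //.
      rewrite -[X in X * fro _](ger0_norm (ltW (ep0 j))) -froZ scalerBr scalerA mulfV ?gt_eqF //.
      by rewrite scale1r opprD addrA.
    by rewrite froB opprD addrA (le_trans (HC _)) // expr2 mulrCA.
  have c0 : (fun j => 2 * (fro ((ep j)^-1 *: (rho (h j) - 1%:M) - B) + C * ep j)) @ U -->
      (2 * (fro (B - B) + C * 0) : R).
    apply: cvgM; first exact: cvg_cst.
    apply: cvgD; last by apply: cvgM; [exact: cvg_cst|exact: epU].
    by apply: mxcvg_fro; apply: mxcvgB => //; exact: mxcvg_cst.
  have : 1 <= 2 * (fro (B - B) + C * 0).
    by apply: (ler_cvg_to (cvg_cst (1 : R)) c0); exact: nearW.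
  by rewrite subrr fro0 mulr0 addr0 mulr0 ler10.
have fB : fro (B *m v) != 0 by rewrite gt_eqF // fro_gt0.
exists ((fro (B *m v))^-1 *: B), (fun t => al ((fro (B *m v))^-1 * t)).
split; first exact: one_paramZ.
rewrite -scalemxAl; apply: (mxcvg_unique _ wxi).
rewrite (_ : (fun j => _) = fun j => (fro ((ep j)^-1 *: w j))^-1 *: ((ep j)^-1 *: w j)).
  apply: mxcvgZ => //; apply: cvgV => //; exact: mxcvg_fro.
apply/funext => j; rewrite froZ ger0_norm ?invr_ge0 ?(ltW (ep0 j)) // scalerA.
congr (_ *: _); rewrite invfM invrK mulrC mulrA mulVf ?mul1r // gt_eqF //.
Qed.

End Limits.

End OneRep.
End Representations.

Lemma mxcvg_direction (R : realType) (T : Type) (F : set_system T) (FF : ProperFilter F) n k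
    (a : T -> R) (w : T -> 'M[R]_(n, k)) (L : 'M[R]_(n, k)) :
  (forall t, 0 < a t) -> L != 0 -> mxcvg F (fun t => a t *: w t) L ->
  mxcvg F (fun t => (fro (w t))^-1 *: w t) ((fro L)^-1 *: L).
Proof.
move=> a0 L0 H.
rewrite (_ : (fun t => _) = fun t => (fro (a t *: w t))^-1 *: (a t *: w t)).
  by apply: mxcvgZ => //; apply: cvgV; [rewrite gt_eqF // fro_gt0|exact: mxcvg_fro].
apply/funext => t; rewrite froZ gtr0_norm // scalerA; congr (_ *: _).
by rewrite invfM mulrC mulrA mulfV ?mul1r // gt_eqF.
Qed.

Lemma fro_sqrB (R : realType) n k (A B : 'M[R]_(n, k)) :
  fro (A - B) ^+ 2 = fro A ^+ 2 - 2 * mxdot B A + fro B ^+ 2.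
Proof.
by rewrite !fro_sqr mxdotDl !mxdotDr !mxdotNl !mxdotNr [mxdot A B]mxdotC; ring.
Qed.

(** * Lifting one-parameter paths to a direct sum *)

Section BlockRepresentation.
Variables (R : realType) (G : topologicalGroupType).
Hypothesis cG : compact [set: G].
Variables (n0 n1 : nat) (rho0 : G -> 'M[R]_n0) (rho1 : G -> 'M[R]_n1).
Hypotheses (rho0P : orep rho0) (rho1P : orep rho1).

Definition rho_block x : 'M[R]_(n0 + n1) := block_mx (rho0 x) 0 0 (rho1 x).

Lemma orep_block : orep rho_block.
Proof.
have [M0 O0 c0] := rho0P; have [M1 O1 c1] := rho1P; split.
- by move=> x y; rewrite /rho_block mulmx_block !mulmx0 !mul0mx !addr0 !add0r M0 M1.
- move=> x; rewrite /orthogonal tr_block_mx mulmx_block !trmx0 !mulmx0 !mul0mx !addr0 !add0r.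
  by rewrite O0 O1 -scalar_mx_block.
- move=> i j; case: (split_ordP i) => i' ->; case: (split_ordP j) => j' ->.
  + by rewrite (_ : (fun x => _) = fun x => rho0 x i' j'); [exact: c0|apply/funext => x; rewrite block_mxEul].
  + by rewrite (_ : (fun x => _) = fun x => 0); [exact: cts_cst|apply/funext => x; rewrite block_mxEur mxE].
  + by rewrite (_ : (fun x => _) = fun x => 0); [exact: cts_cst|apply/funext => x; rewrite block_mxEdl mxE].
  + by rewrite (_ : (fun x => _) = fun x => rho1 x i' j'); [exact: c1|apply/funext => x; rewrite block_mxEdr].
Qed.

Lemma fro_col_mx0 k (A : 'M[R]_(n0, k)) : fro (col_mx A (0 : 'M[R]_(n1, k))) = fro A.
Proof.
rewrite /fro /mxdot big_split_ord /= [X in _ + X]big1 ?addr0.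
  by congr Num.sqrt; apply: eq_bigr => i _; apply: eq_bigr => j _; rewrite col_mxEu.
by move=> i _; rewrite big1 // => j _; rewrite col_mxEd mxE mul0r.
Qed.

(** A matrix whose orbit under [rho_block] records exactly [rho0], so that tangents to the orbit at
    [v] amount to generators for [rho0]. *)
Let v : 'M[R]_(n0 + n1, n0) := col_mx 1%:M 0.

Lemma rho_block_v x : rho_block x *m v = col_mx (rho0 x) 0.
Proof. by rewrite mul_block_col !mulmx0 mul0mx addr0 mulmx1 addr0. Qed.

(** Along [al0] the displacements of [v] have the direction [col_mx B0 0]. By [orbit_tangent] this
    direction also comes from a one-parameter path of the block representation; seen by [rho0], that
    path has the generator [B0] and so agrees with [al0]. *)
Lemma one_param_lift B0 al0 : one_param rho0 B0 al0 ->
  exists B al, one_param rho_block B al /\ forall t, rho0 (al t) = rho0 (al0 t).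
Proof.
move=> P0; have [H0 [C C0 HC]] := P0.
have [B00|B00] := eqVneq B0 0.
  exists 0, (fun=> 1%g); split.
    split; first by move=> s t; rewrite (orep1 orep_block) mulmx1.
    exists 0 => // t; rewrite (orep1 orep_block) subrr scaler0 subr0 fro0 mul0r //.
  move=> t; rewrite (orep1 rho0P) -[RHS]mulmx1.
  by rewrite (one_param_fixes rho0P t P0) // B00 mul0mx.
have b0 : 0 < fro B0 by rewrite fro_gt0.
have C1 : 0 < C + 1 by rewrite ltr_wpDl.
(* For [0 < s <= c] the quadratic error is below [fro B0 * s], so the displacement along [al0] is
   nonzero, as [orbit_tangent] demands. *)
pose c := fro B0 / (C + 1); have c0 : 0 < c by rewrite divr_gt0.
pose s j : R := c * j.+1%:R^-1.
have s0 j : 0 < s j by rewrite mulr_gt0 ?invr_gt0.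
have sc j : s j <= c by rewrite ler_piMr ?(ltW c0) // invf_le1 ?ler1n.
have [U [UU Uoo]] := ultra_nat; have UP : ProperFilter U by exact: ultra_proper.
have sU : s @ U --> (0 : R).
  rewrite -[X in _ --> X](mulr0 c); apply: cvgM; first exact: cvg_cst.
  exact: (harmonic_cvg_ultra Uoo).
have w_eq j : rho_block (al0 (s j)) *m v - v = col_mx (rho0 (al0 (s j)) - 1%:M) 0.
  by rewrite rho_block_v opp_col_mx add_col_mx subr0.
have w_neq0 j : rho_block (al0 (s j)) *m v - v != 0.
  apply/eqP => w0; have : fro (rho0 (al0 (s j)) - 1%:M) = 0 by rewrite -fro_col_mx0 -w_eq w0 fro0.
  move/fro_eq0 => h; have := HC (s j); rewrite h sub0r froN froZ gtr0_norm // expr2 mulrCA.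
  rewrite ler_pM2l // => /(le_trans)/(_ (ler_wpM2l C0 (sc j))).
  rewrite /c mulrA ler_pdivlMr // mulrDr mulr1 mulrC gerDl leNgt.
  by rewrite b0.
have rho0U : mxcvg U (fun j => rho0 (al0 (s j))) 1%:M.
  by rewrite -(one_param0 rho0P P0); exact: (one_param_cvg rho0P _ P0).
have wU : (fun j => fro (rho_block (al0 (s j)) *m v - v)) @ U --> (0 : R).
  rewrite (_ : (fun j => _) = fun j => fro (rho0 (al0 (s j)) - 1%:M)); last first.
    by apply/funext => j; rewrite w_eq fro_col_mx0.
  rewrite -[X in _ --> X](fro0 R n0 n0) -[X in fro X](subrr (1%:M : 'M[R]_n0)).
  by apply: mxcvg_fro; apply: mxcvgB => //; exact: mxcvg_cst.
have dirB : mxcvg U (fun j => (s j)^-1 *: (rho_block (al0 (s j)) *m v - v)) (col_mx B0 0).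
  apply: mxcvg_fro0; apply: (@real_cvg0_le _ _ _ _ _ (fun j => C * s j)).
    by rewrite -[X in _ --> X](mulr0 C); apply: cvgM => //; exact: cvg_cst.
  apply: nearW => j; rewrite ger0_norm ?fro_ge0 // w_eq scale_col_mx scaler0 opp_col_mx.
  rewrite add_col_mx subr0 fro_col_mx0 -(ler_pM2l (s0 j)).
  rewrite -[X in X * fro _](gtr0_norm (s0 j)) -froZ scalerBr scalerA mulfV ?gt_eqF // scale1r.
  by apply: le_trans (HC _) _; rewrite expr2 mulrCA.
have L0 : col_mx B0 (0 : 'M[R]_(n1, n0)) != 0.
  by apply: contra_neq B00 => h; apply: fro_eq0; rewrite -fro_col_mx0 h fro0.
have s0V j : 0 < (s j)^-1 by rewrite invr_gt0.
have dir := mxcvg_direction UP s0V L0 dirB.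
have [B [al [P BV]]] := orbit_tangent cG orep_block UU w_neq0 wU dir.
have {}P := one_paramZ (fro B0) P.
exists (fro B0 *: B), (fun t => al (fro B0 * t)); split=> //.
apply: (one_param_eq rho0P _ P0); have [H [C' C0' HC']] := P; split.
  move=> t t'; have := H t t'.
  by rewrite mulmx_block !mulmx0 !addr0 => /eq_block_mx[].
exists (C' * fro v); first by rewrite mulr_ge0 // fro_ge0.
move=> t; have -> : fro (rho0 (al (fro B0 * t)) - 1%:M - t *: B0) =
    fro ((rho_block (al (fro B0 * t)) - 1%:M - t *: (fro B0 *: B)) *m v).
  rewrite !mulmxBl mul1mx rho_block_v -!scalemxAl BV fro_col_mx0 !scalerA -mulrA mulfV ?gt_eqF //.
  rewrite mulr1 scale_col_mx scaler0 !opp_col_mx !add_col_mx !oppr0 !addr0.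
  by rewrite fro_col_mx0.
by apply: le_trans (froM _ _) _; rewrite mulrAC ler_wpM2r ?fro_ge0.
Qed.

End BlockRepresentation.

(** * Gradient steps along an orbit *)

Section Contraction.
Variables (R : realType) (G : topologicalGroupType).
Hypothesis cG : compact [set: G].
Variables (n : nat) (rho : G -> 'M[R]_n).
Hypothesis rhoP : orep rho.
Let rhoM x y : rho (x * y)%g = rho x *m rho y. Proof. by have [] := rhoP. Qed.
Let rhoO x : orthogonal (rho x). Proof. by have [] := rhoP. Qed.

Definition spanning m (B : 'I_m -> 'M[R]_n) (al : 'I_m -> R -> G) :=
  (forall j, one_param rho (B j) (al j)) /\
  forall B' al', one_param rho B' al' -> exists c : 'I_m -> R, B' = \sum_j c j *: B j.

(** Taking generators whose span has maximal dimension avoids proving that sums of generators are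
    generators. *)
Lemma spanning_exists : exists m (B : 'I_m -> 'M[R]_n) al, spanning B al.
Proof.
pose gen (B : 'M[R]_n) := exists al, one_param rho B al.
pose P d := `[< exists2 s : seq 'M[R]_n, (forall B, B \in s -> gen B) & \dim (span s) = d >].
have P0 : exists d, P d.
  by exists 0%N; apply/asboolP; exists [::] => //; rewrite span_nil dimv0.
have Pb d : P d -> (d <= dim 'M[R]_n)%N.
  by move=> /asboolP [s _ <-]; rewrite -dimvf dimvS // subvf.
case: (ex_maxnP P0 Pb) => d /asboolP [s sgen sd] dmax.
have exal (j : 'I_(size s)) : exists al, one_param rho s`_j al.
  by apply: sgen; exact: mem_nth.
have [al Hal] := choice exal.
exists (size s), (fun j => s`_j), al; split=> // B' al' P'.
have Bs : B' \in span s.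
  apply/negPn/negP => nB; have : P (\dim (span (B' :: s))).
    apply/asboolP; exists (B' :: s) => // B; rewrite inE => /predU1P[->|]; last exact: sgen.
    by exists al'.
  move=> /dmax; rewrite -sd leqNgt => /negP; apply.
  rewrite span_cons; apply: (@leq_trans (\dim (<[B']> + span s)%VS)) => //.
  rewrite ltn_neqAle dimvS ?addvSr // andbT; apply: contraNneq nB => h.
  have : (span s == <[B']> + span s)%VS by rewrite eqEdim addvSr h leqnn.
  by move=> /eqP ->; rewrite memvE addvSl.
exists (fun j => coord (in_tuple s) j B').
exact: (coord_span (X := in_tuple s)).
Qed.

Section Spanning.
Variables (m : nat) (B : 'I_m -> 'M[R]_n) (al : 'I_m -> R -> G).
Hypothesis Bal : spanning B al.
Variable v : 'cV[R]_n.

(** A sequence violating the bound yields a unit vector [xi] tangent to the orbit at [v], hence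
    [xi = B' *m v] for a generator [B']. Conjugated by the limit [xo] of the base points, [B'] lies
    in the span of the [B j]; but [rho xo *m xi] is orthogonal to every [B j *m (rho xo *m v)],
    hence to itself. *)
Lemma orbit_nondegenerate : exists c d, [/\ 0 < c, 0 < d & forall x y,
  fro (rho y *m v - rho x *m v) <= d ->
  c * fro (rho y *m v - rho x *m v) ^+ 2 <=
  \sum_j mxdot (B j *m (rho x *m v)) (rho y *m v - rho x *m v) ^+ 2].
Proof.
apply: contrapT => Hn.
have ex k : exists xy : G * G,
    fro (rho xy.2 *m v - rho xy.1 *m v) <= k.+1%:R^-1 /\
    \sum_j mxdot (B j *m (rho xy.1 *m v)) (rho xy.2 *m v - rho xy.1 *m v) ^+ 2 <
    k.+1%:R^-1 * fro (rho xy.2 *m v - rho xy.1 *m v) ^+ 2.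
  apply: contrapT => Hk; apply: Hn; exists k.+1%:R^-1, k.+1%:R^-1; rewrite invr_gt0; split=> // x y h.
  by rewrite leNgt; apply/negP => h'; apply: Hk; exists (x, y).
have [xy Hxy] := choice ex.
pose x k := (xy k).1; pose y k := (xy k).2; pose g k := ((x k)^-1 * y k)%g.
pose w k := rho (g k) *m v - v.
have [U [UU Uoo]] := ultra_nat; have UP : ProperFilter U by exact: ultra_proper.
have rw k : rho (x k) *m w k = rho (y k) *m v - rho (x k) *m v.
  by rewrite mulmxBr mulmxA -rhoM mulVKg.
have fw k : fro (w k) = fro (rho (y k) *m v - rho (x k) *m v).
  by rewrite -rw fro_orthl.
have w_neq0 k : w k != 0.
  apply/eqP => w0; have [_] := Hxy k; rewrite -/(x k) -/(y k) -rw w0 mulmx0 fro0.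
  rewrite expr0n /= mulr0 ltNge; apply/negP; rewrite negbK.
  by apply: sumr_ge0 => j _; exact: sqr_ge0.
have w0 k : 0 < fro (w k) by rewrite fro_gt0.
have wU : (fun k => fro (w k)) @ U --> (0 : R).
  apply: (real_cvg0_le (harmonic_cvg_ultra Uoo)); apply: nearW => k.
  by rewrite ger0_norm ?fro_ge0 // fw; have [] := Hxy k.
have fu k : fro ((fro (w k))^-1 *: w k) = 1.
  by rewrite froZ gtr0_norm ?invr_gt0 // mulVf // gt_eqF.
have [xi Hxi] : exists xi, mxcvg U (fun k => (fro (w k))^-1 *: w k) xi.
  by apply: (mxcvg_ultra (C := 1)) => // k; rewrite fu.
have xi1 : fro xi = 1.
  apply: (@real_cvg_unique _ _ U _ (fun k => fro ((fro (w k))^-1 *: w k))).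
    exact: mxcvg_fro.
  by under eq_fun do rewrite fu; exact: cvg_cst.
have [xo _ xU] := ultra_compact_cvg (x := x) UU cG (fun=> I).
have rxU : mxcvg U (fun k => rho (x k)) (rho xo) by exact: orep_cvg.
have [B' [al' [P' B'v]]] := orbit_tangent cG rhoP UU w_neq0 wU Hxi.
have [Bgen Bspan] := Bal.
have [c Hc] := Bspan _ _ (one_paramJ rhoP xo P').
have lim0 : \sum_j mxdot (B j *m (rho xo *m v)) (rho xo *m xi) ^+ 2 <= 0.
  have c1 : (fun k => \sum_j (mxdot (B j *m (rho (x k) *m v)) (rho (x k) *m ((fro (w k))^-1 *: w k)) *
      mxdot (B j *m (rho (x k) *m v)) (rho (x k) *m ((fro (w k))^-1 *: w k)))) @ U -->
      \sum_j (mxdot (B j *m (rho xo *m v)) (rho xo *m xi) * mxdot (B j *m (rho xo *m v)) (rho xo *m xi)).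
    apply: real_cvg_sum => j.
    have c2 : (fun k => mxdot (B j *m (rho (x k) *m v)) (rho (x k) *m ((fro (w k))^-1 *: w k))) @ U -->
        mxdot (B j *m (rho xo *m v)) (rho xo *m xi).
      apply: mxcvg_mxdot; last exact: mxcvgM.
      by apply: mxcvgM; [exact: mxcvg_cst|apply: mxcvgM => //; exact: mxcvg_cst].
    exact: cvgM.
  under eq_bigr do rewrite expr2.
  apply: (ler_cvg_to c1 (harmonic_cvg_ultra Uoo)); apply: nearW => k.
  rewrite -scalemxAr rw; under eq_bigr do rewrite -expr2 mxdotZr exprMn.
  rewrite -mulr_sumr exprVn mulrC ler_pdivrMr ?exprn_gt0 //.
  by have [_ /ltW] := Hxy k; rewrite -fw.
have mx0 j : mxdot (B j *m (rho xo *m v)) (rho xo *m xi) = 0.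
  apply/eqP; rewrite -sqrf_eq0 eq_le sqr_ge0 andbT; apply: le_trans lim0.
  rewrite (bigD1 j) //= lerDl; apply: sumr_ge0 => i _; exact: sqr_ge0.
have : mxdot (rho xo *m xi) (rho xo *m xi) = 0.
  rewrite -{1}B'v mulmxA.
  have -> : rho xo *m B' *m v = (rho xo *m B' *m (rho xo)^T) *m (rho xo *m v).
    by rewrite -[RHS]mulmxA (mulKmx_orth rhoP).
  rewrite Hc mulmx_suml mxdot_suml big1 // => j _.
  by rewrite -scalemxAl mxdotZl mx0 mulr0.
by rewrite mxdot_orthl // -fro_sqr xi1 expr1n => /eqP; rewrite oner_eq0.
Qed.

Definition word (r : seq 'I_m) (s : 'I_m -> R) : G :=
  foldr (fun j g => (al j (s j) * g)%g) 1%g r.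

Lemma word_linear r : exists2 K, 0 <= K & forall sg s, 0 <= sg <= 1 -> (forall j, `|s j| <= sg) ->
  fro (rho (word r s) - 1%:M - \sum_(j <- r) s j *: B j) <= K * sg ^+ 2 /\
  fro (rho (word r s) - 1%:M) <= K * sg.
Proof.
elim: r => [|i r [K K0 IH]].
  exists 0 => // sg s _ _; rewrite /word /= big_nil (orep1 rhoP) subrr subr0 fro0 !mul0r.
  by split.
have [Bgen _] := Bal; have [H [C C0 HC]] := Bgen i.
exists (K + C + fro (B i) * K + fro (B i)); first by rewrite !addr_ge0 ?mulr_ge0 ?fro_ge0.
move=> sg s sg01 ssg; have [IH1 IH2] := IH sg s sg01 ssg; have /andP[sg0 sg1] := sg01.
rewrite big_cons [word _ _]/= rhoM.
set g := word r s in IH1 IH2 *; set a := rho (al i (s i)).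
have sg2 : sg ^+ 2 <= sg by rewrite expr2 ler_piMr.
have a1 : fro (a - 1%:M - s i *: B i) <= C * sg ^+ 2.
  apply: le_trans (HC _) _; rewrite ler_wpM2l //.
  by rewrite -[leLHS]real_normK ?num_real // ler_pXn2r ?nnegrE.
have sB : fro (s i *: B i) <= fro (B i) * sg by rewrite froZ mulrC ler_wpM2l ?fro_ge0.
have bK : 0 <= fro (B i) * K by rewrite mulr_ge0 ?fro_ge0.
split.
  have -> : a *m rho g - 1%:M - (s i *: B i + \sum_(j <- r) s j *: B j) =
      (a - 1%:M - s i *: B i) *m rho g + (s i *: B i) *m (rho g - 1%:M) +
      (rho g - 1%:M - \sum_(j <- r) s j *: B j).
    move: (s i *: B i) => Y; rewrite !mulmxBl mul1mx mulmxBr mulmx1.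
    move: (a *m rho g) => X1; move: (Y *m rho g) => X2; move: (rho g) => X3.
    by move: (\sum_(j <- r) _) => X4; apply/matrixP => p q; rewrite !mxE; ring.
  apply: le_trans (froD _ _) _; apply: le_trans (lerD (froD _ _) IH1) _.
  have h1 : fro ((a - 1%:M - s i *: B i) *m rho g) <= C * sg ^+ 2 by rewrite fro_orthr.
  have h2 : fro ((s i *: B i) *m (rho g - 1%:M)) <= fro (B i) * K * sg ^+ 2.
    apply: le_trans (froM _ _) _; apply: le_trans (ler_pM _ _ sB IH2) _; rewrite ?fro_ge0 //.
    by rewrite mulrACA -expr2.
  apply: le_trans (lerD (lerD h1 h2) (lexx _)) _.
  have := mulr_ge0 (fro_ge0 (B i)) (sqr_ge0 sg).
  by move: (fro (B i)) (sg ^+ 2) => b x; lra.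
have -> : a *m rho g - 1%:M = (a - 1%:M) *m rho g + (rho g - 1%:M).
  by rewrite mulmxBl mul1mx addrA subrK.
apply: le_trans (froD _ _) _; rewrite fro_orthr //; apply: le_trans (lerD (lexx _) IH2) _.
have h1 : fro (a - 1%:M) <= C * sg + fro (B i) * sg.
  have -> : a - 1%:M = (a - 1%:M - s i *: B i) + s i *: B i by rewrite subrK.
  apply: le_trans (froD _ _) _; rewrite lerD // (le_trans a1) // ler_wpM2l //.
apply: le_trans (lerD h1 (lexx _)) _; have := mulr_ge0 bK sg0.
by move: (fro (B i)) => b; lra.
Qed.

(** The parameters are a gradient step for the squared distance to [b] along the orbit of [a]. To
    first order [a] moves by [kap *: Pw], and [orbit_nondegenerate] gives [|w - kap Pw|^2 <= (1 - 2
    kap c + kap^2 M^2) |w|^2]; for close points the quadratic remainder from [word_linear] is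
    absorbed. *)
Lemma contraction_step : exists kap q d, [/\ 0 <= q, q < 1, 0 < d & forall x y,
  let a := rho x *m v in let b := rho y *m v in
  fro (b - a) <= d ->
  fro (b - rho (word (enum 'I_m) (fun j => kap * mxdot (B j *m a) (b - a))) *m a) <= q * fro (b - a)].
Proof.
have [c [d0 [c0 d00 Hc]]] := orbit_nondegenerate.
have [K K0 HK] := word_linear (enum 'I_m).
pose bt j := fro (B j) * fro v.
have bt0 j : 0 <= bt j by rewrite mulr_ge0 ?fro_ge0.
pose bS := 1 + \sum_j bt j.
have bS0 : 0 < bS by rewrite ltr_pwDl // sumr_ge0.
have btS j : bt j <= bS by rewrite /bS (bigD1 j) //= addrCA lerDl addr_ge0 // sumr_ge0.
pose M := c + 1 + \sum_j bt j ^+ 2.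
have M2 : \sum_j bt j ^+ 2 <= M by rewrite lerDr addr_ge0 // ltW.
have cM : c <= M by rewrite /M -addrA lerDl addr_ge0 // sumr_ge0 // => j _; exact: sqr_ge0.
have M0 : 0 < M by exact: lt_le_trans cM.
(* The minimiser of [1 - 2 kap c + kap^2 M^2]; the minimum is [1 - (c / M)^2], the square of
   [q0]. *)
pose kap := c / M ^+ 2.
have kap0 : 0 < kap by rewrite divr_gt0 // exprn_gt0.
pose q0 := Num.sqrt (1 - (c / M) ^+ 2).
have cM1 : 0 < c / M <= 1 by rewrite divr_gt0 //= ler_pdivrMr // mul1r.
have q0_sqr : q0 ^+ 2 = 1 - (c / M) ^+ 2.
  by rewrite sqr_sqrtr // subr_ge0 exprn_ile1 //; case/andP: cM1 => /ltW.
have q00 : 0 <= q0 by exact: sqrtr_ge0.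
have q01 : q0 < 1.
  rewrite -(ltr_pXn2r (n := 2)) ?nnegrE // q0_sqr expr1n gtrDl oppr_lt0 exprn_gt0 //.
  by case/andP: cM1.
pose E := K * (kap * bS) ^+ 2 * fro v + 1.
have E0 : 0 < E by apply: ltr_wpDl => //; apply: mulr_ge0; [apply: mulr_ge0 => //; exact: sqr_ge0|exact: fro_ge0].
have kb0 : 0 < kap * bS by rewrite mulr_gt0.
(* In turn: [orbit_nondegenerate] applies; the parameters are at most [1], as [word_linear] asks;
   the quadratic remainder uses up at most half the gap between [q0] and [1]. *)
pose d := Num.min d0 (Num.min ((kap * bS)^-1) ((1 - q0) / (2 * E))).
have dd0 : 0 < d.
  by rewrite !lt_min d00 invr_gt0 kb0 divr_gt0 ?subr_gt0 // mulr_gt0.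
exists kap, ((1 + q0) / 2), d; split => //.
- by rewrite divr_ge0 // addr_ge0.
- by rewrite ltr_pdivrMr // mul1r; move: q01; lra.
move=> x y a b ab.
have [ab0 ab1 ab2] : [/\ fro (b - a) <= d0, fro (b - a) <= (kap * bS)^-1 &
    fro (b - a) <= (1 - q0) / (2 * E)].
  by split; apply: le_trans ab _; rewrite /d !ge_min lexx ?orbT.
set w := b - a in ab ab0 ab1 ab2 *; set L := fro w in ab ab0 ab1 ab2 *.
have L0 : 0 <= L by exact: fro_ge0.
have fa : fro a = fro v by rewrite /a fro_orthl.
have Ba j : fro (B j *m a) <= bt j by rewrite /bt -fa froM.
pose s j := kap * mxdot (B j *m a) w.
pose sg := kap * bS * L.
have sgP : 0 <= sg <= 1.
  by rewrite /sg mulr_ge0 ?(ltW kb0) //= -ler_pdivlMl // mulr1.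
have ssg j : `|s j| <= sg.
  rewrite normrM gtr0_norm // /sg -mulrA ler_wpM2l ?(ltW kap0) //.
  apply: le_trans (mxdot_le _ _) _; rewrite ler_wpM2r // (le_trans (Ba j)) //.
have [lin _] := HK sg s sgP ssg.
set W := rho (word _ _) in lin *.
pose Pw := \sum_j mxdot (B j *m a) w *: (B j *m a).
have Pww : c * L ^+ 2 <= mxdot Pw w.
  rewrite /Pw mxdot_suml; apply: le_trans (Hc x y ab0) _.
  by rewrite le_eqVlt; apply/orP; left; apply/eqP; apply: eq_bigr => j _; rewrite mxdotZl expr2.
have fPw : fro Pw <= M * L.
  apply: le_trans (fro_sum _ _) _; apply: (@le_trans _ _ (\sum_j bt j ^+ 2 * L)).
    apply: ler_sum => j _; rewrite froZ; apply: le_trans (ler_wpM2r (fro_ge0 _) (mxdot_le _ _)) _.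
    rewrite mulrAC -expr2 ler_wpM2r // ler_pXn2r ?nnegrE ?fro_ge0 //.
  by rewrite -mulr_suml ler_wpM2r.
have main : fro (w - kap *: Pw) <= q0 * L.
  rewrite -(ler_pXn2r (n := 2)) ?nnegrE ?fro_ge0 ?mulr_ge0 // fro_sqrB.
  rewrite mxdotZl froZ gtr0_norm //.
  have : fro Pw ^+ 2 <= (M * L) ^+ 2 by rewrite ler_pXn2r ?nnegrE ?fro_ge0 ?mulr_ge0 // ltW.
  rewrite -/L.
  have e1 : kap * (c * L ^+ 2) <= kap * mxdot Pw w by rewrite ler_wpM2l // ltW.
  move=> h; have e2 : kap ^+ 2 * fro Pw ^+ 2 <= kap ^+ 2 * (M * L) ^+ 2.
    by rewrite ler_wpM2l ?sqr_ge0.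
  have e3 : kap ^+ 2 * (M * L) ^+ 2 = (c / M) ^+ 2 * L ^+ 2.
    by rewrite /kap; field; rewrite gt_eqF.
  have e4 : kap * (c * L ^+ 2) = (c / M) ^+ 2 * L ^+ 2.
    by rewrite /kap; field; rewrite gt_eqF.
  rewrite e3 in e2; rewrite e4 in e1; rewrite [(kap * fro Pw) ^+ 2]exprMn [(q0 * L) ^+ 2]exprMn q0_sqr.
  move: e1 e2.
  move: (kap * mxdot Pw w) (kap ^+ 2 * fro Pw ^+ 2) ((c / M) ^+ 2) (L ^+ 2).
  by move=> p1 p2 p3 p4; lra.
have Ss : \sum_(j <- enum 'I_m) s j *: B j *m a = kap *: Pw.
  rewrite big_enum /= /Pw scaler_sumr; apply: eq_bigr => j _.
  by rewrite -scalemxAl scalerA.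
have -> : b - W *m a = (w - kap *: Pw) - (W - 1%:M - \sum_(j <- enum 'I_m) s j *: B j) *m a.
  rewrite !mulmxBl mul1mx mulmx_suml Ss /w.
  by move: (W *m a) (kap *: Pw) => X1 X2; apply/matrixP => i j; rewrite !mxE; ring.
apply: le_trans (froD _ _) _; rewrite froN.
apply: le_trans (lerD main (froM _ _)) _; rewrite fa.
have : fro (W - 1%:M - \sum_(j <- enum 'I_m) s j *: B j) * fro v <= K * sg ^+ 2 * fro v.
  by rewrite ler_wpM2r ?fro_ge0.
have -> : K * sg ^+ 2 * fro v = (E - 1) * (L * L) by rewrite /sg /E; ring.
have : E * L <= (1 - q0) / 2.
  have := ab2; rewrite invfM mulrA ler_pdivlMr // mulrC //.
move=> h1 h2; apply: le_trans (lerD (lexx _) h2) _.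
have h3 : E * L * L <= (1 - q0) / 2 * L by rewrite ler_wpM2r.
have h4 : 0 <= L * L by rewrite mulr_ge0.
by move: h3 h4; move: (E) (q0) (L) => E' q' L'; lra.
Qed.

End Spanning.
End Contraction.

(** * Lifting a homotopy to one-parameter paths *)

Section SystemRepresentation.
Variables (R : realType) (G : topologicalGroupType).
Hypothesis cG : compact [set: G].
Variables (n : nat) (e : 'I_n -> G -> R).
Hypothesis ce : forall i, continuous (e i).
Hypothesis oe : forall i j, mean (fun x => e i x * e j x) = (i == j)%:R.
Hypothesis te : forall g i x,
  e i (g * x)%g = \sum_j mean (fun y => e i (g * y)%g * e j y) * e j x.

Definition system_rep g : 'M[R]_n := \matrix_(i, j) mean (fun y => e i (g * y)%g * e j y).
Definition system_vec x : 'cV[R]_n := \col_i e i x.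

Lemma system_vecM g x : system_vec (g * x)%g = system_rep g *m system_vec x.
Proof.
apply/colP => i; rewrite !mxE te; apply: eq_bigr => j _; by rewrite !mxE.
Qed.

Lemma orep_system : orep system_rep.
Proof.
have mean_te g i (phi : G -> R) : continuous phi ->
    mean (fun y => e i (g * y)%g * phi y) = \sum_k system_rep g i k * mean (fun y => e k y * phi y).
  move=> cphi.
  transitivity (mean (fun y => \sum_k system_rep g i k * (e k y * phi y))).
    congr mean; apply/funext => y; rewrite te mulr_suml; apply: eq_bigr => k _.
    by rewrite mxE mulrA.
  rewrite mean_sum // => [|k]; last by apply: ctsM; [exact: cts_cst|exact: ctsM].
  by apply: eq_bigr => k _; rewrite meanZ //; exact: ctsM.
have ceg g i : continuous (fun y => e i (g * y)%g) by exact: cts_lmul.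
split.
- move=> g h; apply/matrixP => i j; rewrite !mxE.
  rewrite -(mean_lmul cG h^-1%g); last by apply: ctsM.
  rewrite (_ : (fun x => _) = fun x => e i (g * x)%g * e j (h^-1 * x)%g); last first.
    by apply/funext => x; rewrite -mulgA mulVKg.
  rewrite mean_te //; apply: eq_bigr => k _; congr (_ * _); rewrite mxE.
  rewrite -(mean_lmul cG h); last by apply: ctsM.
  by congr mean; apply/funext => x; rewrite mulKg.
- move=> g; apply: mulmx1C; apply/matrixP => i k; rewrite !mxE.
  transitivity (mean (fun y => e i (g * y)%g * e k (g * y)%g)).
    rewrite mean_te //; apply: eq_bigr => j _; rewrite [in RHS]mxE; congr (_ * _).
      by rewrite mxE.
    by rewrite !mxE; congr mean; apply/funext => y; rewrite mulrC.
  by rewrite (mean_lmul cG g (f := fun y => e i y * e k y)) //; exact: ctsM.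
- move=> i j; rewrite (_ : (fun x => _) = fun x => mean (fun y => e i (x * y)%g * e j y)).
    apply: (@cts_mean _ _ cG (fun p => e i (p.1 * p.2)%g * e j p.2)).
    by apply: ctsM; [exact: cts_mul2|apply: (cts_comp (@ce j)); exact: cts_snd].
  by apply/funext => x; rewrite mxE.
Qed.

End SystemRepresentation.

Section Words.
Variables (R : realType) (G : topologicalGroupType).
Hypothesis cG : compact [set: G].

(** Parameters are indexed by position, since the same generator recurs at every time step with
    another parameter. *)
Fixpoint path_word (als : seq (R -> G)) (s : nat -> R) : G :=
  if als is al :: als' then (al (s 0%N) * path_word als' (fun k => s k.+1))%g else 1%g.

Fixpoint one_params n (rho : G -> 'M[R]_n) (als : seq (R -> G)) : Prop :=
  if als is al :: als' then (exists B, one_param rho B al) /\ one_params rho als' else True.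

Lemma path_word_cat als1 als2 s : path_word (als1 ++ als2) s =
  (path_word als1 s * path_word als2 (fun k => s (size als1 + k)%N))%g.
Proof.
elim: als1 s => [|al als1 IH] s /=; first by rewrite mul1g.
by rewrite IH mulgA.
Qed.

Lemma eq_path_word als s s' : (forall k, (k < size als)%N -> s k = s' k) ->
  path_word als s = path_word als s'.
Proof.
elim: als s s' => [//|al als IH] s s' H /=.
by rewrite H // (IH _ (fun k => s' k.+1)) // => k ks; rewrite H.
Qed.

Lemma one_params_cat n (rho : G -> 'M[R]_n) als1 als2 :
  one_params rho als1 -> one_params rho als2 -> one_params rho (als1 ++ als2).
Proof. by elim: als1 => [//|al als1 IH] /= [h1 h2] h3; split=> //; exact: IH. Qed.

Section OneRep.
Variables (n : nat) (rho : G -> 'M[R]_n).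
Hypothesis rhoP : orep rho.
Let rhoM x y : rho (x * y)%g = rho x *m rho y. Proof. by have [] := rhoP. Qed.
Let rhoO x : orthogonal (rho x). Proof. by have [] := rhoP. Qed.

Lemma path_word_cvg als (T : Type) (F : set_system T) (FF : ProperFilter F)
    (s : T -> nat -> R) (t : nat -> R) : one_params rho als ->
  (forall k, (fun z => s z k) @ F --> t k) ->
  mxcvg F (fun z => rho (path_word als (s z))) (rho (path_word als t)).
Proof.
elim: als s t => [|al als IH] s t /=; first by move=> _ _; exact: mxcvg_cst.
move=> [[B P] Pals] st; rewrite rhoM.
rewrite (_ : (fun z => _) = fun z => rho (al (s z 0%N)) *m rho (path_word als (fun k => s z k.+1))).
  by apply: mxcvgM; [exact: (one_param_cvg rhoP FF P)|exact: (IH (fun z k => s z k.+1))].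
by apply/funext => z; rewrite rhoM.
Qed.

Lemma path_word0 als : one_params rho als -> rho (path_word als (fun=> 0)) = 1%:M.
Proof.
elim: als => [|al als IH] /=; first by rewrite (orep1 rhoP).
by move=> [[B P] Pals]; rewrite rhoM IH // (one_param0 rhoP P) mulmx1.
Qed.

Lemma path_word_lipschitz als : one_params rho als -> exists2 K, 0 <= K &
  forall s s' d, 0 <= d <= 1 -> (forall k, (k < size als)%N -> `|s k - s' k| <= d) ->
  fro (rho (path_word als s) - rho (path_word als s')) <= K * d.
Proof.
elim: als => [|al als IH] /=.
  by move=> _; exists 0 => // s s' d _ _; rewrite subrr fro0 mul0r.
move=> [[B P] /IH [K K0 HK]]; have [C C0 HC] := one_param_diff rhoP P.
exists (fro B + C + K); first by rewrite !addr_ge0 ?fro_ge0.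
move=> s s' d d01 H; have /andP[d0 d1] := d01.
have h1 := HK (fun k => s k.+1) (fun k => s' k.+1) d d01 (fun k => H k.+1).
have h2 : fro (rho (al (s 0%N)) - rho (al (s' 0%N))) <= (fro B + C) * d.
  apply: le_trans (HC _ _) _; have h := H 0%N isT; rewrite mulrDl lerD //.
    by rewrite ler_wpM2l ?fro_ge0.
  rewrite ler_wpM2l // (@le_trans _ _ (d ^+ 2)) ?ler_pXn2r ?nnegrE //.
  by rewrite expr2 ler_piMr.
rewrite !rhoM.
apply: le_trans (fro_triangle (rho (al (s 0%N)) *m rho (path_word als (fun k => s' k.+1))) _ _) _.
rewrite -mulmxBr -mulmxBl fro_orthl // fro_orthr // addrC.
by rewrite mulrDl lerD.
Qed.

End OneRep.

Lemma path_word_lift n0 n1 (rho0 : G -> 'M[R]_n0) (rho1 : G -> 'M[R]_n1) als :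
  orep rho0 -> orep rho1 -> one_params rho0 als ->
  exists als', [/\ size als' = size als, one_params (rho_block rho0 rho1) als' &
    forall s, rho0 (path_word als' s) = rho0 (path_word als s)].
Proof.
move=> rho0P rho1P; have [rho0M _ _] := rho0P; elim: als => [|al als IH] /=.
  by move=> _; exists [::].
move=> [[B P] /IH [als' [sz P' E]]].
have [B' [al' [Pal' Eal']]] := one_param_lift cG rho0P rho1P P.
exists (al' :: als'); split=> /=; first by rewrite sz.
  by split=> //; exists B'.
by move=> s; rewrite !rho0M Eal' E.
Qed.

(** * Following a homotopy by words *)

Section Homotopy.
Variables (X : topologicalType) (F : X * R -> X).
Hypothesis cX : compact [set: X].
Hypothesis cF : {within [set: X] `*` `[0, 1], continuous F}.
Hypothesis F0 : forall x, F (x, 0) = x.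
Variables (n : nat) (rho : G -> 'M[R]_n) (v : 'cV[R]_n) (p : X -> 'cV[R]_n).
Hypothesis rhoP : orep rho.
Hypothesis cp : forall i, continuous (fun x => p x i 0).
Hypothesis p_orbit : forall x, exists g, p x = rho g *m v.

Let A : set (X * R) := [set: X] `*` `[0, 1].

Let A_proper z : A z -> ProperFilter (within A (nbhs z)).
Proof. by move=> Az; apply: within_nbhs_proper; exact: subset_closure. Qed.

Lemma homotopy_cvg z : A z -> mxcvg (within A (nbhs z)) (fun z => p (F z)) (p (F z)).
Proof.
move=> Az i j; rewrite (ord1 j).
have FFz := A_proper Az.
have h : F @ within A (nbhs z) --> F z by move/subspace_continuousP: cF; exact.
apply: (@cvg_comp _ _ _ F (fun x => p x i 0) _ (nbhs (F z))) => //; exact: cp.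
Qed.

Lemma homotopy_slice t i : 0 <= t <= 1 -> continuous (fun x => p (F (x, t)) i 0).
Proof.
move=> t01 x; have Az : A (x, t) by split=> //=; rewrite in_itv.
have h := @homotopy_cvg (x, t) Az i 0.
apply: (@cvg_comp _ _ _ (fun x => (x, t)) (fun z => p (F z) i 0) _ (within A (nbhs (x, t)))) => //.
move=> V [[V1 V2] /= [V1x V2t] V12]; apply: filterS V1x => y V1y.
apply: (V12 (y, t)); first by split=> //=; exact: nbhs_singleton.
by split=> //=; rewrite in_itv.
Qed.

Lemma homotopy_uniform e : 0 < e -> exists m : nat, forall x t t', 0 <= t <= 1 -> 0 <= t' <= 1 ->
  `|t' - t| <= m.+1%:R^-1 -> fro (p (F (x, t')) - p (F (x, t))) <= e.
Proof.
move=> e0; have e2 : 0 < e / 2 by rewrite divr_gt0.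
have cA : compact A by apply: compact_setX => //; exact: segment_compact.
pose P (m : nat) (z : X * R) := 0 <= z.2 <= 1 -> forall t', 0 <= t' <= 1 ->
  `|t' - z.2| <= m.+1%:R^-1 -> fro (p (F (z.1, t')) - p (F z)) <= e.
have := iffLR (compact_near_coveringP A) cA nat \oo P _ => H.
have [m Hm] : exists m, A `<=` P m; last first.
  exists m => x t t' t01 t'01 tt'.
  have Axt : A (x, t) by split=> //=; rewrite in_itv.
  exact: (Hm _ Axt t01 t' t'01 tt').
apply: (@filter_ex _ \oo); apply: H => -[x0 t0] Az0.
have FFz := A_proper Az0.
have h1 : (fun z => fro (p (F z) - p (F (x0, t0)))) @ within A (nbhs (x0, t0)) --> (0 : R).
  rewrite -[X in _ --> X](fro0 R n 1) -[X in fro X](subrr (p (F (x0, t0)))).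
  by apply: mxcvg_fro; apply: mxcvgB; [exact: homotopy_cvg|exact: mxcvg_cst].
have h2 : \forall z \near within A (nbhs (x0, t0)), `|fro (p (F z) - p (F (x0, t0)))| < e / 2.
  exact: (cvgr0_norm_lt _ h1).
have [[V1 V2] /= [V1x /nbhs_ballP [r /= r0 V2t]] V12] := h2.
have r2 : 0 < r / 2 by rewrite divr_gt0.
exists (V1 `*` ball t0 (r / 2), [set m : nat | m.+1%:R^-1 < r / 2]).
  split=> /=; first by exists (V1, ball t0 (r / 2)) => //=; split=> //; exact: nbhsx_ballx.
  have /cvgrPdist_lt/(_ _ r2) := @cvg_harmonic R.
  by apply: filterS => k; rewrite sub0r normrN ger0_norm // ltW // invr_gt0.
move=> [[x t] m] /= [[V1x' tb] mr] t01 t' t'01 tt'.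
have step s : 0 <= s <= 1 -> ball t0 r s -> fro (p (F (x, s)) - p (F (x0, t0))) < e / 2.
  move=> s01 sb; rewrite -[X in X < _](ger0_norm (fro_ge0 _)).
  by apply: (V12 (x, s)) => /=; [split=> //; exact: V2t|split=> //=; rewrite in_itv].
apply: le_trans (fro_triangle (p (F (x0, t0))) _ _) _; rewrite [e]splitr lerD //.
  apply/ltW/step => //; move: tb; rewrite -!ball_normE /= => tb.
  rewrite (le_lt_trans (ler_distD t _ _)) // [r]splitr ltrD // distrC (le_lt_trans tt') //.
rewrite froB; apply/ltW/step => //; move: tb; rewrite -!ball_normE /= => tb.
by rewrite (lt_trans tb) // ltr_pdivrMr // ltr_pMr // ltr1n.
Qed.

(** Over the time steps the error stays at most [q * de]: moving the target adds at most
    [(1 - q) * de], so the points are within [de <= d] and one contraction step restores the bound.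
    New letters are prepended, since the step starts from the point [a x] already reached, which
    lies on the orbit of [v]. *)
Lemma homotopy_word e : 0 < e -> exists als (S : nat -> X -> R), [/\ one_params rho als,
  forall k, continuous (S k) &
  forall x, fro (p (F (x, 1)) - rho (path_word als (fun k => S k x)) *m p x) <= e].
Proof.
move=> e0; have [rhoM rhoO _] := rhoP.
have [m [B [al Bal]]] := spanning_exists rho.
have [kap [q [d [q0 q1 d0 Hstep]]]] := contraction_step cG rhoP Bal v.
pose de := Num.min e d; have de0 : 0 < de by rewrite lt_min e0.
have eta0 : 0 < (1 - q) * de by rewrite mulr_gt0 // subr_gt0.
have [N HN] := homotopy_uniform eta0.
suff : forall i, (i <= N.+1)%N -> exists als (S : nat -> X -> R), [/\ one_params rho als,
    forall k, continuous (S k) &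
    forall x, fro (p (F (x, i%:R * N.+1%:R^-1)) - rho (path_word als (fun k => S k x)) *m p x) <= q * de].
  move=> /(_ N.+1 (leqnn _)) [als [S [h1 h2 h3]]]; exists als, S; split=> // x.
  have := h3 x; rewrite mulfV // => /le_trans; apply.
  apply: (@le_trans _ _ de); last by rewrite ge_min lexx.
  by rewrite ler_piMl ?(ltW de0) // ltW.
elim=> [_|i IH iN].
  exists [::], (fun _ _ => 0); split=> //; first by move=> k; exact: cts_cst.
  by move=> x; rewrite mul0r F0 (orep1 rhoP) mul1mx subrr fro0 mulr_ge0 // ltW.
have [als [S [Pals cS HS]]] := IH (ltnW iN).
have time_in k : (k <= N.+1)%N -> 0 <= (k%:R * N.+1%:R^-1 : R) <= 1.
  by move=> kN; rewrite mulr_ge0 ?invr_ge0 //= ler_pdivrMr ?ltr0n // mul1r ler_nat.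
set t' := (i.+1%:R * N.+1%:R^-1).
pose a x := rho (path_word als (fun k => S k x)) *m p x.
pose s (j : 'I_m) x := kap * mxdot (B j *m a x) (p (F (x, t')) - a x).
pose alsn := [seq al j | j <- enum 'I_m].
(* The first [m] parameters belong to the new letters; the older ones are shifted by [m]. *)
pose Sn k := if (k < m)%N then (if insub k is Some j then s j else fun=> 0) else S (k - m)%N.
have ca x : mxcvg (nbhs x) a (a x).
  apply: mxcvgM; last by move=> j j'; rewrite (ord1 j'); exact: (@cp j x).
  by apply: (path_word_cvg rhoP _ Pals) => k; exact: (@cS k x).
have cs j : continuous (s j).
  move=> x; apply: cvgM; first exact: cvg_cst.
  apply: mxcvg_mxdot; first by apply: mxcvgM; [exact: mxcvg_cst|exact: (@ca x)].
  apply: mxcvgB; last exact: (@ca x).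
  by move=> k k'; rewrite (ord1 k'); apply: homotopy_slice; exact: time_in.
have sz : size alsn = m by rewrite size_map size_enum_ord.
exists (alsn ++ als), Sn; split.
- apply: one_params_cat => //; rewrite /alsn; elim: (enum _) => //= j r IHr.
  by split=> //; exists (B j); have [h _] := Bal.
- move=> k; rewrite /Sn; case: ifP => km; last exact: cS.
  by case: insubP => [j _ _|_]; [exact: cs|exact: cts_cst].
move=> x.
have -> : path_word (alsn ++ als) (fun k => Sn k x) =
    (word al (enum 'I_m) (fun j => s j x) * path_word als (fun k => S k x))%g.
  rewrite path_word_cat; congr (_ * _)%g; last first.
    by apply: eq_path_word => k _; rewrite /Sn sz ltnNge leq_addr /= addKn.
  suff gen (r : seq 'I_m) (f : nat -> R) : (forall k, (k < size r)%N ->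
        forall j0, f k = s (nth j0 r k) x) ->
      path_word [seq al j | j <- r] f = word al r (fun j => s j x).
    apply: gen => k; rewrite size_enum_ord => km j0; rewrite /Sn km.
    case: insubP => [j _ jk|]; last by rewrite km.
    by congr (s _ x); apply: val_inj; rewrite /= nth_enum_ord.
  elim: r f => [//|j r IHr] f Hf /=; rewrite (Hf 0%N isT j) /= IHr // => k kr j0.
  exact: (Hf k.+1 kr j0).
rewrite rhoM -mulmxA -/(a x).
have [gx Hgx] := p_orbit x; have [gy Hgy] := p_orbit (F (x, t')).
have ax : a x = rho (path_word als (fun k => S k x) * gx)%g *m v by rewrite /a Hgx mulmxA rhoM.
have close : fro (p (F (x, t')) - a x) <= de.
  apply: le_trans (fro_triangle (p (F (x, i%:R * N.+1%:R^-1))) _ _) _.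
  have -> : de = (1 - q) * de + q * de by ring.
  apply: lerD; last exact: HS.
  apply: HN; [exact: time_in (ltnW iN)|exact: time_in|].
  rewrite /t' -mulrBl -natrB // subSnn mul1r ger0_norm // invr_ge0 //.
have close_d : fro (p (F (x, t')) - a x) <= d by apply: le_trans close _; rewrite ge_min lexx orbT.
move: close_d close; rewrite /s ax Hgy => close_d close.
apply: le_trans (Hstep _ _ close_d) _.
by rewrite ler_wpM2l.
Qed.

End Homotopy.
End Words.

(** * Coset spaces *)

Section CosetSpaceTopology.
Local Open Scope quotient_scope.
Variables (R : realType) (G : topologicalGroupType) (H : set G).
Hypothesis HG : group_closed [in H].

Definition coset_pi (g : G) : coset_space H := \pi_({eq_quot left_coset_equiv H}) g.

Lemma coset_pi_continuous : continuous coset_pi.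
Proof. exact: pi_continuous. Qed.

Lemma coset_pi_surj x : exists g, coset_pi g = x.
Proof. by exists (repr (x : {eq_quot left_coset_equiv H})); exact: reprK. Qed.

Lemma coset_pi_eq g g' : coset_pi g = coset_pi g' <-> H (g^-1 * g')%g.
Proof.
split=> [/eqquotP|h]; last apply/eqquotP.
  by rewrite /= left_coset_relE // => /set_mem.
by rewrite /= left_coset_relE //; exact: mem_set.
Qed.

Lemma coset_space_compact : compact [set: G] -> compact [set: coset_space H].
Proof.
move=> cG; have -> : [set: coset_space H] = coset_pi @` [set: G].
  by apply/seteqP; split=> // x _; have [g <-] := coset_pi_surj x; exists g.
apply: continuous_compact => //; apply: continuous_subspaceT; exact: coset_pi_continuous.
Qed.

Definition coset_lift (T : Type) (f : G -> T) (x : coset_space H) : T :=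
  f (repr (x : {eq_quot left_coset_equiv H})).

Lemma coset_lift_pi (T : Type) (f : G -> T) g :
  (forall x h, H h -> f (x * h)%g = f x) -> coset_lift f (coset_pi g) = f g.
Proof.
move=> fH; rewrite /coset_lift.
set r := repr _.
have : coset_pi r = coset_pi g by exact: reprK.
by move=> /coset_pi_eq h; rewrite -(fH _ _ h) mulVKg.
Qed.

Lemma coset_lift_continuous (f : G -> R) : continuous f -> right_invariant H f ->
  continuous (coset_lift f).
Proof.
move=> cf fH; apply: (iffRL (quotient_continuous (coset_lift f))).
rewrite (_ : _ \o _ = f) //; apply/funext => g; exact: coset_lift_pi.
Qed.

(** A Urysohn function for the two cosets in [G] is made right invariant by the supremum of its
    right translates by [H]; being constant on each of the two cosets, it keeps its values there. *)
Lemma coset_separation g0 g1 : hausdorff_space G -> compact [set: G] -> closed H ->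
  ~ H (g0^-1 * g1)%g -> exists f : G -> R, [/\ ctsH H f, f g0 = 0 & f g1 = 1].
Proof.
move=> hG cG clH Hn; have [H1 HB] := HG; have HV := group_closedV HG; have HM := group_closedM HG.
have h1 : H 1%g by exact: set_mem.
have clT g : closed [set x | H (g^-1 * x)%g].
  have cg : continuous (fun x => (g^-1 * x)%g).
    by apply: cts_mulg; [move=> x; exact: cvg_cst|exact: cts_id].
  exact: (closed_comp (f := fun x => (g^-1 * x)%g) (fun x _ => cg x) clH).
have disj : [set x | H (g0^-1 * x)%g] `&` [set x | H (g1^-1 * x)%g] = set0.
  apply/seteqP; split=> // x [/= hx0 hx1]; apply: Hn.
  have -> : (g0^-1 * g1 = g0^-1 * x * (g1^-1 * x)^-1)%g by rewrite invgM invgK mulgA mulgK.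
  by apply/set_mem/HM; [exact: mem_set|apply: HV; exact: mem_set].
have [b [cb b0 b1 _]] := @urysohn_ext_itv G R (compact_normal hG cG) _ _ 0 1 (clT g0) (clT g1) disj ltr01.
have b0' x : H (g0^-1 * x)%g -> b x = 0 by move=> hx; apply: (b0 (b x)); exists x.
have b1' x : H (g1^-1 * x)%g -> b x = 1 by move=> hx; apply: (b1 (b x)); exists x.
have cF : continuous (fun p : G * G => b (p.2 * p.1)%g).
  by apply: (cts_comp cb); apply: cts_mulg; [exact: cts_snd|exact: cts_fst].
have [cf f_ub f_le] := cts_sup cG (ex_intro _ 1%g h1 : H !=set0) cF.
set f := fun y => sup _ in cf f_ub f_le.
exists f; split.
- split=> // x h Hh; congr sup; apply/seteqP; split=> _ [k Hk <-] /=.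
    exists (h * k)%g; last by rewrite mulgA.
    by apply/set_mem/HM; exact: mem_set.
  exists (h^-1 * k)%g; last by rewrite -!mulgA mulVKg.
  by apply/set_mem/HM; [apply: HV; exact: mem_set|exact: mem_set].
- apply/eqP; rewrite eq_le; apply/andP; split.
    by apply: f_le => h Hh /=; rewrite b0' // mulKg.
  by have := f_ub _ g0 h1; rewrite /= mulg1 b0' // mulVg.
- apply/eqP; rewrite eq_le; apply/andP; split.
    by apply: f_le => h Hh /=; rewrite b1' // mulKg.
  by have := f_ub _ g1 h1; rewrite /= mulg1 b1' // mulVg.
Qed.

End CosetSpaceTopology.

(** * The self-map of the larger representation *)

Section MainArgument.
Variables (R : realType) (G : topologicalGroupType) (H : set G).
Hypothesis cG : compact [set: G].
Hypothesis HG : group_closed [in H].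
Variables (n0 : nat) (rho0 : G -> 'M[R]_n0) (P0 : G -> 'cV[R]_n0).
Hypothesis rho0P : orep rho0.
Hypothesis P0M : forall g x, P0 (g * x)%g = rho0 g *m P0 x.
Variables (als : seq (R -> G)) (f : nat -> G -> R) (d : R) (g0 g1 : G).
Hypothesis alsP : one_params rho0 als.
Hypothesis fH : forall k, ctsH H (f k).
Hypothesis d0 : 0 < d.

(* The map [Phi] below is the identity far away, hence onto; as it moves points
   inside their orbits, it can take the value [pi g1] only on the orbit of
   [pi 1]. *)
Lemma path_word_hits :
  exists y, fro (rho0 (path_word als (fun k => f k y)) *m P0 y - P0 g1) <= d.
Proof.
have [rho0M rho0O _] := rho0P.
have [K K0 HK] := path_word_lipschitz rho0P alsP.
have fP0 y : fro (P0 y) = fro (P0 1%g) by rewrite -[y]mulg1 P0M fro_orthl.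
(* An error [eta <= 1] in the parameters moves the word by at most [K * eta], and all [P0 y] have
   the norm of [P0 1]; the added [1] keeps the denominator positive. *)
pose eta := Num.min 1 (d / (K * fro (P0 1%g) + 1)).
have E0 : 0 < K * fro (P0 1%g) + 1 by rewrite ltr_wpDl // mulr_ge0 // fro_ge0.
have eta0 : 0 < eta by rewrite lt_min ltr01 divr_gt0.
have eta01 : 0 <= eta <= 1 by rewrite (ltW eta0) ge_min lexx.
have [n1 [e [eH oe te approx]]] := peter_weyl cG (fs := fun l : 'I_(size als) => f l) eta0
  (fun l => fH l).
have ce i : continuous (e i) by have [] := eH i.
pose rho1 := system_rep e; have rho1P : orep rho1 by exact: orep_system.
pose rho := rho_block rho0 rho1; have rhoP : orep rho by exact: orep_block.
have [rhoM rhoO _] := rhoP.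
have [c Hc] := choice approx.
have [als' [sz als'P Eals']] := path_word_lift cG rho0P rho1P alsP.
pose pi y := col_mx (P0 y) (system_vec e y).
have piM g y : pi (g * y)%g = rho g *m pi y.
  by rewrite /pi P0M (system_vecM te) mul_block_col !mul0mx addr0 add0r.
have fpi y : fro (pi y) = fro (pi 1%g) by rewrite -[y]mulg1 piM fro_orthl.
pose r2 := fro (pi 1%g) ^+ 2.
(* Equal to [1] on the sphere containing the orbit of [pi 1], where the parameters must stay
   unchanged, and to [0] once [|u|^2 >= r2 + 1]. *)
pose cut (u : 'cV[R]_(n0 + n1)) : R := Num.max (r2 + 1 - mxdot u u) 0.
(* A linear functional of the second block; on the orbit, for [k < size als], it is within [eta] of
   [f k]. *)
pose ell (k : nat) (u : 'cV[R]_(n0 + n1)) : R :=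
  if insub k is Some l then mxdot (\col_i c l i) (dsubmx u) else 0.
pose Phi u := rho (path_word als' (fun k => cut u * ell k u)) *m u.
have [U [UU Uoo]] := ultra_nat; have UP : ProperFilter U by exact: ultra_proper.
have cPhi (u : nat -> 'cV[R]_(n0 + n1)) l : mxcvg U u l -> mxcvg U (Phi \o u) (Phi l).
  move=> ul; apply: mxcvgM => //; apply: (path_word_cvg rhoP UP als'P) => k.
  apply: cvgM.
    have cm : continuous (fun z : R => Num.max (r2 + 1 - z) 0).
      apply: cts_max; last exact: cts_cst.
      by apply: ctsB; [exact: cts_cst|exact: cts_id].
    apply: (@cvg_comp _ _ _ (fun k => mxdot (u k) (u k)) (fun z : R => Num.max (r2 + 1 - z) 0) U
      (nbhs (mxdot l l))); first exact: mxcvg_mxdot.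
    exact: cm.
  rewrite /ell; case: insubP => [j _ _|_]; last exact: cvg_cst.
  apply: mxcvg_mxdot; first exact: mxcvg_cst.
  by move=> i j'; rewrite mxE; under eq_fun do rewrite mxE; exact: ul.
have Phi_id (u : 'cV[R]_(n0 + n1)) i : r2 + 1 <= `|u i 0| -> Phi u = u.
  move=> ui; have r21 : 1 <= r2 + 1 by rewrite lerDr sqr_ge0.
  have cut0 : cut u = 0.
    apply/max_idPr; rewrite subr_le0 (le_trans _ (mxdot_entry u i 0)) //.
    rewrite -[leRHS]real_normK ?num_real // (le_trans ui) // expr2 ler_peMr //.
    exact: le_trans ui.
  rewrite /Phi (@eq_path_word _ _ _ _ (fun=> 0)); last by move=> k _; rewrite cut0 mul0r.
  by rewrite (path_word0 rhoP) // mul1mx.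
have [u Hu] := surjective_of_id_outside UU Uoo cPhi Phi_id (pi g1).
pose g := path_word als' (fun k => cut u * ell k u).
have {}Hu : rho g *m u = pi g1 by exact: Hu.
(* [Phi] moves [u] by the group element [g], so [u] is [g^-1] applied to [pi g1], a point of the
   orbit. *)
pose y := (g^-1 * g1)%g.
have uy : u = pi y.
  by rewrite piM -Hu mulmxA -rhoM mulVg (orep1 rhoP) mul1mx.
exists y.
have cut1 : cut u = 1.
  by rewrite /cut -fro_sqr uy fpi -/r2 addrAC subrr add0r; apply/max_idPl.
have ell_f k : (k < size als)%N -> `|ell k u - f k y| <= eta.
  move=> ks; rewrite /ell; case: insubP => [l _ lk|]; last by rewrite ks.
  have := Hc l y; rewrite lk distrC; congr (`|_ - _| <= _).
  rewrite /mxdot; apply: eq_bigr => i _; by rewrite big_ord1 uy col_mxKd !mxE.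
have gE : rho0 g *m P0 y = P0 g1 by rewrite -P0M /y mulVKg.
have rho0g : rho0 g = rho0 (path_word als (fun k => ell k u)).
  rewrite /g Eals'; congr rho0; apply: eq_path_word => k _.
  by rewrite cut1 mul1r.
rewrite -gE rho0g -mulmxBl; apply: le_trans (froM _ _) _; rewrite fP0.
have h : fro (rho0 (path_word als (fun k => f k y)) - rho0 (path_word als (fun k => ell k u))) <= K * eta.
  by apply: HK => // k ks; rewrite distrC ell_f.
apply: le_trans (ler_wpM2r (fro_ge0 _) h) _.
have h2 : eta <= d / (K * fro (P0 1%g) + 1) by rewrite ge_min lexx orbT.
move: h2; rewrite ler_pdivlMr // mulrDr mulr1 mulrAC [eta * _]mulrC => /(le_trans _); apply.
by rewrite lerDl ltW.
Qed.

End MainArgument.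

Theorem theorem1p1 (R : realType) (G : topologicalGroupType) (H : set G) :
  hausdorff_space G -> compact [set: G] ->
  group_closed [in H] -> closed H ->
  contractible R (coset_space H) ->
  H = [set: G].
Proof.
move=> hG cG HG clH [x0 [F [cF F0 F1]]].
apply/seteqP; split=> // g _; apply: contrapT => Hg.
have [g0 g0x] := coset_pi_surj x0; pose g1 := (g0 * g)%g.
have Hn : ~ H (g0^-1 * g1)%g by rewrite /g1 mulKg.
have [phi [phiH phi0 phi1]] := coset_separation R HG hG cG clH Hn.
(* The values of [phi] at [g0] and [g1] differ by [1], more than twice this error, so [P0] must
   separate the two points. *)
have d4 : 0 < 4^-1 :> R by rewrite invr_gt0.
have [n0 [e [eH oe te approx]]] := peter_weyl cG (fs := fun _ : 'I_1 => phi) d4 (fun=> phiH).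
have ce i : continuous (e i) by have [] := eH i.
pose rho0 := system_rep e; have rho0P : orep rho0 by exact: orep_system.
pose P0 := system_vec e.
have P0M g' x : P0 (g' * x)%g = rho0 g' *m P0 x by exact: system_vecM.
have P0H x h : H h -> P0 (x * h)%g = P0 x.
  by move=> Hh; apply/colP => i; rewrite !mxE; have [_ ie] := eH i; exact: ie.
have P01 : 0 < fro (P0 g0 - P0 g1).
  rewrite fro_gt0 // subr_eq0; apply/eqP => E.
  have [c Hc] := approx 0; have := Hc g0; have := Hc g1; rewrite phi0 phi1.
  have -> : \sum_i c i * e i g1 = \sum_i c i * e i g0.
    apply: eq_bigr => i _; congr (_ * _).
    by have := congr1 (fun u : 'cV_n0 => u i 0) E; rewrite !mxE.
  rewrite !ler_distl => /andP[a1 a2] /andP[a3 a4]; move: a1 a2 a3 a4.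
  by move: (\sum_i _) => z; lra.
pose p := coset_lift (H := H) P0.
have pE x : p (coset_pi H x) = P0 x by exact: coset_lift_pi.
have cp i : continuous (fun x => p x i 0).
  rewrite (_ : (fun x => _) = coset_lift (fun x => P0 x i 0)) //.
  apply: coset_lift_continuous => //.
    by rewrite (_ : (fun x => _) = e i); [exact: ce|apply/funext => x; rewrite mxE].
  by move=> x h Hh; rewrite P0H.
have p_orbit x : exists g', p x = rho0 g' *m P0 1%g.
  by have [g' <-] := coset_pi_surj x; exists g'; rewrite pE -P0M mulg1.
(* The word and the hitting point each cost [d], and [2 d] is less than the distance [3 d] to be
   bridged. *)
pose d := fro (P0 g0 - P0 g1) / 3; have d0 : 0 < d by rewrite divr_gt0.
have [als [S [alsP cS HS]]] := homotopy_word cG (coset_space_compact (H := H) cG) cF F0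
  rho0P cp p_orbit d0.
pose f k y := S k (coset_pi H y).
have fH k : ctsH H (f k).
  split; first by apply: (cts_comp (@cS k)); exact: coset_pi_continuous.
  move=> x h Hh; congr (S k); apply/coset_pi_eq => //.
  rewrite invgM -mulgA mulVg mulg1.
  by apply/set_mem/(group_closedV HG); exact: mem_set.
have [y Hy] := path_word_hits cG rho0P P0M g1 alsP fH d0.
have := HS (coset_pi H y); rewrite F1 -g0x !pE => HSy.
have := fro_triangle (rho0 (path_word als (fun k => f k y)) *m P0 y) (P0 g0) (P0 g1).
move=> /le_trans/(_ (lerD HSy Hy)); rewrite /d leNgt => /negP; apply.
by move: P01; move: (fro _) => z; lra.
Qed.
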